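(* Let $p\ge11$ be prime, $\widetilde H$ a (normalized) primitive projective-augmented module of type $\bar\rho$, with $\bar\rho$ très ramifiée, and $\varepsilon=\omega^{-s_\varepsilon}\times\omega^{s_\varepsilon}$ with $0\le s_\varepsilon\le p-2$. For $k=k_\varepsilon+(p-1)k_\bullet$ with $k_\bullet\in\mathbb Z_{\ge0}$, and with $t_\varepsilon=s_\varepsilon+\delta_\varepsilon+1$, $$d_k^{\mathrm{ur}}(\varepsilon_1)=\left\lfloor\frac{k_\bullet-t_\varepsilon}{p+1}\right\rfloor+1 .$$ The right-hand side is nonnegative. Moreover, $$d_{k+p^2-1}^{\mathrm{ur}}=d_k^{\mathrm{ur}}+1,\qquad d_k^{\mathrm{ur}}=\frac{k}{p^2-1}+O(1),\qquad d_k^{\mathrm{new}}=\frac{k}{p+1}+O(1),$$ where $k$ ranges over the weights $k\equiv k_\varepsilon\pmod{p-1}$, $k\ge2$.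
   Context: $G=\mathrm{GL}_2(\mathbb Q_p)$, $K=\mathrm{GL}_2(\mathbb Z_p)$, $\mathrm{Iw}\subset K$ is the subgroup of matrices upper triangular mod $p$, $I_1$ its pro-$p$ Sylow subgroup, $\Delta^2\subset K$ the diagonal torsion subgroup (identified with $(\mathbb F_p^\times)^2$), $\Pi=\left(\begin{smallmatrix}0&1\\ p&0\end{smallmatrix}\right)$. $E/\mathbb Q_p$ is a sufficiently large finite extension with ring of integers $\mathcal O$, uniformizer $\varpi$, residue field $\mathbb F$. $\omega$ is the mod $p$ cyclotomic character and also the Teichmüller character $\mathbb F_p^\times\to\mathcal O^\times$. $\bar\rho\cong\left(\begin{smallmatrix}\omega&*\\ 0&1\end{smallmatrix}\right)$ is nonsplit with extension class $c\in H^1(G_{\mathbb Q_p},\mathbb F(\omega))$ très ramifiée, i.e. $\langle c,\mathrm{ord}_p\rangle\neq0$ under the local Tate pairing with $H^1(G_{\mathbb Q_p},\mathbb F)\cong\mathrm{Hom}_{\rm cont}(\mathbb Q_p^\times,\mathbb F)$, $\mathrm{ord}_p$ being the unramified class with $\mathrm{ord}_p(p)=1$. A primitive projective-augmented module of type $\bar\rho$ is a finite projective right $\mathcal O[\![K]\!]$-module $\widetilde H$ with a continuous right $G$-action extending its $K$-action such that: (1) its quotient by $\varpi$ and all $g-1$, $g\in1+pM_2(\mathbb Z_p)$, is one copy of the projective envelope of $\sigma_{p-1,0}=\mathrm{Sym}^{p-1}\mathbb F^2$ over $\mathbb F[\mathrm{GL}_2(\mathbb F_p)]$; (2) $p\,\mathrm{id}$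 acts by a scalar in $\mathcal O^\times$; (3) $\widetilde H\cong\widetilde H_0\widehat\otimes_{\mathcal O}\mathcal O[\![1+p\mathbb Z_p]\!]$ as $G$-modules, where scalars in $1+p\mathbb Z_p$ act trivially on $\widetilde H_0$ and $G$ acts on the second factor through the projection of $\det g\in\mathbb Q_p^\times=p^{\mathbb Z}\times\mu_{p-1}\times(1+p\mathbb Z_p)$ to $1+p\mathbb Z_p$. Normalization (by finite coefficient extension and unramified twist): $p\,\mathrm{id}$ acts trivially and $\widetilde H$ has an $\mathcal O[\![I_1]\!]$-basis $e$, fixed by $\Delta^2$, with $e\Pi=-e$. $\mathrm{Sym}^{k-2}\mathcal O^2$ is the space $\mathcal O[z]^{\le k-2}$ of polynomials of degree $\le k-2$ with right $K$-action $h|_g(z)=(\gamma z+\delta)^{k-2}h\bigl(\frac{\alpha z+\beta}{\gamma z+\delta}\bigr)$, $g=\left(\begin{smallmatrix}\alpha&\beta\\ \gamma&\delta\end{smallmatrix}\right)$; for a character $\psi$ of $\Delta^2$, $\mathcal O[z]^{\le k-2}\otimes\psi$ is the same space with right $\mathrm{Iw}$-action multiplied by $\psi(\overline{\det g}/\bar\delta,\bar\delta)$. With $\varepsilon_1=\omega^{-s_\varepsilon}$, $$d_k^{\mathrm{ur}}=d_k^{\mathrm{ur}}(\varepsilon_1)=\mathrm{rank}_{\mathcal O}\mathrm{Hom}_{\mathcal O[\![K]\!]}\bigl(\widetilde H,\mathrm{Sym}^{k-2}\mathcal O^2\otimes(\varepsilon_1\circ\det)\bigr),$$ $$d_k^{\mathrm{Iw}}=\mathrm{rank}_{\mathcal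 O}\mathrm{Hom}_{\mathcal O[\![\mathrm{Iw}]\!]}\bigl(\widetilde H,\mathcal O[z]^{\le k-2}\otimes\varepsilon(1\times\omega^{2-k})\bigr),\qquad d_k^{\mathrm{new}}=d_k^{\mathrm{Iw}}-2d_k^{\mathrm{ur}}.$$ $\{x\}\in\{0,\dots,p-2\}$ is the residue of $x$ mod $p-1$; $k_\varepsilon=2+\{2s_\varepsilon\}$ and $\delta_\varepsilon=\lfloor 2s_\varepsilon/(p-1)\rfloor$. *)

(* Defs.v *)
From HB Require Import structures.
From mathcomp Require Import all_boot all_order all_algebra all_fingroup.
From mathcomp Require Import all_field all_character.
From mathcomp Require Import boolp classical_sets functions.

Set Implicit Arguments.
Unset Strict Implicit.
Unset Printing Implicit Defensive.

Import Order.TTheory GRing.Theory Num.Theory.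
Local Open Scope classical_set_scope.
Local Open Scope ring_scope.

(* Q_p, as a completion of Q for the p-adic absolute value (unique up to a
   unique isometry).  The absolute value takes its values in p^Z and 0, so it
   can be rational-valued. *)
Record padicField (p : nat) := PadicField {
  padic_sort :> fieldType;
  padic_abs : padic_sort -> rat;
  padic_prime : prime p;
  padic_abs_ge0 : forall x, 0 <= padic_abs x;
  padic_abs_eq0 : forall x, (padic_abs x == 0) = (x == 0);
  padic_absM : forall x y, padic_abs (x * y) = padic_abs x * padic_abs y;
  padic_absD : forall x y,
    padic_abs (x + y) <= Num.max (padic_abs x) (padic_abs y);
  padic_abs_nat : forall n, (0 < n)%N ->
    padic_abs n%:R = (p%:R : rat) ^- logn p n;
  padic_dense : forall x (eps : rat), 0 < eps ->
    exists q : rat, padic_abs (x - ratr q) < eps;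
  padic_complete : forall u : nat -> padic_sort,
    (forall eps : rat, 0 < eps -> exists N, forall m n,
       (N <= m)%N -> (N <= n)%N -> padic_abs (u m - u n) < eps) ->
    exists l, forall eps : rat, 0 < eps -> exists N, forall n,
       (N <= n)%N -> padic_abs (u n - l) < eps }.

Section PadicIntegers.
Variables (p : nat) (Qp : padicField p).
Local Notation abs := (@padic_abs p Qp).

Lemma padic_abs1 : abs 1 = 1.
Proof.
have := @padic_abs_nat p Qp 1%N isT.
by rewrite logn1 expr0 invr1.
Qed.

Lemma padic_absN x : abs (- x) = abs x.
Proof.
suff h : abs (-1) = 1 by rewrite -mulN1r padic_absM h mul1r.
have h : abs (-1) ^+ 2 = 1 by rewrite expr2 -padic_absM mulrNN mulr1 padic_abs1.
by apply/eqP; rewrite -(@pexpr_eq1 _ _ 2) ?padic_abs_ge0 // h.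
Qed.

Lemma padic_absB_le x y (c : rat) : abs x <= c -> abs y <= c -> abs (x - y) <= c.
Proof.
move=> hx hy; apply: le_trans (padic_absD _ _) _.
by rewrite ge_max hx padic_absN hy.
Qed.

Lemma padic_absD_le x y (c : rat) : abs x <= c -> abs y <= c -> abs (x + y) <= c.
Proof. by move=> hx hy; apply: le_trans (padic_absD _ _) _; rewrite ge_max hx. Qed.

Lemma padic_natr_neq0 : (p%:R : Qp) != 0.
Proof.
have p_gt0 := prime_gt0 (padic_prime Qp).
rewrite -(padic_abs_eq0 (p%:R : Qp)) padic_abs_nat //.
by rewrite invr_eq0 expf_eq0 pnatr_eq0 (gtn_eqF p_gt0) andbF.
Qed.

Definition zp_pred : {pred Qp} := fun x => abs x <= 1.

Fact zp_subring_closed : subring_closed zp_pred.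
Proof.
split=> [|x y hx hy|x y hx hy].
- by rewrite /zp_pred unfold_in padic_abs1.
- exact: padic_absB_le.
- rewrite /zp_pred unfold_in padic_absM -[leRHS](mulr1 1).
  by apply: ler_pM; rewrite ?padic_abs_ge0.
Qed.
HB.instance Definition _ := GRing.isSubringClosed.Build Qp zp_pred zp_subring_closed.

Record Zp := ZpElt { zp_val : Qp; _ : zp_val \in zp_pred }.
HB.instance Definition _ := [isSub for zp_val].
HB.instance Definition _ := [Choice of Zp by <:].
HB.instance Definition _ := [SubChoice_isSubComNzRing of Zp by <:].

Variable E : fieldExtType Qp.

Definition zp_in_ext : Zp -> E := in_alg E \o val.
HB.instance Definition _ := GRing.RMorphism.on zp_in_ext.

(* The ring of integers of E is the integral closure of Z_p in E; its topology is
   the p-adic one (congO below). *)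
Definition int_pred : {pred E} := fun x => `[< integralOver zp_in_ext x >].

Fact int_subring_closed : subring_closed int_pred.
Proof.
split=> [|x y|x y]; rewrite /int_pred !unfold_in.
- by apply/asboolP; apply: integral1.
- by move=> /asboolP hx /asboolP hy; apply/asboolP; apply: integral_sub.
- by move=> /asboolP hx /asboolP hy; apply/asboolP; apply: integral_mul.
Qed.
HB.instance Definition _ := GRing.isSubringClosed.Build E int_pred int_subring_closed.

Record integers := IntElt { int_val : E; _ : int_val \in int_pred }.
HB.instance Definition _ := [isSub for int_val].
HB.instance Definition _ := [Choice of integers by <:].
HB.instance Definition _ := [SubChoice_isSubComNzRing of integers by <:].

Local Notation O := integers.

(* Only meaningful on Z_p; elements of Q_p outside Z_p are sent to 0. *)
Definition toO (x : Qp) : O := insubd (0 : O) (x%:A : E).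

Definition congO (m : nat) (a b : O) := exists c : O, a - b = p%:R ^+ m * c.

Lemma congO_refl m a : congO m a a.
Proof. by exists 0; rewrite subrr mulr0. Qed.

Lemma natO_lreg m : injective ( *%R (p%:R ^+ m : O)).
Proof.
have nz : val (p%:R ^+ m : O) != 0.
  rewrite rmorphXn rmorph_nat expf_neq0 //.
  have -> : (p%:R : E) = in_alg E p%:R by rewrite rmorph_nat.
  by rewrite fmorph_eq0 padic_natr_neq0.
move=> a b /(congr1 val); rewrite !rmorphM => h; apply: val_inj.
exact: (mulfI nz h).
Qed.

(* Measures on a profinite subset A of T whose uniform structure is given by
   cong.  As A is compact, continuity and uniform continuity agree.  For an
   O-module M, the O-linear maps C(A, O) -> M are the M-valued measures on A;
   they are coded here as maps on all functions T -> O that only look at the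
   values on A and vanish on functions that are not continuous on A. *)
Section Measures.
Variables (T : Type) (cong : nat -> T -> T -> Prop) (A : set T).

Definition ucont (f : T -> O) := forall m, exists n, forall x y,
  A x -> A y -> cong n x y -> congO m (f x) (f y).

Record is_measure (M : lmodType O) (mu : (T -> O) -> M) : Prop := IsMeasure {
  measure_linear : forall c f g, ucont f -> ucont g ->
    mu (fun x => c * f x + g x) = c *: mu f + mu g;
  measure_eq : forall f g, (forall x, A x -> f x = g x) -> mu f = mu g;
  measure_out : forall f, ~ ucont f -> mu f = 0 }.

Lemma ucont_eq f g : (forall x, A x -> f x = g x) -> ucont f -> ucont g.
Proof.
move=> fg cf m; have [n h] := cf m; exists n => x y Ax Ay xy.
by rewrite -!fg //; apply: h.
Qed.

Lemma ucont0 : ucont (fun=> 0).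
Proof. by move=> m; exists 0%N => x y _ _ _; apply: congO_refl. Qed.

Hypothesis congW : forall m n x y, (m <= n)%N -> cong n x y -> cong m x y.

Lemma ucont_lin c f g : ucont f -> ucont g -> ucont (fun x => c * f x + g x).
Proof.
move=> cf cg m; have [n1 h1] := cf m; have [n2 h2] := cg m.
exists (maxn n1 n2) => x y Ax Ay xy.
have [a ha] := h1 _ _ Ax Ay (congW (leq_maxl _ _) xy).
have [b hb] := h2 _ _ Ax Ay (congW (leq_maxr _ _) xy).
exists (c * a + b); rewrite mulrDr mulrCA -ha -hb mulrBr.
by rewrite opprD addrACA.
Qed.

Lemma measure_congO (mu : (T -> O) -> O^o) f g m : is_measure mu ->
  ucont f -> ucont g -> (forall x, A x -> congO m (f x) (g x)) ->
  congO m (mu f) (mu g).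
Proof.
move=> hmu cf cg fg.
have [u hu] : exists u : T -> O, forall x, A x -> f x - g x = p%:R ^+ m * u x.
  have /choice[u hu] : forall x, exists c : O, A x -> f x - g x = p%:R ^+ m * c.
    move=> x; have [Ax|nAx] := pselect (A x); last by exists 0.
    by have [c hc] := fg _ Ax; exists c.
  by exists u.
have cu : ucont u.
  have cfg : ucont (fun x => -1 * g x + f x) by apply: ucont_lin.
  move=> k; have [n hn] := cfg (m + k)%N; exists n => x y Ax Ay xy.
  have [c hc] := hn _ _ Ax Ay xy; exists c; apply: (@natO_lreg m).
  rewrite mulrA -exprD -hc mulrBr -!hu //.
  by rewrite !mulN1r ![- g _ + _]addrC.
exists (mu u).
have -> : mu f = mu (fun x => p%:R ^+ m * u x + g x).
  by apply: (measure_eq hmu) => x Ax; rewrite -hu // subrK.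
by rewrite (measure_linear hmu) // addrK.
Qed.

End Measures.

Local Notation M2 := 'M[Qp]_2.

Definition congQ (n : nat) (x y : Qp) := abs (x - y) <= p%:R ^- n.
Definition congM (n : nat) (g h : M2) := forall i j, congQ n (g i j) (h i j).

Definition GL2Qp : set M2 := [set g : M2 | g \in unitmx].
Definition GL2Zp : set M2 :=
  [set g : M2 | (forall i j, abs (g i j) <= 1) /\ abs (\det g) = 1].

Lemma congQW m n x y : (m <= n)%N -> congQ n x y -> congQ m x y.
Proof.
move=> mn h; apply: le_trans h _.
have p_gt0 : (0 : rat) < p%:R by rewrite ltr0n prime_gt0 // (padic_prime Qp).
rewrite lef_pV2 ?posrE ?exprn_gt0 //; apply: ler_weXn2l => //.
by rewrite ler1n prime_gt0 // (padic_prime Qp).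
Qed.

Lemma congMW m n g h : (m <= n)%N -> congM n g h -> congM m g h.
Proof. by move=> mn gh i j; apply: congQW mn _. Qed.

Lemma GL2Zp1 : GL2Zp 1%:M.
Proof.
split=> [i j|]; last by rewrite det1 padic_abs1.
rewrite mxE; case: eqP => _; first by rewrite padic_abs1.
have /eqP -> : abs 0 == 0 by rewrite padic_abs_eq0.
exact: ler01.
Qed.

Lemma mulmx_abs_le (g h : M2) (c : rat) :
  (forall i j k, abs (g i k * h k j) <= c) -> forall i j, abs ((g *m h) i j) <= c.
Proof.
move=> H i j; rewrite mxE !big_ord_recl big_ord0 addr0.
by apply: padic_absD_le; apply: H.
Qed.

Lemma GL2ZpM g h : GL2Zp g -> GL2Zp h -> GL2Zp (g *m h).
Proof.
move=> [g1 gd] [h1 hd]; split; last by rewrite det_mulmx padic_absM gd hd mulr1.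
apply: mulmx_abs_le => i j k; rewrite padic_absM -[leRHS](mulr1 1).
by apply: ler_pM; rewrite ?padic_abs_ge0.
Qed.

Lemma congM_mull n g h h' : GL2Zp g -> congM n h h' -> congM n (g *m h) (g *m h').
Proof.
move=> [g1 _] hh i j; rewrite /congQ.
have -> : (g *m h) i j - (g *m h') i j = (g *m (h - h')) i j.
  by rewrite mulmxBr !mxE.
apply: mulmx_abs_le => {}i {}j k; rewrite padic_absM -[leRHS]mul1r.
apply: ler_pM; rewrite ?padic_abs_ge0 //.
by have := hh k j; rewrite /congQ !mxE.
Qed.

Lemma congM_mulr n g h h' : GL2Zp g -> congM n h h' -> congM n (h *m g) (h' *m g).
Proof.
move=> [g1 _] hh i j; rewrite /congQ.
have -> : (h *m g) i j - (h' *m g) i j = ((h - h') *m g) i j.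
  by rewrite mulmxBl !mxE.
apply: mulmx_abs_le => {}i {}j k; rewrite padic_absM -[leRHS]mulr1.
apply: ler_pM; rewrite ?padic_abs_ge0 //.
by have := hh i k; rewrite /congQ !mxE.
Qed.

(* The completed group algebra O[[K]] = lim_n O[K / K_n], K_n = 1 + p^n M_2(Z_p):
   O[K / K_n] is the O-dual of the functions on the finite set K / K_n, so the
   limit is the algebra of O-valued measures on K = GL_2(Z_p), the product
   being convolution. *)
Definition meas_pred : {pred (M2 -> O) -> O} :=
  fun mu => `[< is_measure congM GL2Zp (mu : (M2 -> O) -> O^o) >].

Fact meas_zmod_closed : zmod_closed meas_pred.
Proof.
split=> [|mu nu].
  rewrite /meas_pred unfold_in; apply/asboolP; split=> // c f g _ _.
  by rewrite scaler0 addr0.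
rewrite /meas_pred !unfold_in => /asboolP hmu /asboolP hnu; apply/asboolP.
split=> [c f g cf cg|f g fg|f cf].
- rewrite -[LHS]/(mu _ - nu _) (measure_linear hmu) // (measure_linear hnu) //.
  by rewrite -[in RHS]/(mu _ - nu _) -[in RHS]/(mu _ - nu _) scalerBr opprD addrACA.
- rewrite -[LHS]/(mu _ - nu _) -[RHS]/(mu _ - nu _).
  by rewrite (measure_eq hmu fg) (measure_eq hnu fg).
- rewrite -[LHS]/(mu _ - nu _).
  by rewrite (measure_out hmu) // (measure_out hnu) // subr0.
Qed.
HB.instance Definition _ :=
  GRing.isZmodClosed.Build ((M2 -> O) -> O) meas_pred meas_zmod_closed.

Record iwasawa := Iwasawa { meas_val :> (M2 -> O) -> O; _ : meas_val \in meas_pred }.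
HB.instance Definition _ := [isSub for meas_val].
HB.instance Definition _ := [Choice of iwasawa by <:].
HB.instance Definition _ := [SubChoice_isSubZmodule of iwasawa by <:].

Local Notation OK := iwasawa.
Local Notation contK := (ucont congM GL2Zp).

Lemma iwasawaP (mu : OK) : is_measure congM GL2Zp (meas_val mu : (M2 -> O) -> O^o).
Proof. by case: mu => mu /= h; move: (h); rewrite unfold_in => /asboolP. Qed.

Lemma iwasawaE (mu nu : OK) :
  (forall f, contK f -> mu f = nu f) -> mu = nu.
Proof.
move=> h; apply: val_inj; apply: funext => f /=.
have [cf|ncf] := pselect (contK f); first exact: h.
by rewrite (measure_out (iwasawaP mu)) // (measure_out (iwasawaP nu)).
Qed.

Lemma contK_mull f g : GL2Zp g -> contK f -> contK (fun h => f (g *m h)).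
Proof.
move=> Kg cf m; have [n hn] := cf m; exists n => x y Kx Ky xy.
by apply: hn; [apply: GL2ZpM | apply: GL2ZpM | apply: congM_mull].
Qed.

Lemma contK_conv (nu : OK) f : contK f -> contK (fun g => nu (fun h => f (g *m h))).
Proof.
move=> cf m; have [n hn] := cf m; exists n => x y Kx Ky xy.
apply: (measure_congO congMW (iwasawaP nu)); try exact: contK_mull.
by move=> h Kh; apply: hn; [apply: GL2ZpM | apply: GL2ZpM | apply: congM_mulr].
Qed.

Definition dirac_fun (g : M2) (f : M2 -> O) : O := if `[< contK f >] then f g else 0.
Definition conv_fun (mu nu : OK) (f : M2 -> O) : O :=
  if `[< contK f >] then mu (fun g => nu (fun h => f (g *m h))) else 0.

Lemma contK_asbool_eq f g : (forall x, GL2Zp x -> f x = g x) ->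
  `[< contK f >] = `[< contK g >].
Proof.
move=> fg; apply: asbool_equiv_eq; split; apply: ucont_eq => // x Kx.
by rewrite fg.
Qed.

Fact dirac_subproof g : GL2Zp g -> dirac_fun g \in meas_pred.
Proof.
move=> Kg; rewrite /meas_pred unfold_in; apply/asboolP; rewrite /dirac_fun.
split=> [c f f' cf cf'|f f' ff'|f ncf]; last by rewrite asboolF.
- by rewrite !asboolT //; apply: ucont_lin => //; apply: congMW.
- by rewrite (contK_asbool_eq ff') ff'.
Qed.

Fact conv_subproof mu nu : conv_fun mu nu \in meas_pred.
Proof.
rewrite /meas_pred unfold_in; apply/asboolP; rewrite /conv_fun.
split=> [c f f' cf cf'|f f' ff'|f ncf]; last by rewrite asboolF.
- have cff' : contK (fun x => c * f x + f' x).
    by apply: ucont_lin => //; apply: congMW.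
  rewrite !asboolT // -(measure_linear (iwasawaP mu)); try exact: contK_conv.
  apply: (measure_eq (iwasawaP mu)) => x Kx.
  by rewrite (measure_linear (iwasawaP nu)) //; apply: contK_mull.
- rewrite (contK_asbool_eq ff'); case: ifP => // _.
  apply: (measure_eq (iwasawaP mu)) => x Kx.
  by apply: (measure_eq (iwasawaP nu)) => y Ky; apply/ff'/GL2ZpM.
Qed.

(* The group element g of K, seen in O[[K]]; junk value 0 if g is not in K. *)
Definition dirac (g : M2) : OK :=
  if pselect (GL2Zp g) is left Kg then Iwasawa (dirac_subproof Kg) else 0.
Definition conv (mu nu : OK) : OK := Iwasawa (conv_subproof mu nu).

Lemma diracE g f : GL2Zp g -> contK f -> dirac g f = f g.
Proof.
move=> Kg cf; rewrite /dirac; case: pselect => // Kg' /=.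
by rewrite /dirac_fun asboolT.
Qed.

Lemma convE mu nu f : contK f ->
  conv mu nu f = mu (fun g => nu (fun h => f (g *m h))).
Proof. by move=> cf; rewrite /= /conv_fun asboolT. Qed.

Fact iw_scalar_subproof (c : O) : (fun f => c * dirac 1%:M f) \in meas_pred.
Proof.
have hd := iwasawaP (dirac 1%:M).
rewrite /meas_pred unfold_in; apply/asboolP; split=> [a f g cf cg|f g fg|f ncf].
- by rewrite (measure_linear hd) // mulrDr mulrCA.
- by rewrite (measure_eq hd fg).
- by rewrite (measure_out hd) // mulr0.
Qed.

Definition iw_scalar (c : O) : OK := Iwasawa (iw_scalar_subproof c).

Fact convA : associative conv.
Proof.
move=> mu nu rho; apply: iwasawaE => f cf.
rewrite convE // convE // (convE mu nu); last exact: contK_conv.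
apply: (measure_eq (iwasawaP mu)) => g Kg; rewrite convE; last exact: contK_mull.
apply: (measure_eq (iwasawaP nu)) => h Kh.
by apply: (measure_eq (iwasawaP rho)) => k Kk; rewrite mulmxA.
Qed.

Fact conv1l : left_id (dirac 1%:M) conv.
Proof.
move=> mu; apply: iwasawaE => f cf; rewrite convE // diracE.
- by apply: (measure_eq (iwasawaP mu)) => g Kg; rewrite mul1mx.
- exact: GL2Zp1.
- exact: contK_conv.
Qed.

Fact conv1r : right_id (dirac 1%:M) conv.
Proof.
move=> mu; apply: iwasawaE => f cf; rewrite convE //.
apply: (measure_eq (iwasawaP mu)) => g Kg; rewrite diracE ?mulmx1 //.
- exact: GL2Zp1.
- exact: contK_mull.
Qed.

Fact convDl : left_distributive conv +%R.
Proof.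
move=> mu nu rho; apply: iwasawaE => f cf; rewrite convE //.
by rewrite -[LHS]/(mu _ + nu _) -[RHS]/(conv mu rho f + conv nu rho f) !convE.
Qed.

Fact convDr : right_distributive conv +%R.
Proof.
move=> mu nu rho; apply: iwasawaE => f cf; rewrite convE //.
rewrite -[RHS]/(conv mu nu f + conv mu rho f) !convE //.
have := measure_linear (iwasawaP mu) 1 (contK_conv nu cf) (contK_conv rho cf).
rewrite scale1r => <-; apply: (measure_eq (iwasawaP mu)) => g Kg.
by rewrite mul1r.
Qed.

Fact dirac1_neq0 : dirac 1%:M != 0.
Proof.
apply/eqP => /(congr1 (fun mu : OK => mu (fun=> 1))).
rewrite diracE; last by move=> m; exists 0%N => x y _ _ _; apply: congO_refl.
- by move/eqP; rewrite oner_eq0.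
- exact: GL2Zp1.
Qed.

HB.instance Definition _ :=
  GRing.Zmodule_isNzRing.Build iwasawa convA conv1l conv1r convDl convDr dirac1_neq0.

End PadicIntegers.

Definition mx2 (R : nzRingType) (a b c d : R) : 'M[R]_2 :=
  \matrix_(i, j) if i == 0 then (if j == 0 then a else b)
                 else (if j == 0 then c else d).

(* h |-> (c z + d)^m h((a z + b) / (c z + d)) for h of degree at most m,
   g = mx2 a b c d. *)
Definition slash (R : nzRingType) (m : nat) (g : 'M[R]_2) (h : {poly R}) : {poly R} :=
  \sum_(i < m.+1) h`_i *:
    ((g 0 0 *: 'X + (g 0 1)%:P) ^+ i * (g 1 0 *: 'X + (g 1 1)%:P) ^+ (m - i)).

Section Galois.
Variables (p : nat) (Qp : padicField p) (L : closedFieldType).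
Variables (iota : {rmorphism Qp -> L}) (F : fieldType).

Definition is_algebraic_closure := forall x : L, algebraicOver iota x.

(* The absolute Galois group of Q_p; cochains are given as functions on all
   maps L -> L and only their values on the group matter. *)
Definition gal : set (L -> L) := [set s : L -> L | [/\ bijective s,
  exists f : {rmorphism L -> L}, s = f & forall x, s (iota x) = iota x]].

(* Continuity for the Krull topology and the discrete topology on T; as the
   group is compact, such a map factors through the restriction to a finite
   extension of Q_p. *)
Definition gal_cont (T : Type) (f : (L -> L) -> T) := exists S : seq L,
  forall s t, gal s -> gal t -> {in S, s =1 t} -> f s = f t.

(* The mod p cyclotomic character (F is meant to have characteristic p). *)
Definition cyclo (s : L -> L) : F :=
  xget 0 [set a | exists2 n : nat, a = n%:R &
                  forall z : L, z ^+ p = 1 -> s z = z ^+ n].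

Definition is_cocycle (c : (L -> L) -> F) := gal_cont c /\
  forall s t, gal s -> gal t -> c (s \o t) = c s + cyclo s * c t.

Definition is_coboundary (c : (L -> L) -> F) :=
  exists u, forall s, gal s -> c s = (cyclo s - 1) * u.

(* The unramified homomorphism sending every Frobenius to 1: an automorphism
   raising the roots of unity of order prime to p to the power p^m has value m;
   for m = 0 these automorphisms are those of the inertia group. *)
Definition is_ord (x : (L -> L) -> F) := [/\ gal_cont x,
  forall s t, gal s -> gal t -> x (s \o t) = x s + x t &
  forall s m, gal s ->
    (forall (n : nat) (z : L), coprime p n -> (0 < n)%N -> z ^+ n = 1 ->
       s z = z ^+ (p ^ m)) ->
    x s = m%:R].

(* The cup product of c with x vanishes in H^2(F(omega)).  The local Tate pairing
   is the cup product followed by the isomorphism H^2(F(omega)) = F. *)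
Definition cup_trivial (c x : (L -> L) -> F) := exists f : (L -> L) -> F,
  gal_cont f /\ forall s t, gal s -> gal t ->
    c s * x t = f s + cyclo s * f t - f (s \o t).

Record tres_ramifiee (rho : (L -> L) -> 'M[F]_2) : Prop := TresRamifiee {
  tr_cont : gal_cont rho;
  tr_hom : forall s t, gal s -> gal t -> rho (s \o t) = rho s *m rho t;
  tr_ext : exists (P : 'M[F]_2) (c : (L -> L) -> F),
    [/\ P \in unitmx,
        forall s, gal s -> P *m rho s *m invmx P = mx2 (cyclo s) (c s) 0 1,
        is_cocycle c, ~ is_coboundary c &
        exists x, is_ord x /\ ~ cup_trivial c x] }.

End Galois.

Section FiniteReduction.
Variables (p : nat) (F : fieldType).
Local Notation gl := {'GL_2['F_p]}.
Local Notation rep n := (mx_representation F [set: gl]%G n).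

Definition ofFp (a : 'F_p) : F := (a : nat)%:R.

(* Row vectors form a right module, x acting by right multiplication by rP x.
   Projectivity is the lifting property among finite-dimensional modules. *)
Definition is_projective n (rP : rep n) := forall n1 n2 (r1 : rep n1) (r2 : rep n2)
    (f : 'M[F]_(n1, n2)) (h : 'M[F]_(n, n2)),
  (forall x, r1 x *m f = f *m r2 x) -> row_full f ->
  (forall x, rP x *m h = h *m r2 x) ->
  exists2 k : 'M[F]_(n, n1), (forall x, rP x *m k = k *m r1 x) & k *m f = h.

(* rP, with the map pi, is a projective envelope of Sym^m F^2. *)
Record is_envelope_sym (m n : nat) (rP : rep n)
    (pi : {linear 'rV[F]_n -> {poly F}}) : Prop := IsEnvelopeSym {
  env_projective : is_projective rP;
  env_sub : forall v, (size (pi v) <= m.+1)%N;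
  env_surj : forall h : {poly F}, (size h <= m.+1)%N -> exists v, pi v = h;
  env_equiv : forall v (x : gl),
    pi (v *m rP x) = slash m (map_mx ofFp (GLval x)) (pi v);
  env_essential : forall U : 'M[F]_n, mxmodule rP U ->
    (forall h : {poly F}, (size h <= m.+1)%N -> exists2 v, (v <= U)%MS & pi v = h) ->
    row_full U }.

End FiniteReduction.

Section AugmentedModules.
Variables (p : nat) (Qp : padicField p) (E : fieldExtType Qp).
Local Notation O := (integers E).
Local Notation OK := (iwasawa E).
Local Notation M2 := 'M[Qp]_2.
Local Notation abs := (@padic_abs p Qp).

(* Together with F being a field, this makes varpi a uniformizer. *)
Definition is_residue_field (F : fieldType) (red : {rmorphism O -> F}) (varpi : O) :=
  (forall a, exists x, red x = a) /\
  (forall x, red x = 0 <-> exists y, x = varpi * y).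

Definition K1 : set M2 := [set g | GL2Zp g /\ congM 1 g 1%:M].
Definition Iw : set M2 := [set g | GL2Zp g /\ abs (g 1 0) < 1].
(* The matrices that are upper unipotent mod p. *)
Definition I1 : set M2 :=
  [set g | Iw g /\ abs (g 0 0 - 1) < 1 /\ abs (g 1 1 - 1) < 1].
Definition Delta2 : set M2 :=
  [set g : M2 | [/\ GL2Zp g, is_diag_mx g & exists2 n, (0 < n)%N & g ^+ n = 1]].
Definition Pi : M2 := mx2 0 1 p%:R 0.

Definition reduces_to (g : M2) (x : {'GL_2['F_p]}) :=
  forall i j : 'I_2, abs (g i j - (GLval x i j : nat)%:R) < 1.

(* The closed subalgebra O[[S]] of O[[K]], S a closed subgroup of K. *)
Definition supported (S : set M2) (mu : OK) :=
  forall f, ucont (@congM p Qp) (@GL2Zp p Qp) f -> (forall g, S g -> f g = 0) -> mu f = 0.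

(* The topology on O[[K]] is defined by the kernels of
   O[[K]] -> (O/p^n)[K/K_n], K_n = 1 + p^n M_2(Z_p). *)
Definition iw_nbhs (n : nat) : set OK := [set mu : OK |
  forall f : M2 -> O, (forall g h, GL2Zp g -> GL2Zp h -> congM n g h -> f g = f h) ->
    congO n (mu f) 0].


Section RightModules.
Variable H : lmodType OK^c.

Definition ract (x : H) (mu : OK) : H := (mu : OK^c) *: x.
Local Notation "x ** mu" := (ract x mu) (at level 40, left associativity).

Definition finite_projective := exists (n : nat)
  (i : {linear H -> 'rV[OK^c]_n}) (r : {linear 'rV[OK^c]_n -> H}), cancel i r.

(* The neighbourhoods of 0 of the canonical topology of a finitely generated
   O[[K]]-module. *)
Definition mod_nbhs (n : nat) : set H := [set x | exists s : seq (H * OK),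
  (forall u, u \in s -> iw_nbhs n u.2) /\ x = \sum_(u <- s) u.1 ** u.2].

End RightModules.
Local Notation "x ** mu" := (ract x mu) (at level 40, left associativity).

(* A continuous O-linear right action of GL_2(Q_p) on an O-module N whose scalar
   multiplication is sc and whose topology is given by the submodules U n. *)
Record gl2_action (N : zmodType) (sc : O -> N -> N) (U : nat -> set N)
    (act : N -> M2 -> N) : Prop := GL2Action {
  act_lin : forall g c x y, GL2Qp g -> act (sc c x + y) g = sc c (act x g) + act y g;
  act_1 : forall x, act x 1%:M = x;
  act_M : forall x g h, GL2Qp g -> GL2Qp h -> act (act x g) h = act x (g *m h);
  act_cont : forall x g n, GL2Qp g -> exists m, forall y h, U m (y - x) -> GL2Qp h ->
    congM m h g -> U n (act y h - act x g) }.

Record profinite_filtration (N : lmodType O) (U : nat -> set N) : Prop :=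
    ProfiniteFiltration {
  filt_0 : forall n, U n 0;
  filt_lin : forall n c x y, U n x -> U n y -> U n (c *: x + y);
  filt_decr : forall n x, U n.+1 x -> U n x;
  filt_index : forall n, exists s : seq N, forall x, exists2 y, y \in s & U n (x - y);
  filt_sep : forall x, (forall n, U n x) -> x = 0;
  filt_complete : forall u : nat -> N, (forall n, U n (u n.+1 - u n)) ->
    exists l, forall n, U n (l - u n) }.

Definition onepZp : set Qp := [set x | congQ 1 x 1].

(* The projection of Q_p^* = p^Z * mu_(p-1) * (1 + p Z_p) to 1 + p Z_p. *)
Definition pr1 (x : Qp) : Qp := xget 1 [set u | onepZp u /\
  exists (n : int) (z : Qp), z ^+ p.-1 = 1 /\ x = p%:R ^ n * z * u].

(* H = H0 (x) O[[1 + p Z_p]] as topological GL_2(Q_p)-modules.  The completed tensor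
   product lim_(m,n) H0 / U m [(1 + p Z_p) / (1 + p^n Z_p)] is the module of
   H0-valued measures on 1 + p Z_p; the measure Phi x is the element
   corresponding to x. *)
Definition det_factor (H : lmodType OK^c) (act : H -> M2 -> H) :=
  exists (H0 : lmodType O) (U : nat -> set H0) (act0 : H0 -> M2 -> H0)
         (Phi : H -> ((Qp -> O) -> H0)),
  [/\ profinite_filtration U,
      gl2_action (fun c x => c *: x) U act0,
      forall a x, onepZp a -> act0 x a%:M = x &
  [/\ forall x, is_measure (@congQ p Qp) onepZp (Phi x),
      forall mu, is_measure (@congQ p Qp) onepZp mu -> exists! x, Phi x = mu,
      forall c x y f, Phi (x ** iw_scalar c + y) f = c *: Phi x f + Phi y f,
      forall x g f, GL2Qp g -> ucont (@congQ p Qp) onepZp f ->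
        Phi (act x g) f = act0 (Phi x (fun a => f (a * pr1 (\det g)))) g &
      forall f n, exists m, forall x, mod_nbhs m x -> U n (Phi x f)]].

(* H / (varpi, g - 1 : g in 1 + p M_2(Z_p)), identified through q, is a projective
   envelope of Sym^(p-1) F^2. *)
Definition envelope_quotient (F : fieldType) (red : {rmorphism O -> F}) (varpi : O)
    (H : lmodType OK^c) :=
  exists (n : nat) (rP : mx_representation F [set: {'GL_2['F_p]}]%G n)
         (pi : {linear 'rV[F]_n -> {poly F}}) (q : H -> 'rV[F]_n),
  [/\ is_envelope_sym p.-1 rP pi,
      forall c x y, q (x ** iw_scalar c + y) = red c *: q x + q y,
      forall x g gb, GL2Zp g -> reduces_to g gb -> q (x ** dirac E g) = q x *m rP gb,
      forall v, exists x, q x = v &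
      forall x, q x = 0 <-> exists (y : H) (s : seq (H * M2)),
        (forall u, u \in s -> K1 u.2) /\
        x = y ** iw_scalar varpi + \sum_(u <- s) (u.1 ** dirac E u.2 - u.1)].

Record primitive_augmented (F : fieldType) (red : {rmorphism O -> F}) (varpi : O)
    (H : lmodType OK^c) (act : H -> M2 -> H) : Prop := PrimitiveAugmented {
  pam_projective : finite_projective H;
  pam_action : gl2_action (fun c x => x ** iw_scalar c) (@mod_nbhs H) act;
  pam_extends : forall x g, GL2Zp g -> act x g = x ** dirac E g;
  pam_envelope : envelope_quotient red varpi H;
  pam_central : exists u v : O, u * v = 1 /\
    forall x, act x (p%:R)%:M = x ** iw_scalar u;
  pam_det : det_factor act }.

Record normalized (H : lmodType OK^c) (act : H -> M2 -> H) (e : H) : Prop := Normalized {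
  norm_central : forall x, act x (p%:R)%:M = x;
  norm_basis : forall x, exists! mu : OK, supported I1 mu /\ x = e ** mu;
  norm_Delta2 : forall g, Delta2 g -> act e g = e;
  norm_Pi : act e Pi = - e }.

(* The Teichmuller lift of the residue class of a p-adic unit. *)
Definition teich (x : Qp) : Qp :=
  xget 0 [set z : Qp | z ^+ p.-1 = 1 /\ abs (z - x) < 1].

(* omega^n on the residue class of a p-adic unit x. *)
Definition omega_pow (n : int) (x : Qp) : O := toO E (teich x ^ n).

(* The element h . mu of the O[[K]]-module of polynomials of degree at most m
   with right action h . g = chi g *: slash m g h, i.e. the integral of
   h . g against mu.  If chi is supported on a subgroup such as Iw, then this is
   the module structure over the measures supported on that subgroup. *)
Definition pol_act (m : nat) (chi : M2 -> O) (h : {poly O}) (mu : OK) : {poly O} :=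
  \poly_(i < m.+1) mu (fun g => chi g * (slash m (map_mx (toO E) g) h)`_i).

(* Homomorphisms over O[[S]] from H to the polynomials of degree at most m twisted
   by chi; O-linearity follows, the scalars being measures supported on S. *)
Definition hom_pol (S : set M2) (m : nat) (chi : M2 -> O) (H : lmodType OK^c) :
    set (H -> {poly O}) :=
  [set phi : H -> {poly O} | [/\ forall x, (size (phi x) <= m.+1)%N,
     forall x y, phi (x + y) = phi x + phi y &
     forall x mu, supported S mu -> phi (x ** mu) = pol_act m chi (phi x) mu]].

(* The rank of an O-module of functions: the largest number of O-linearly
   independent elements. *)
Definition lin_indep (X : Type) (S : set (X -> {poly O})) (n : nat) :=
  exists b : 'I_n -> (X -> {poly O}), (forall i, S (b i)) /\
    forall c : 'I_n -> O, (forall x, \sum_i c i *: b i x = 0) -> forall i, c i = 0.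

Definition rankO (X : Type) (S : set (X -> {poly O})) : nat :=
  xget 0%N [set n | lin_indep S n /\ ~ lin_indep S n.+1].

(* The twist by omega^(-s) o det. *)
Definition chi_ur (s : nat) (g : M2) : O := omega_pow (- s%:Z) (\det g).

(* The character psi (a, d) = omega^(-s)(a) omega^(s + 2 - k)(d), that is
   eps (1 x omega^(2-k)), evaluated at (det g / delta, delta) and extended by 0
   outside Iw. *)
Definition chi_Iw (s k : nat) (g : M2) : O :=
  if `[< Iw g >] then
    omega_pow (- s%:Z) (\det g / g 1 1) * omega_pow (s%:Z + (2 - k%:Z)) (g 1 1)
  else 0.

Definition d_ur (H : lmodType OK^c) (s k : nat) : nat :=
  rankO (@hom_pol (@GL2Zp p Qp) (k - 2) (chi_ur s) H).
Definition d_Iw (H : lmodType OK^c) (s k : nat) : nat :=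
  rankO (@hom_pol Iw (k - 2) (chi_Iw s k) H).
Definition d_new (H : lmodType OK^c) (s k : nat) : int :=
  (d_Iw H s k)%:Z - 2 * (d_ur H s k)%:Z.

End AugmentedModules.

Definition k_eps (p s : nat) : nat := 2 + (2 * s) %% (p - 1).
Definition delta_eps (p s : nat) : nat := (2 * s) %/ (p - 1).
Definition t_eps (p s : nat) : nat := s + delta_eps p s + 1.

(* Main.v *)
(** By projectivity, Hom_{O[[K]]}(H, Sym^m (x) omega^{-s} o det), with m = k - 2, reduces modulo
    varpi onto Hom_{GL_2(F_p)}(H/HJ, F[z]^{<=m} (x) det^{-s}), where J is the kernel of
    O[[K]] -> F[GL_2(F_p)].  Because e is a basis over O[[I_1]], H/HJ has dimension p, hence it is
    the simple quotient St = Sym^{p-1} of the projective envelope.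

    A homomorphism from St is determined by the image a of the constant 1, an eigenvector of the
    Borel subgroup whose translates over P^1(F_p) sum to 0.  Let A(m, s) be the space of these a.
    If a(0) = 0, then a vanishes on F_p and is divisible by theta = X^p - X, on which GL_2(F_p)
    acts by det.  So A(m, s) = theta A(m-p-1, s-1) if 0 < s <= p - 2, whereas for m > 0
    A(m, 0) = F v + theta A(m-p-1, p-2) with v = - sum_d (X+d)^m.  By induction
    dim A(m, s) = floor((m + p^2 - p - (p+1)s) / (p^2 - 1)), which is d_k^ur.

    Over O[[Iw]], phi |-> phi(e) identifies the homomorphisms with the Delta^2-invariant vectors,
    spanned by the z^i with i = s mod p - 1, which gives d_k^Iw. *)

Require Import Defs.
From HB Require Import structures.
From mathcomp Require Import all_boot all_order all_algebra all_fingroup.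
From mathcomp Require Import all_field all_character.
From mathcomp Require Import boolp classical_sets functions.

Set Implicit Arguments.
Unset Strict Implicit.
Unset Printing Implicit Defensive.

Import Order.TTheory GRing.Theory Num.Theory.
Local Open Scope ring_scope.
From mathcomp Require Import ring zify lra.

(** The kernel of H -> Sym^(p-1) is pinned down from two sides. Splitting a measure along the cosets
    of 1 + p M_2(Z_p) turns an element of HJ into [e] times a measure on I_1 whose mass reduces to
    0; uniqueness of coordinates then keeps [e] out of HJ, which forces the image of HJ in the
    simple module to be 0. Conversely the p upper unipotent translates of [e] span H modulo HJ and
    map onto a space of dimension p, so nothing else is killed. The rank over O is compared with a
    dimension over F although no valuation on O is given: O is an integral closure and [varpi]
    merely generates the kernel of [red]. Instead, integral equations show that no nonzero element
    is divisible by every power of [varpi]. This gives the lower bound by infinite descent on a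
    linear relation, and the upper bound by descent on a determinant. The period p^2 - 1 comes from
    p - 1 divisions by [theta]: they bring s back, lower m by (p-1)(p+1), and meet s = 0, where the
    one new vector appears, exactly once; m = 2s mod p - 1 survives since p + 1 = 2 there. *)

Lemma ord2E (i : 'I_2) : i = if i == 0 then 0 else 1.
Proof. by apply/val_inj; case: i => [[|[|]]]. Qed.

Lemma mulmx2E (R : nzRingType) (A B : 'M[R]_2) i j :
  (A *m B) i j = A i 0 * B 0 j + A i 1 * B 1 j.
Proof.
rewrite mxE !big_ord_recl big_ord0 addr0.
by congr (_ + A i _ * B _ j); apply/val_inj.
Qed.

(** * The action of 2 x 2 matrices on polynomials *)

Section Slash.
Variable R : comNzRingType.
Implicit Types (g : 'M[R]_2) (h : {poly R}).

Definition mnum g : {poly R} := g 0 0 *: 'X + (g 0 1)%:P.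
Definition mden g : {poly R} := g 1 0 *: 'X + (g 1 1)%:P.

Lemma slashE m g h :
  slash m g h = \sum_(i < m.+1) h`_i *: (mnum g ^+ i * mden g ^+ (m - i)).
Proof. by []. Qed.

Lemma slash_linear m g c h h' :
  slash m g (c *: h + h') = c *: slash m g h + slash m g h'.
Proof.
rewrite !slashE scaler_sumr -big_split /=; apply: eq_bigr => i _.
by rewrite coefD coefZ scalerDl scalerA.
Qed.

Lemma slash0 m g : slash m g 0 = 0.
Proof. by rewrite slashE big1 // => i _; rewrite coef0 scale0r. Qed.

Lemma slashD m g h h' : slash m g (h + h') = slash m g h + slash m g h'.
Proof. by rewrite -{1}[h]scale1r slash_linear scale1r. Qed.

Lemma slashZ m g c h : slash m g (c *: h) = c *: slash m g h.
Proof. by rewrite -[c *: h]addr0 slash_linear slash0 addr0. Qed.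

Lemma slashN m g h : slash m g (- h) = - slash m g h.
Proof. by rewrite -scaleN1r slashZ scaleN1r. Qed.

Lemma slash_sum m g I (r : seq I) (P : pred I) (f : I -> {poly R}) :
  slash m g (\sum_(i <- r | P i) f i) = \sum_(i <- r | P i) slash m g (f i).
Proof. exact: (big_morph (slash m g) (slashD m g) (slash0 m g)). Qed.

Lemma slash_Xn m g i : (i <= m)%N ->
  slash m g 'X^i = mnum g ^+ i * mden g ^+ (m - i).
Proof.
move=> im; rewrite slashE (bigD1 (Ordinal (im : i < m.+1)%N)) //= coefXn eqxx scale1r.
rewrite big1 ?addr0 // => j; rewrite coefXn -val_eqE /= => /negPf ->.
by rewrite scale0r.
Qed.

Lemma size_mlin (a b : R) : (size (a *: 'X + b%:P)%R <= 2)%N.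
Proof.
apply: leq_trans (size_polyD _ _) _; rewrite geq_max size_polyC.
by rewrite (leq_trans (size_scale_leq _ _)) ?size_polyX //; case: (b != 0).
Qed.

Lemma size_exp_lin (u : {poly R}) n : (size u <= 2)%N -> (size (u ^+ n) <= n.+1)%N.
Proof.
move=> hu; apply: leq_trans (size_poly_exp_leq _ _) _; rewrite ltnS.
by case: (size u) hu => [|[|[|]]] //= _; rewrite ?mul1n // mul0n.
Qed.

Lemma size_slash m g h : (size (slash m g h) <= m.+1)%N.
Proof.
rewrite slashE; apply: (leq_trans (size_sum _ _ _)); apply/bigmax_leqP => i _.
apply: leq_trans (size_scale_leq _ _) _; apply: leq_trans (size_polyMleq _ _) _.
have h1 := size_exp_lin i (size_mlin (g 0 0) (g 0 1)).
have h2 := size_exp_lin (m - i) (size_mlin (g 1 0) (g 1 1)).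
rewrite -/(mnum g) -/(mden g) in h1 h2.
by move: (size _) (size _) (ltn_ord i) h1 h2; case: i => i _ /= a b; lia.
Qed.

Lemma poly_sumE n h : (size h <= n)%N -> h = \sum_(i < n) h`_i *: 'X^i.
Proof.
move=> hn; rewrite -poly_def; apply/polyP => i; rewrite coef_poly.
by case: ltnP => // ni; rewrite nth_default // (leq_trans hn).
Qed.

(** A polynomial with a degree bound m stands for a binary form of degree m, and substitution in
    forms is multiplicative. This drives both the composition law and multiplication by [theta]. *)
Lemma slashM m n g h h' : (size h <= m.+1)%N -> (size h' <= n.+1)%N ->
  slash (m + n) g (h * h') = slash m g h * slash n g h'.
Proof.
move=> hm hn; rewrite {1}(poly_sumE hm) {1}(poly_sumE hn) mulr_suml slash_sum.
rewrite !slashE mulr_suml; apply: eq_bigr => i _.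
rewrite mulr_sumr slash_sum mulr_sumr; apply: eq_bigr => j _.
rewrite -scalerAl -scalerAr !slashZ -exprD slash_Xn; last first.
  by case: i => i hi; case: j => j hj /=; lia.
have -> : (m + n - (i + j) = (m - i) + (n - j))%N.
  by case: i => i hi; case: j => j hj /=; lia.
rewrite -scalerAl -scalerAr !exprD; congr (_ *: (_ *: _)); ring.
Qed.

Lemma slash_exp n g (u : {poly R}) : (size u <= 2)%N ->
  slash n g (u ^+ n) = slash 1 g u ^+ n.
Proof.
move=> hu; elim: n => [|n IH]; first by rewrite !expr0 -(expr0 'X) slash_Xn ?expr0 ?mul1r.
by rewrite !exprS -add1n slashM // ?IH //; apply: size_exp_lin.
Qed.

Lemma slash1_lin g (a b : R) : slash 1 g (a *: 'X + b%:P) = a *: mnum g + b *: mden g.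
Proof.
have hX : slash 1 g 'X = mnum g by rewrite -(expr1 'X) slash_Xn // mulr1.
have h1 : slash 1 g 1 = mden g by rewrite -(expr0 'X) slash_Xn // mul1r.
by rewrite slash_linear hX -[b]mulr1 polyCM mul_polyC slashZ h1 mulr1.
Qed.

(** A right action, [g'] acting first. A monomial goes to a product of linear forms, so
    multiplicativity reduces the identity to degree 1. *)
Lemma slash_comp m g g' h : (size h <= m.+1)%N ->
  slash m g (slash m g' h) = slash m (g' *m g) h.
Proof.
move=> hm; rewrite [slash m g' h]slashE slash_sum [RHS]slashE; apply: eq_bigr => i _.
rewrite slashZ; congr (_ *: _).
have im : (i <= m)%N by rewrite -ltnS.
rewrite -{1}(subnKC im) slashM; try (apply: size_exp_lin; exact: size_mlin).
rewrite (slash_exp i) ?(slash_exp (m - i)); try exact: size_mlin.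
rewrite !slash1_lin /mnum /mden !mulmx2E.
by congr (_ ^+ _ * _ ^+ _); rewrite -!mul_polyC /= !rmorphD !rmorphM /=; ring.
Qed.

Lemma slash_id m h : (size h <= m.+1)%N -> slash m 1%:M h = h.
Proof.
move=> hm; rewrite slashE {2}(poly_sumE hm); apply: eq_bigr => i _.
by rewrite /mnum /mden !mxE /= scale1r scale0r addr0 add0r expr1n mulr1.
Qed.

Lemma slash_1 m g : slash m g 1 = mden g ^+ m.
Proof. by rewrite -(expr0 'X) slash_Xn // expr0 mul1r subn0. Qed.

Lemma slash_diag m (a d : R) h i : (i <= m)%N ->
  (slash m (mx2 a 0 0 d) h)`_i = h`_i * a ^+ i * d ^+ (m - i).
Proof.
move=> im; rewrite slashE coef_sum.
have E j : (h`_j *: (mnum (mx2 a 0 0 d) ^+ j * mden (mx2 a 0 0 d) ^+ (m - j)))`_i =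
    (i == j)%:R * (h`_j * a ^+ j * d ^+ (m - j)).
  rewrite /mnum /mden !mxE /= !scale0r addr0 add0r exprZn -polyC_exp mulrC mul_polyC.
  by rewrite !coefZ coefXn; ring.
rewrite (bigD1 (Ordinal (im : i < m.+1)%N)) //= E eqxx mul1r big1 ?addr0 // => j.
by rewrite E -val_eqE eq_sym /= => /negPf ->; rewrite mul0r.
Qed.

End Slash.

Lemma map_slash (R S : comNzRingType) (f : {rmorphism R -> S}) m g h :
  map_poly f (slash m g h) = slash m (map_mx f g) (map_poly f h).
Proof.
rewrite !slashE rmorph_sum; apply: eq_bigr => i _.
by rewrite /= map_polyZ coef_map !rmorphM /= !rmorphXn /= /mnum /mden !rmorphD /= !map_polyZ
  !map_polyX !map_polyC !mxE.
Qed.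

Lemma mul_mx2 (R : nzRingType) (a b c d a' b' c' d' : R) :
  mx2 a b c d *m mx2 a' b' c' d' =
  mx2 (a * a' + b * c') (a * b' + b * d') (c * a' + d * c') (c * b' + d * d').
Proof.
apply/matrixP => i j; rewrite mulmx2E !mxE /=.
by case: (i == 0); case: (j == 0).
Qed.

Lemma mx2_eta (R : nzRingType) (g : 'M[R]_2) : g = mx2 (g 0 0) (g 0 1) (g 1 0) (g 1 1).
Proof.
apply/matrixP => i j; rewrite mxE.
by rewrite [in LHS](ord2E i) [in LHS](ord2E j); case: (i == 0); case: (j == 0).
Qed.

Lemma det_mx2 (R : comNzRingType) (g : 'M[R]_2) :
  \det g = g 0 0 * g 1 1 - g 0 1 * g 1 0.
Proof.
rewrite (expand_det_row _ ord0) !big_ord_recl big_ord0 addr0 /cofactor !det_mx11 !mxE /=.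
rewrite expr0 expr1 mul1r mulN1r mulrN.
have E0 : lift ord0 ord0 = 1 :> 'I_2 by apply/val_inj.
have E1 : lift 1 ord0 = 0 :> 'I_2 by apply/val_inj.
by rewrite ?E0 ?E1; congr (_ - _ * _); congr (g _ _); apply/val_inj.
Qed.

Lemma map_mx2 (R S : nzRingType) (f : R -> S) (a b c d : R) :
  map_mx f (mx2 a b c d) = mx2 (f a) (f b) (f c) (f d).
Proof. by apply/matrixP => i j; rewrite !mxE; case: (i == 0); case: (j == 0). Qed.

(** * Steinberg vectors in F[z] *)

Section FiniteCount.
Variables (p : nat) (F : fieldType) (iota : {rmorphism 'F_p -> F}).
Hypotheses (p_pr : prime p) (p_gt2 : (2 < p)%N).
Implicit Types (g : 'M['F_p]_2) (a h : {poly F}).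

Local Notation pchF := (rmorph_pchar iota (pchar_Fp p_pr)).

Lemma Fp_natp : p%:R = 0 :> F.
Proof. exact: (pcharf0 pchF). Qed.

Lemma FpXp (x : 'F_p) : x ^+ p = x.
Proof. by have := expf_card x; rewrite card_Fp. Qed.

Lemma FpX_pred (x : 'F_p) : x != 0 -> x ^+ p.-1 = 1.
Proof.
move=> x0; apply: (mulfI x0).
by rewrite -exprS prednK ?prime_gt0 // FpXp mulr1.
Qed.

Lemma FpX_mod (x : 'F_p) m n : x != 0 -> m = n %[mod p.-1] -> x ^+ m = x ^+ n.
Proof.
move=> x0 mn; rewrite (divn_eq m p.-1) (divn_eq n p.-1) mn !exprD.
by rewrite ![(_ * p.-1)%N]mulnC !exprM FpX_pred // !expr1n.
Qed.

Lemma FpX_dvd (x : 'F_p) m : x != 0 -> (p.-1 %| m)%N -> x ^+ m = 1.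
Proof. by move=> x0 /eqP h; rewrite (@FpX_mod x m 0) // h mod0n. Qed.

(** Otherwise all p - 1 nonzero elements would be roots of X^r - 1, where r < p - 1 is the nonzero
    residue of s. *)
Lemma exists_FpX_neq1 s : ~~ (p.-1 %| s)%N -> exists2 x : 'F_p, x != 0 & x ^+ s != 1.
Proof.
move=> hs; set r := (s %% p.-1)%N.
have p1 : (0 < p.-1)%N by lia.
have r_gt0 : (0 < r)%N by rewrite lt0n.
have r_lt : (r < p.-1)%N by rewrite ltn_mod.
have [/existsP[x /andP[x0 xr]]|] := boolP [exists x : 'F_p, (x != 0) && (x ^+ r != 1)].
  by exists x => //; rewrite (@FpX_mod x s r) // modn_mod.
rewrite negb_exists => /forallP H; exfalso.
have nz : 'X^r - 1 != 0 :> {poly 'F_p} by rewrite -size_poly_eq0 size_XnsubC.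
have := max_poly_roots (rs := enum (predC1 (0 : 'F_p))) nz.
have h : all (root ('X^r - 1)) (enum (predC1 (0 : 'F_p))).
  apply/allP => x; rewrite mem_enum inE => x0.
  have := H x; rewrite x0 /= negbK => /eqP xr.
  by rewrite rootE !hornerE xr subrr.
move=> /(_ h (enum_uniq _)); rewrite size_XnsubC // -cardE cardC1 card_Fp //.
by rewrite ltnS leqNgt r_lt.
Qed.

Lemma sum_FpX k : (0 < k)%N ->
  \sum_(x : 'F_p) iota x ^+ k = if (p.-1 %| k)%N then -1 else 0.
Proof.
move=> k0; case: ifPn => hk.
  rewrite (bigD1 0) //= rmorph0 expr0n gtn_eqF // add0r.
  rewrite (eq_bigr (fun=> 1)) => [|x x0]; last by rewrite -rmorphXn FpX_dvd ?rmorph1.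
  have -> : \sum_(x : 'F_p | x != 0) 1 = (p.-1)%:R :> F.
    by rewrite sumr_const; congr (1 *+ _); rewrite -[in RHS](card_Fp p_pr) -(cardC1 0).
  by apply/eqP; rewrite -addr_eq0 natr1 prednK ?prime_gt0 // Fp_natp.
(* Substituting y x for x multiplies the sum by y^k, which differs from 1. *)
have [y y0 yk] := exists_FpX_neq1 hk.
set S := \sum_x _; have : S = iota y ^+ k * S.
  rewrite {1}/S (reindex_inj (mulfI y0)) mulr_sumr; apply: eq_bigr => x _.
  by rewrite rmorphM exprMn.
move=> /eqP; rewrite -subr_eq0 -{1}[S]mul1r -mulrBl mulf_eq0 => /orP[|/eqP //].
by rewrite -rmorphXn -(rmorph1 iota) -rmorphB fmorph_eq0 subr_eq0 eq_sym (negPf yk).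
Qed.

(** The Dickson form X^p Y - X Y^p at Y = 1. It has degree p but is used with weight p + 1: as a
    binary form it vanishes at every point of P^1(F_p), infinity included. *)
Definition theta : {poly F} := 'X^p - 'X.

Lemma size_theta : size theta = p.+1.
Proof.
by rewrite /theta size_polyDl ?size_polyXn // size_polyN size_polyX; lia.
Qed.

Lemma theta_neq0 : theta != 0.
Proof. by rewrite -size_poly_eq0 size_theta. Qed.

Lemma theta0 : theta`_0 = 0.
Proof. by rewrite coefB coefXn coefX eq_sym gtn_eqF ?subrr // prime_gt0. Qed.

Lemma theta_prod : theta = \prod_(x : 'F_p) ('X - (iota x)%:P).
Proof.
have := finField_genPoly 'F_p; rewrite card_Fp // => /(congr1 (map_poly iota)).
rewrite rmorphB /= map_polyXn map_polyX /theta => ->.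
by rewrite rmorph_prod; apply: eq_bigr => x _; rewrite rmorphB /= map_polyX map_polyC.
Qed.

Lemma Fp_roots_theta a : (forall x : 'F_p, a.[iota x] = 0) -> exists a', a = a' * theta.
Proof.
move=> ha; have : theta %| a.
  rewrite theta_prod -(big_map iota predT (fun z => 'X - z%:P)) /=.
  apply: uniq_roots_dvdp; last first.
    by rewrite uniq_rootsE map_inj_uniq ?index_enum_uniq //; apply: fmorph_inj.
  by apply/allP => _ /mapP[x _ ->]; rewrite rootE ha.
by move=> /dvdpP[a' ->]; exists a'.
Qed.

Definition slashFp m g a := slash m (map_mx iota g) a.
Local Notation sl := slashFp.

Lemma sl_comp m g g' a : (size a <= m.+1)%N -> sl m g (sl m g' a) = sl m (g' *m g) a.
Proof. by move=> ha; rewrite /sl slash_comp // map_mxM. Qed.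

Lemma Frobenius_lin (x y : 'F_p) :
  (iota x *: 'X + (iota y)%:P) ^+ p = iota x *: 'X^p + (iota y)%:P.
Proof.
have pch : p \in [pchar {poly F}] by rewrite pchar_poly pchF.
rewrite exprDn_pchar ?pnatE ?pch //.
by rewrite exprZn -polyC_exp -!rmorphXn !FpXp.
Qed.

Lemma sl_theta g : sl p.+1 g theta = iota (\det g) *: theta.
Proof.
have sX m' (g' : 'M[F]_2) : (0 < m')%N -> slash m' g' 'X = mnum g' * mden g' ^+ m'.-1.
  by move=> m0; rewrite -[X in slash _ _ X]expr1 slash_Xn // expr1 subn1.
rewrite /sl /theta slashD slashN sX // slash_Xn // subSn // subnn expr1 /=.
rewrite /mnum /mden !mxE !Frobenius_lin det_mx2 -!mul_polyC !(rmorphB, rmorphM) /=.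
ring.
Qed.

(* Representatives of B \ B w B, B the upper triangular Borel subgroup. *)
Definition W (d : 'F_p) : 'M['F_p]_2 := mx2 0 (-1) 1 d.

Lemma det_W d : \det (W d) = 1.
Proof. by rewrite det_mx2 !mxE /= mul0r mulr1 sub0r opprK. Qed.

(* The images of the constant 1 under the equivariant maps from the Steinberg module
   Sym^(p-1) to F[z]^(<=m) twisted by det^(-s). *)
Definition st_vec m s a := [/\ (size a <= m.+1)%N,
  forall g, g 1 0 = 0 -> \det g != 0 -> sl m g a = iota (\det g) ^+ s *: a &
  a + \sum_d sl m (W d) a = 0].

Lemma st_vec_lin m s c a b : st_vec m s a -> st_vec m s b -> st_vec m s (c *: a + b).
Proof.
move=> [sa Ba Ta] [sb Bb Tb]; split=> [|g g0 dg|].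
- rewrite (leq_trans (size_polyD _ _)) // geq_max sb (leq_trans (size_scale_leq _ _)) //.
- by rewrite /sl slash_linear [slash _ _ a]Ba // [slash _ _ b]Bb // scalerDr !scalerA mulrC.
transitivity (c *: (a + \sum_d sl m (W d) a) + (b + \sum_d sl m (W d) b)).
  rewrite scalerDr scaler_sumr addrACA -big_split; congr (_ + _).
  by apply: eq_bigr => d _; rewrite /sl slash_linear.
by rewrite Ta Tb scaler0 addr0.
Qed.

Lemma st_vec_mod m s s' a : s = s' %[mod p.-1] -> st_vec m s a -> st_vec m s' a.
Proof.
move=> ss [sa Ba Ta]; split=> // g g0 dg; rewrite Ba // -!rmorphXn.
by rewrite (FpX_mod dg ss).
Qed.

(** Multiplication by [theta] costs one determinant, absorbed by passing from s to s + 1; the [W d]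
    have determinant 1, so the trace relation is only multiplied by [theta]. *)
Lemma st_vec_theta m s a : (size a <= m.+1)%N ->
  st_vec (m + p.+1) s.+1 (a * theta) <-> st_vec m s a.
Proof.
move=> sa; have slt g : sl (m + p.+1) g (a * theta) = iota (\det g) *: (sl m g a * theta).
  by rewrite /sl slashM ?size_theta // [slash p.+1 _ _]sl_theta scalerAr.
have T : a * theta + \sum_d sl (m + p.+1) (W d) (a * theta) =
    (a + \sum_d sl m (W d) a) * theta.
  rewrite mulrDl mulr_suml; congr (_ + _); apply: eq_bigr => d _.
  by rewrite slt det_W rmorph1 scale1r.
split=> [[_ Ba Ta]|[_ Ba Ta]]; split=> //.
- move=> g g0 dg; have dg' : iota (\det g) != 0 by rewrite fmorph_eq0.
  apply: (mulIf theta_neq0); apply: (scalerI dg').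
  by rewrite -slt Ba // exprS -scalerA scalerAl.
- by move: Ta; rewrite T => /eqP; rewrite mulf_eq0 (negPf theta_neq0) orbF => /eqP.
- by rewrite (leq_trans (size_polyMleq _ _)) // size_theta; lia.
- by move=> g g0 dg; rewrite slt Ba // exprS -scalerAl scalerA.
- by rewrite T Ta mul0r.
Qed.

Lemma st_vec_coef0 m s a : ~~ (p.-1 %| s)%N -> st_vec m s a -> a`_0 = 0.
Proof.
move=> hs [sa Ba _]; have [x x0 xs] := exists_FpX_neq1 hs.
have := Ba (mx2 x 0 0 1); rewrite det_mx2 !mxE /= mulr1 mul0r subr0 => /(_ erefl x0).
move=> /(congr1 (fun q : {poly F} => q`_0)).
rewrite /sl map_mx2 rmorph0 rmorph1 slash_diag // expr0 expr1n !mulr1 coefZ => /eqP.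
rewrite -subr_eq0 -{1}[a`_0]mul1r -mulrBl mulf_eq0 => /orP[|/eqP //].
by rewrite -rmorphXn -(rmorph1 iota) -rmorphB fmorph_eq0 subr_eq0 eq_sym (negPf xs).
Qed.

Lemma coef_slash_W m d a : (sl m (W d) a)`_m = a`_0.
Proof.
rewrite /sl slashE coef_sum (bigD1 ord0) //= expr0 mul1r subn0 big1 ?addr0.
  rewrite coefZ /mden !mxE /= rmorph1 scale1r -[(iota d)%:P]opprK -polyCN.
  have := monicXsubC (- iota d) => /(monic_exp m)/monicP.
  by rewrite lead_coefE size_exp_XsubC /= => ->; rewrite mulr1.
move=> i; rewrite -val_eqE /= => i0; rewrite /mnum !mxE /= rmorph0 scale0r add0r.
rewrite -polyC_exp mul_polyC !coefZ [X in _ * (_ * X)]nth_default ?mulr0 //.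
rewrite (leq_trans (size_exp_lin _ (size_mlin _ _))) //.
by have := ltn_ord i; lia.
Qed.

(** Each of the p translates by [W d] has top coefficient a(0); they add up to p a(0) = 0 in the
    trace relation. This is the zero at infinity that divisibility by the form [theta] requires. *)
Lemma st_vec_coef_top m s a : st_vec m s a -> a`_m = 0.
Proof.
move=> [sa _ /(congr1 (fun q : {poly F} => q`_m))]; rewrite coefD coef_sum.
rewrite (eq_bigr (fun=> a`_0)) => [|d _]; last exact: coef_slash_W.
by rewrite sumr_const card_Fp // -mulr_natl Fp_natp mul0r addr0 coef0.
Qed.

Lemma horner_slash (R : comNzRingType) m (g : 'M[R]_2) (h : {poly R}) z :
  (slash m g h).[z] = \sum_(i < m.+1) h`_i * ((mnum g).[z] ^+ i * (mden g).[z] ^+ (m - i)).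
Proof.
by rewrite slashE horner_sum; apply: eq_bigr => i _; rewrite hornerZ hornerM !horner_exp.
Qed.

(** Invariance under upper unipotents makes a constant on F_p. *)
Lemma st_vec_eval m s a (x : 'F_p) : st_vec m s a -> a.[iota x] = a`_0.
Proof.
move=> [sa Ba _]; have := Ba (mx2 1 x 0 1).
rewrite det_mx2 !mxE /= mulr1 mulr0 subr0 oner_eq0 rmorph1 expr1n scale1r.
move=> /(_ erefl isT) /(congr1 (horner^~ 0)) Ba1; rewrite -horner_coef0 -Ba1.
rewrite /sl horner_slash (horner_coef_wide _ sa); apply: eq_bigr => i _.
rewrite /mnum /mden !mxE /=.
by rewrite !hornerE rmorph1 expr1n /= mulr1.
Qed.

(** The zeros on F_p give the factor [theta] of degree p; the vanishing top coefficient lowers the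
    degree once more, so the quotient fits the weight m - (p + 1). *)
Lemma st_vec_divtheta m s a : st_vec m s a -> a`_0 = 0 -> a = 0 \/
  (p.+1 <= m)%N /\ exists2 a' : {poly F}, (size a' <= (m - p.+1).+1)%N & a = a' * theta.
Proof.
move=> ha a0; have [a' Ea] : exists a', a = a' * theta.
  by apply: Fp_roots_theta => x; rewrite (st_vec_eval x ha).
have [->|nz] := eqVneq a 0; [by left | right].
have sam : (size a <= m)%N.
  have [sa _ _] := ha; rewrite leqNgt; apply/negP => ma.
  have sE : size a = m.+1 by apply/eqP; rewrite eqn_leq sa.
  by move: nz; rewrite -lead_coef_eq0 lead_coefE sE /= (st_vec_coef_top ha) eqxx.
have a'0 : a' != 0 by apply: contraNneq nz => a'0; rewrite Ea a'0 mul0r.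
have : size a = (size a' + p)%N.
  by rewrite Ea size_mul ?theta_neq0 // size_theta addnS.
rewrite -size_poly_gt0 in a'0 => sE.
by split; [lia | exists a' => //; lia].
Qed.

(** The forms X + d Y together with Y represent the points of P^1(F_p); this sums the m-th powers of
    all of them except Y. *)
Definition powsum m : {poly F} := \sum_(d : 'F_p) ('X + (iota d)%:P) ^+ m.

Lemma sl_lin m g (x y : 'F_p) :
  sl m g ((iota x *: 'X + (iota y)%:P) ^+ m) =
  (iota (x * g 0 0 + y * g 1 0) *: 'X + (iota (x * g 0 1 + y * g 1 1))%:P) ^+ m.
Proof.
rewrite /sl slash_exp ?size_mlin // slash1_lin /mnum /mden !mxE.
by congr (_ ^+ _); rewrite -!mul_polyC !(rmorphD, rmorphM) /=; ring.
Qed.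

Lemma sl_lin1 m g (y : 'F_p) :
  sl m g (('X + (iota y)%:P) ^+ m) =
  (iota (g 0 0 + y * g 1 0) *: 'X + (iota (g 0 1 + y * g 1 1))%:P) ^+ m.
Proof. by have := sl_lin m g 1 y; rewrite rmorph1 scale1r !mul1r. Qed.

Lemma lin_scale m (x y : 'F_p) : x != 0 -> (p.-1 %| m)%N ->
  (iota x *: 'X + (iota y)%:P) ^+ m = ('X + (iota (y / x))%:P) ^+ m.
Proof.
move=> x0 hm; have -> : iota x *: 'X + (iota y)%:P = iota x *: ('X + (iota (y / x))%:P).
  by rewrite scalerDr -[_ *: _%:P]mul_polyC -polyCM -rmorphM mulrCA mulfV // mulr1.
by rewrite exprZn -rmorphXn FpX_dvd // rmorph1 scale1r.
Qed.

Lemma powsum_coef0 m : (0 < m)%N -> (p.-1 %| m)%N -> (powsum m)`_0 = -1.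
Proof.
move=> m0 hm; rewrite -horner_coef0 horner_sum.
rewrite (eq_bigr (fun d => iota d ^+ m)) => [|d _]; last by rewrite !hornerE.
by rewrite sum_FpX // hm.
Qed.

(** As p - 1 divides m, the m-th power of a linear form depends only on its class in P^1(F_p). The
    Borel subgroup fixes the class of Y and permutes the others, whence the invariance. *)
Lemma st_vec_powsum m : (0 < m)%N -> (p.-1 %| m)%N -> st_vec m 0 (- powsum m).
Proof.
move=> m0 hm.
have S_inv (c e : 'F_p) : c != 0 ->
    \sum_(d : 'F_p) ('X + (iota ((e + d * c)))%:P) ^+ m = powsum m.
  by move=> c0; rewrite /powsum [RHS](reindex_inj (addrI e)) [RHS](reindex_inj (mulIf c0)).
split.
- rewrite size_polyN; apply: (leq_trans (size_sum _ _ _)); apply/bigmax_leqP => d _.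
  by apply: size_exp_lin; rewrite -['X]scale1r; apply: size_mlin.
- move=> g g0 dg; rewrite expr0 scale1r /sl slashN slash_sum; congr (- _).
  move: dg; rewrite det_mx2 g0 mulr0 subr0 mulf_eq0 negb_or => /andP[a0 d0].
  rewrite -(S_inv (g 1 1 / g 0 0) (g 0 1 / g 0 0)); last by rewrite mulf_neq0 ?invr_neq0.
  apply: eq_bigr => d _; rewrite [slash _ _ _]sl_lin1 g0 mulr0 addr0 lin_scale //.
  by rewrite mulrDl mulrA.
(* If d is nonzero, the translates of X + d by the [W e] run through all X + c up to scalars; if d =
   0 they are p copies of 1, which cancel. In total the trace relation becomes p times the power
   sum. *)
- have H (d : 'F_p) : \sum_e sl m (W e) (('X + (iota d)%:P) ^+ m) =
      if d == 0 then 0 else powsum m.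
    case: eqVneq => [->|d0].
      rewrite (eq_bigr (fun=> 1)) => [|e _]; last first.
        rewrite sl_lin1 !mxE /= !mul0r !addr0 rmorph0 scale0r add0r -polyC_exp.
        by rewrite -rmorphXn FpX_dvd ?rmorph1 // oppr_eq0 oner_eq0.
      by rewrite sumr_const card_Fp // -polyC1 -polyCMn Fp_natp polyC0.
    rewrite -(S_inv 1 (- d^-1)) ?oner_eq0 //; apply: eq_bigr => e _.
    rewrite sl_lin1 !mxE /= add0r !mulr1 lin_scale // mulrDl mulN1r.
    by rewrite [d * e / d]mulrAC mulfV // mul1r.
  rewrite (eq_bigr (fun e => - \sum_d sl m (W e) (('X + (iota d)%:P) ^+ m))); last first.
    by move=> e _; rewrite /sl slashN slash_sum.
  rewrite sumrN exchange_big /=.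
  rewrite (eq_bigr (fun d => if d == 0 then 0 else powsum m)) => [|d _]; last exact: H.
  rewrite (bigD1 0) //= add0r.
  rewrite (eq_bigr (fun=> powsum m)) => [|d /negPf -> //].
  rewrite sumr_const; have -> : #|[pred d : 'F_p | d != 0]| = p.-1.
    by rewrite -[in RHS](card_Fp p_pr) -(cardC1 0).
  rewrite -opprD -mulrS prednK ?prime_gt0 // -mulr_natl.
  by rewrite -polyC1 -polyCMn Fp_natp mul0r oppr0.
Qed.

Definition has_basis (A : {poly F} -> Prop) n := exists b : 'I_n -> {poly F},
  [/\ forall i, A (b i),
      forall c, \sum_i c i *: b i = 0 -> forall i, c i = 0 &
      forall a, A a -> exists c : 'I_n -> F, a = \sum_i c i *: b i].

Lemma has_basis0 (A : {poly F} -> Prop) : (forall a, A a -> a = 0) -> has_basis A 0.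
Proof.
move=> A0; exists (fun=> 0); split=> [[]|c _ []|a /A0 ->] //.
by exists (fun=> 0); rewrite big_ord0.
Qed.

Lemma has_basis_mul (A A' : {poly F} -> Prop) (t : {poly F}) n : t != 0 ->
  (forall a', A' a' -> A (a' * t)) ->
  (forall a, A a -> exists2 a', A' a' & a = a' * t) ->
  has_basis A' n -> has_basis A n.
Proof.
move=> t0 AA' A'A [b [Ab ib gb]]; exists (fun i => b i * t).
have E c : \sum_i c i *: (b i * t) = (\sum_i c i *: b i) * t.
  by rewrite mulr_suml; apply: eq_bigr => i _; rewrite scalerAl.
split=> [i|c|a /A'A[a' /gb[c ->] ->]]; first exact: AA'.
- by rewrite E => /eqP; rewrite mulf_eq0 (negPf t0) orbF => /eqP /ib.
- by exists c; rewrite E.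
Qed.

(** The constant term is a linear form on A with value 1 at v, so A is the line of v plus the kernel
    of this form. *)
Lemma has_basis_cons (A : {poly F} -> Prop) (v : {poly F}) n : A v -> v`_0 = 1 ->
  (forall c a b, A a -> A b -> A (c *: a + b)) ->
  has_basis (fun a => A a /\ a`_0 = 0) n -> has_basis A n.+1.
Proof.
move=> Av v1 lin [b [Ab ib gb]].
exists (fun i => if unlift ord0 i is Some j then b j else v).
have E c : \sum_i c i *: (if unlift ord0 i is Some j then b j else v) =
    c ord0 *: v + \sum_i c (lift ord0 i) *: b i.
  rewrite big_ord_recl unlift_none; congr (_ + _).
  by apply: eq_bigr => i _; rewrite liftK.
split=> [i|c|a Aa].
- by case: unliftP => // j _; case: (Ab j).
- rewrite E => h.
  have c0 : c ord0 = 0.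
    move/(congr1 (fun q : {poly F} => q`_0)): h.
    rewrite coefD coefZ v1 mulr1 coef_sum big1 ?addr0 ?coef0 // => i _.
    by rewrite coefZ (Ab i).2 mulr0.
  have ci : forall i, c (lift ord0 i) = 0.
    by apply: ib; move: h; rewrite c0 scale0r add0r.
  by move=> i; case: (unliftP ord0 i) => [j ->|->].
- have [|c Ec] := gb (- a`_0 *: v + a).
    by split; [exact: lin | rewrite coefD coefZ v1 mulr1 addNr].
  exists (fun i => if unlift ord0 i is Some j then c j else a`_0).
  rewrite E unlift_none; under eq_bigr => i _ do rewrite liftK.
  by rewrite -Ec scaleNr addNKr.
Qed.

Lemma has_basis_ext (A A' : {poly F} -> Prop) n : (forall a, A a <-> A' a) ->
  has_basis A n -> has_basis A' n.
Proof.
move=> AA' [b [Ab ib gb]]; exists b; split=> // [i|a /AA' /gb //].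
exact/AA'.
Qed.

Lemma st_vec_0 m s : st_vec m s 0.
Proof.
split=> [|g _ _|]; rewrite ?size_poly0 // /sl ?slash0 ?scaler0 //.
by rewrite add0r big1 // => d _; rewrite /sl slash0.
Qed.

(** One division by [theta]. Asking for s' = s - 1 only modulo p - 1 lets s = 0 pass to s' = p - 2;
    the clause for m <= p covers weights in which no nonzero multiple of [theta] fits. *)
Lemma has_basis_coef0 m s s' n : (s'.+1 = s %[mod p.-1])%N ->
  ((p.+1 <= m)%N -> has_basis (st_vec (m - p.+1) s') n) -> ((m <= p)%N -> n = 0%N) ->
  has_basis (fun a => st_vec m s a /\ a`_0 = 0) n.
Proof.
move=> ss H H0; have [mp|pm] := leqP m p.
  rewrite (H0 mp); apply: has_basis0 => a [Aa a0].
  by have [//|[]] := st_vec_divtheta Aa a0; rewrite ltnNge mp.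
apply: (has_basis_mul theta_neq0) (H pm).
  move=> a' Aa'; have [sa' _ _] := Aa'.
  split; last by rewrite -horner_coef0 hornerM !horner_coef0 theta0 mulr0.
  by apply: (st_vec_mod ss); rewrite -(subnK pm); apply/st_vec_theta.
move=> a [Aa a0]; have [->|[_ [a' sa' Ea]]] := st_vec_divtheta Aa a0.
  by exists 0; rewrite ?mul0r //; apply: st_vec_0.
exists a' => //; apply/(@st_vec_theta _ _ _ sa'); rewrite subnK // -Ea.
exact: st_vec_mod (esym ss) Aa.
Qed.

Lemma basis_count_rec s m : (p.+1 <= m)%N -> (s <= p - 3)%N ->
  ((m - p.+1 + (p ^ 2 - p) - p.+1 * s) %/ (p ^ 2 - 1) =
   (m + (p ^ 2 - p) - p.+1 * s.+1) %/ (p ^ 2 - 1))%N.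
Proof. by move=> pm sp; congr (_ %/ _)%N; nia. Qed.

Lemma st_vec_basis m s : (s <= p - 2)%N -> (m = 2 * s %[mod p.-1])%N ->
  has_basis (st_vec m s) ((m + (p ^ 2 - p) - p.+1 * s) %/ (p ^ 2 - 1))%N.
Proof.
have p2 : (p ^ 2 = p * p)%N by rewrite -mulnn.
elim/ltn_ind: m s => m IH [|s] sp ms.
  have hm : (p.-1 %| m)%N by rewrite /dvdn ms muln0 mod0n.
  rewrite muln0 subn0.
  have [m0|m0] := posnP m.
    rewrite m0 divn_small; last by nia.
    (* In weight 0 the top coefficient is the constant term. *)
    apply: has_basis0 => a Aa; have a0 := st_vec_coef_top Aa.
    have [//|[]] := st_vec_divtheta Aa a0; lia.
  (* Since p - 1 divides m > 0, m + p^2 - p is at least p^2 - 1: one full period, accounted for by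
     the power sum. *)
  have -> : ((m + (p ^ 2 - p)) %/ (p ^ 2 - 1) = ((m.+1 - p) %/ (p ^ 2 - 1)).+1)%N.
    have -> : (m + (p ^ 2 - p) = (m.+1 - p) + (p ^ 2 - 1))%N by have := dvdn_leq m0 hm; nia.
    have pos : (0 < p ^ 2 - 1)%N by nia.
    by rewrite divnDr ?dvdnn // divnn pos addn1.
  apply: (has_basis_cons (st_vec_powsum m0 hm)) => [|c a b|].
  - by rewrite coefN powsum_coef0 // opprK.
  - exact: st_vec_lin.
  apply: (@has_basis_coef0 _ _ (p - 2)%N) => [|pm|mp].
  - have -> : (p - 2).+1 = p.-1 by lia.
    by rewrite modnn mod0n.
  - have -> : (m.+1 - p = m - p.+1 + (p ^ 2 - p) - p.+1 * (p - 2))%N by nia.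
    apply: IH => //; first by lia.
    apply/eqP; rewrite -(eqn_modDr p.+1) subnK //.
    have -> : (2 * (p - 2) + p.+1 = 3 * p.-1)%N by lia.
    by rewrite modnMl; exact: hm.
  - rewrite divn_small //; nia.
have hs : ~~ (p.-1 %| s.+1)%N by apply/negP => /dvdn_leq; lia.
apply: (@has_basis_ext (fun a => st_vec m s.+1 a /\ a`_0 = 0)).
  by move=> a; split=> [[]//|Aa]; split=> //; apply: st_vec_coef0 Aa.
apply: (@has_basis_coef0 _ _ s) => // [pm|mp].
  rewrite -basis_count_rec //; last by lia.
  apply: IH; [lia|lia|].
  apply/eqP; rewrite -(eqn_modDr p.+1) subnK //.
  have -> : (2 * s + p.+1 = 2 * s.+1 + p.-1)%N by lia.
  by rewrite modnDr ms.
rewrite divn_small //; nia.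
Qed.

End FiniteCount.

(** * The Steinberg module Sym^(p-1) *)

Section Steinberg.
Variables (p : nat) (F : fieldType) (iota : {rmorphism 'F_p -> F}).
Hypotheses (p_pr : prime p) (p_gt2 : (2 < p)%N).
Implicit Types (g : 'M['F_p]_2) (a h : {poly F}).
Local Notation sl := (slashFp iota).
Local Notation st_vec := (st_vec iota).

Lemma Fp_roots_eq0 h : (size h <= p)%N -> (forall x : 'F_p, h.[iota x] = 0) -> h = 0.
Proof.
move=> sh /(Fp_roots_theta p_pr)[h' Eh]; have [h0|nz] := eqVneq h' 0; first by rewrite Eh h0 mul0r.
exfalso; move: sh; rewrite Eh size_mul ?theta_neq0 // size_theta //.
by move: nz; rewrite -size_poly_gt0; case: (size h') => // n _; rewrite addSn /=; lia.
Qed.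

(** Only the monomial X^(p-1) survives: x^0 sums to p = 0, and x^i to 0 for 0 < i < p - 1. *)
Lemma sum_Fp_horner h : (size h <= p)%N -> \sum_(x : 'F_p) h.[iota x] = - h`_p.-1.
Proof.
move=> sh; rewrite (eq_bigr (fun x => \sum_(i < p) h`_i * iota x ^+ i)); last first.
  by move=> x _; rewrite (horner_coef_wide _ sh).
have p1 : (p.-1 < p)%N by lia.
rewrite exchange_big (bigD1 (Ordinal p1)) //= -mulr_sumr.
rewrite sum_FpX ?dvdnn //; last by lia.
rewrite mulrN1 big1 ?addr0 // => i; rewrite -val_eqE /= => ip.
rewrite -mulr_sumr; have [->|i0] := posnP i.
  by rewrite (eq_bigr (fun=> 1)) // sumr_const card_Fp // (Fp_natp iota) // mulr0.
by rewrite sum_FpX // ifN ?mulr0 //; apply/negP => /dvdn_leq; have := ltn_ord i; lia.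
Qed.

Lemma iotaX_pred (x : 'F_p) : iota x ^+ p.-1 = (x != 0)%:R.
Proof.
rewrite -rmorphXn; have [->|x0] := eqVneq x 0; last by rewrite FpX_pred // rmorph1.
by rewrite expr0n; have -> : (p.-1 == 0)%N = false by [lia]; rewrite rmorph0.
Qed.

(* Interpolating at the p points of F_p, a polynomial h of degree < p equals
   - h_(p-1) - sum_d h(-d) (X + d)^(p-1), a combination of translates of 1; [stform m a]
   is thus the map sending 1 to a. *)
Definition stform m a h := - (h`_p.-1 *: a + \sum_d h.[iota (- d)] *: sl m (W d) a).

Lemma stform_linear m a c h h' :
  stform m a (c *: h + h') = c *: stform m a h + stform m a h'.
Proof.
rewrite /stform scalerN -opprD scalerDr scaler_sumr addrACA -big_split.
congr (- (_ + _)); first by rewrite coefD coefZ scalerDl scalerA.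
by apply: eq_bigr => d _; rewrite hornerD hornerZ scalerDl scalerA.
Qed.

Lemma stform0 m a : stform m a 0 = 0.
Proof.
by rewrite /stform coef0 scale0r add0r big1 ?oppr0 // => d _; rewrite horner0 scale0r.
Qed.

Lemma stformD m a h h' : stform m a (h + h') = stform m a h + stform m a h'.
Proof. by rewrite -{1}[h]scale1r stform_linear scale1r. Qed.

Lemma stformZ m a c h : stform m a (c *: h) = c *: stform m a h.
Proof. by rewrite -[c *: h]addr0 stform_linear stform0 addr0. Qed.

Lemma size_stform m a h : (size a <= m.+1)%N -> (size (stform m a h) <= m.+1)%N.
Proof.
move=> sa; rewrite size_polyN (leq_trans (size_polyD _ _)) // geq_max.
rewrite (leq_trans (size_scale_leq _ _)) //= (leq_trans (size_sum _ _ _)) //.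
apply/bigmax_leqP => d _.
by rewrite (leq_trans (size_scale_leq _ _)) // size_slash.
Qed.

Lemma sl_W_1 d : sl p.-1 (W d) 1 = ('X + (iota d)%:P) ^+ p.-1.
Proof. by rewrite /slashFp slash_1 /mden !mxE /= rmorph1 scale1r. Qed.

(** At x in F_p the factor (x + d)^(p-1) is 1 unless d = -x, where it is 0; so the sum over d is the
    sum of all values of h, namely - h_(p-1), minus h(x). Both sides have degree below p, so
    agreement on F_p suffices. *)
Lemma stform_id h : (size h <= p)%N -> stform p.-1 1 h = h.
Proof.
move=> sh; apply/eqP; rewrite -subr_eq0; apply/eqP; apply: Fp_roots_eq0.
  rewrite (leq_trans (size_polyD _ _)) // geq_max (size_polyN h) sh andbT.
  by have := @size_stform p.-1 1 h; rewrite size_poly1 prednK ?prime_gt0 //; apply.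
move=> x; rewrite hornerD !hornerN hornerD hornerZ hornerE mulr1 horner_sum.
rewrite (eq_bigr (fun d => h.[iota (- d)] - (d == - x)%:R * h.[iota (- d)])); last first.
  move=> d _; rewrite hornerZ sl_W_1 horner_exp !hornerE -rmorphD iotaX_pred.
  have -> : (x + d == 0) = (d == - x) by rewrite addrC addr_eq0.
  rewrite mulrC -[X in X - _]mul1r -mulrBl; congr (_ * _).
  by case: eqVneq => _; rewrite ?subrr ?subr0.
rewrite sumrB (reindex_inj oppr_inj) /=; under eq_bigr do rewrite opprK.
rewrite sum_Fp_horner // (bigD1 (- x)) //= eqxx mul1r opprK big1; last first.
  by move=> d /negPf ->; rewrite mul0r.
by rewrite addr0 addrA subrr sub0r opprK subrr.
Qed.

Lemma st_trace1 : 1 + \sum_d sl p.-1 (W d) 1 = 0 :> {poly F}.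
Proof.
have := @stform_id 1; rewrite size_poly1 => /(_ (prime_gt0 p_pr)).
rewrite /stform coef1; have -> : (p.-1 == 0)%N = false by [lia]; rewrite scale0r add0r.
under eq_bigr do rewrite hornerE scale1r.
by move=> E; rewrite -{1}E addNr.
Qed.

Lemma stform_1 m s a : st_vec m s a -> stform m a 1 = a.
Proof.
move=> [_ _ /eqP]; rewrite addr_eq0 => /eqP {2}->.
rewrite /stform coef1; have -> : (p.-1 == 0)%N = false by [lia]; rewrite scale0r add0r.
by congr (- _); apply: eq_bigr => d _; rewrite hornerE scale1r.
Qed.

(** The values of (X + e)^(p-1) at the points -d are 1 except for d = e; the trace relation cancels
    everything but that missing term. *)
Lemma stform_W m s a e : st_vec m s a ->
  stform m a (('X + (iota e)%:P) ^+ p.-1) = sl m (W e) a.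
Proof.
move=> [_ _ Ta]; rewrite /stform.
have -> : (('X + (iota e)%:P) ^+ p.-1)`_p.-1 = 1.
  by rewrite -sl_W_1 coef_slash_W // coef1.
rewrite scale1r (eq_bigr (fun d => sl m (W d) a - (d == e)%:R *: sl m (W d) a)).
  rewrite sumrB addrA Ta sub0r opprK (bigD1 e) //= eqxx scale1r big1 ?addr0 //.
  by move=> d /negPf ->; rewrite scale0r.
move=> d _; rewrite horner_exp !hornerE -rmorphD iotaX_pred addrC subr_eq0 eq_sym.
by case: (d == e); rewrite ?scale0r ?scale1r ?subrr ?subr0.
Qed.

Lemma sl_p_1 g : g 1 0 != 0 ->
  sl p.-1 g 1 = ('X + (iota (g 1 1 / g 1 0))%:P) ^+ p.-1.
Proof.
by move=> c0; rewrite /slashFp slash_1 /mden !mxE lin_scale ?dvdnn.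
Qed.

Lemma sl_p_1_upper g : g 1 0 = 0 -> \det g != 0 -> sl p.-1 g 1 = 1.
Proof.
rewrite det_mx2 => c0; rewrite c0 mulr0 subr0 mulf_eq0 negb_or => /andP[_ d0].
rewrite /slashFp slash_1 /mden !mxE c0 rmorph0 scale0r add0r -polyC_exp iotaX_pred d0.
by rewrite polyC1.
Qed.

Lemma stform_sl1 m s a g : st_vec m s a -> \det g != 0 ->
  iota (\det g) ^+ s *: stform m a (sl p.-1 g 1) = sl m g a.
Proof.
move=> Aa dg; have [sa Ba _] := Aa; have [c0|c0] := eqVneq (g 1 0) 0.
  by rewrite sl_p_1_upper // (stform_1 Aa) Ba.
rewrite sl_p_1 // (stform_W _ Aa).
(* Bruhat decomposition g = b W(g11/g10): the matrix multiplied here is the inverse of W(g11/g10),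
   which makes b upper triangular. *)
pose b := g *m mx2 (g 1 1 / g 1 0) 1 (-1) 0.
have b0 : b 1 0 = 0 by rewrite mulmx2E !mxE /= mulrC mulfVK // mulrN1 subrr.
have db : \det b = \det g.
  by rewrite det_mulmx [\det (mx2 _ _ _ _)]det_mx2 !mxE /= mulr0 mul1r sub0r opprK mulr1.
have Eg : g = b *m W (g 1 1 / g 1 0).
  rewrite -mulmxA mul_mx2 -[LHS]mulmx1; congr (_ *m _).
  apply/matrixP => i j; rewrite !mxE -val_eqE /=.
  case: i => [[|[|]]] //= _; case: j => [[|[|]]] //= _;
   rewrite ?(mulr0,mulr1,mul0r,mul1r,add0r,addr0,opprK,mulrN1,mulNr) //.
  by rewrite addNr.
by rewrite [in RHS]Eg -sl_comp // (Ba b) ?db // /slashFp slashZ.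
Qed.

(** By [stform_id] the translates of 1 span Sym^(p-1), so equivariance need only be checked on
    them. *)
Lemma stform_sl m s a g h : st_vec m s a -> \det g != 0 -> (size h <= p)%N ->
  iota (\det g) ^+ s *: stform m a (sl p.-1 g h) = sl m g (stform m a h).
Proof.
move=> Aa dg sh; have [sa _ _] := Aa.
have -> : sl p.-1 g h = -1 *: (h`_p.-1 *: sl p.-1 g 1 +
    \sum_d h.[iota (- d)] *: sl p.-1 (W d *m g) 1).
  rewrite -{1}(stform_id sh) /stform -scaleN1r /slashFp slashZ slashD slashZ slash_sum.
  congr (_ *: (_ + _)); apply: eq_bigr => d _.
  by rewrite slashZ slash_comp ?size_poly1 // -map_mxM.
have -> : sl m g (stform m a h) = -1 *: (h`_p.-1 *: sl m g a +
    \sum_d h.[iota (- d)] *: sl m (W d *m g) a).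
  rewrite /stform -scaleN1r /slashFp slashZ slashD slashZ slash_sum.
  congr (_ *: (_ + _)); apply: eq_bigr => d _.
  by rewrite slashZ slash_comp // -map_mxM.
rewrite stformZ stformD stformZ; set S := \sum_d _.
have -> : stform m a S = \sum_d stform m a (h.[iota (- d)] *: sl p.-1 (W d *m g) 1).
  exact: (big_morph (stform m a) (stformD m a) (stform0 m a)).
have CA c d (v : {poly F}) : c *: (d *: v) = d *: (c *: v) by rewrite !scalerA mulrC.
rewrite CA scalerDr CA stform_sl1 //; congr (_ *: (_ + _)).
rewrite scaler_sumr; apply: eq_bigr => d _; rewrite stformZ CA -[in RHS](stform_sl1 Aa) det_mulmx det_W ?mul1r //.
Qed.

(** The difference h(X+1) - h(X) lowers the degree, and is nonzero unless h is constant on F_p,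
    hence constant as its degree is below p. Repeating it reaches a nonzero constant, whose
    translates span. *)
Lemma st_irreducible (P : {poly F} -> Prop) h :
  (forall h, P h -> (size h <= p)%N) ->
  (forall c h h', P h -> P h' -> P (c *: h + h')) ->
  (forall g h, \det g != 0 -> P h -> P (sl p.-1 g h)) ->
  P h -> h != 0 -> forall h', (size h' <= p)%N -> P h'.
Proof.
move=> Ps Pl Pg Ph h0.
have P0 : P 0 by rewrite -(addNr h) -scaleN1r; apply: Pl.
have PZ c f : P f -> P (c *: f) by move=> Pf; rewrite -[c *: f]addr0; apply: Pl.
have PD f f' : P f -> P f' -> P (f + f') by move=> Pf Pf'; rewrite -[f]scale1r; apply: Pl.
have P1 : P 1.
  elim: {h}(size h) {-2}h (leqnn (size h)) Ph h0 => [|n IH] h.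
    by rewrite leqn0 size_poly_eq0 => ->.
  move=> sn Ph h0; have [s1|s1] := leqP (size h) 1.
    have [c Eh] : exists c, h = c%:P by exists h`_0; apply: size1_polyC.
    have c0 : c != 0 by move: h0; rewrite Eh polyC_eq0.
    have -> : 1 = c^-1 *: h by rewrite Eh -mul_polyC -polyCM mulVf.
    exact: PZ.
  have sh := Ps _ Ph.
  have sc : sl p.-1 (mx2 1 1 0 1) h = h \Po ('X + 1%:P).
    rewrite comp_polyE /slashFp slashE prednK ?prime_gt0 //.
    rewrite (big_ord_widen _ (fun i => h`_i *: ('X + 1%:P) ^+ i) sh) [RHS]big_mkcond.
    apply: eq_bigr => i _; rewrite /mnum /mden !mxE /= !rmorph1 rmorph0 scale1r scale0r.
    rewrite add0r expr1n mulr1; case: ltnP => // hi.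
    by rewrite nth_default // scale0r.
  have Ph' : P (h \Po ('X + 1%:P) - h).
    rewrite addrC -scaleN1r; apply: Pl => //; rewrite -sc; apply: Pg => //.
    by rewrite det_mx2 !mxE /= mulr1 mulr0 subr0 oner_eq0.
  have sX : size ('X + 1%:P : {poly F}) = 2 by rewrite size_polyDl ?size_polyX ?size_poly1.
  apply: IH Ph' _.
    rewrite -ltnS (leq_trans _ sn) //.
    have sz : (size (h \Po ('X + 1%:P) - h)%R <= size h)%N.
      by rewrite (leq_trans (size_polyD _ _)) // size_polyN size_comp_poly2 // maxnn.
    rewrite ltn_neqAle sz andbT; apply/eqP => E.
    have : (h \Po ('X + 1%:P) - h)`_(size h).-1 != 0.
      by rewrite -E -lead_coefE lead_coef_eq0 -size_poly_gt0 E size_poly_gt0.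
    rewrite coefB -{1}(size_comp_poly2 h sX) -!lead_coefE lead_coef_comp ?sX //.
    have -> : lead_coef ('X + 1%:P : {poly F}) = 1.
      by rewrite lead_coefDl ?size_polyX ?size_poly1 // lead_coefX.
    by rewrite expr1n mulr1 subrr eqxx.
  apply/eqP => /eqP; rewrite subr_eq0 => /eqP E.
  have hn n' : h.[n'%:R] = h.[0].
    elim: n' => // n' <-; rewrite -[in RHS]E horner_comp !hornerE.
    by rewrite natr1.
  have : h - (h.[0])%:P = 0.
    apply: Fp_roots_eq0.
      rewrite (leq_trans (size_polyD _ _)) // geq_max sh size_polyN.
      by rewrite (leq_trans (size_polyC_leq1 _)) // prime_gt0.
    move=> x; rewrite !hornerE; have -> : iota x = (nat_of_ord x)%:R.
      by rewrite -[in LHS](natr_Zp x) rmorph_nat.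
    by rewrite hn subrr.
  move=> /eqP; rewrite subr_eq0 => /eqP Eh; move: s1; rewrite Eh ltnNge.
  by rewrite size_polyC_leq1.
move=> h' sh'; rewrite -(stform_id sh') /stform -scaleN1r; apply: (PZ).
apply: (PD); first exact: PZ.
apply: (big_ind P P0 PD) => d _; apply: PZ; apply: Pg => //.
by rewrite det_W oner_eq0.
Qed.

End Steinberg.

(** * Residues and Teichmuller lifts *)

Section PadicNumbers.
Variables (p : nat) (Qp : padicField p).
Local Notation abs := (@padic_abs p Qp).
Local Notation p_pr := (padic_prime Qp).

Let p_gt0 : (0 : rat) < p%:R. Proof. by rewrite ltr0n prime_gt0 // p_pr. Qed.
Let p_gt1 : (1 : rat) < p%:R. Proof. by rewrite ltr1n prime_gt1 // p_pr. Qed.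
Let pV_gt0 : (0 : rat) < p%:R^-1. Proof. by rewrite invr_gt0. Qed.
Let pV_lt1 : (p%:R^-1 : rat) < 1. Proof. by rewrite invf_lt1. Qed.

Lemma padic_abs0 : abs 0 = 0.
Proof. by apply/eqP; rewrite padic_abs_eq0. Qed.

Lemma padic_absX x n : abs (x ^+ n) = abs x ^+ n.
Proof.
elim: n => [|n IH]; first by rewrite !expr0 padic_abs1.
by rewrite !exprS padic_absM IH.
Qed.

Lemma padic_absV x : abs x^-1 = (abs x)^-1.
Proof.
have [->|x0] := eqVneq x 0; first by rewrite !(invr0, padic_abs0).
have ax0 : abs x != 0 by rewrite padic_abs_eq0.
by apply: (mulfI ax0); rewrite -padic_absM !mulfV // padic_abs1.
Qed.

Lemma padic_absBC x y : abs (x - y) = abs (y - x).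
Proof. by rewrite -padic_absN opprB. Qed.

Lemma padic_absM_le1 x y : abs x <= 1 -> abs y <= 1 -> abs (x * y) <= 1.
Proof.
by move=> hx hy; rewrite padic_absM -[leRHS](mulr1 1) ler_pM ?padic_abs_ge0.
Qed.

Lemma padic_absX_le1 x n : abs x <= 1 -> abs (x ^+ n) <= 1.
Proof. by move=> hx; rewrite padic_absX exprn_ile1 ?padic_abs_ge0. Qed.

Lemma padic_absX_eq1 x n : abs x = 1 -> abs (x ^+ n) = 1.
Proof. by move=> hx; rewrite padic_absX hx expr1n. Qed.

Lemma padic_abs_natle1 n : abs n%:R <= 1.
Proof.
case: n => [|n]; first by rewrite padic_abs0 ler01.
by rewrite padic_abs_nat // invf_le1 ?exprn_gt0 // exprn_ege1 // ltW.
Qed.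

Lemma padic_abs_p : abs p%:R = p%:R^-1.
Proof. by rewrite padic_abs_nat ?prime_gt0 ?p_pr // lognE p_pr prime_gt0 ?p_pr // dvdnn divnn prime_gt0 ?p_pr // logn1. Qed.

Lemma padic_absD_lt x y (c : rat) : abs x < c -> abs y < c -> abs (x + y) < c.
Proof. by move=> hx hy; apply: le_lt_trans (padic_absD _ _) _; rewrite gt_max hx. Qed.

Lemma padic_absB_lt x y (c : rat) : abs x < c -> abs y < c -> abs (x - y) < c.
Proof. by move=> hx hy; apply: padic_absD_lt; rewrite ?padic_absN. Qed.

Lemma padic_abs_sum_le (I : Type) (r : seq I) (P : pred I) (f : I -> Qp) (c : rat) :
  0 <= c -> (forall i, P i -> abs (f i) <= c) -> abs (\sum_(i <- r | P i) f i) <= c.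
Proof.
move=> c0 h; elim/big_ind: _ => //; first by rewrite padic_abs0.
by move=> x y; apply: padic_absD_le.
Qed.

Lemma padic_abs_eq x y : abs (x - y) < abs y -> abs x = abs y.
Proof.
move=> h; apply/eqP; rewrite eq_le; apply/andP; split.
  by rewrite -[x](subrK y) padic_absD_le // ltW.
rewrite leNgt; apply/negP => h'.
suff : abs y < abs y by rewrite ltxx.
by rewrite -{1}[y](subKr x); apply: padic_absB_lt.
Qed.

Lemma padic_abs_dvd n : (p %| n)%N -> abs n%:R <= p%:R^-1.
Proof.
move=> /dvdnP[k ->]; rewrite natrM padic_absM padic_abs_p -[leRHS]mul1r.
by rewrite ler_pM2r // padic_abs_natle1.
Qed.

Lemma padic_abs_ndvd n : ~~ (p %| n)%N -> abs n%:R = 1.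
Proof.
case: n => [|n] h; first by rewrite dvdn0 in h.
by rewrite padic_abs_nat // lognE (negPf h) !andbF expr0 invr1.
Qed.

Lemma Fp_int_eq0 (z : int) : z%:~R = 0 :> 'F_p -> abs z%:~R <= p%:R^-1.
Proof.
have h n : n%:R = 0 :> 'F_p -> abs n%:R <= p%:R^-1.
  by move/eqP; rewrite -(dvdn_pcharf (pchar_Fp p_pr)); apply: padic_abs_dvd.
case: z => n; first exact: h.
rewrite NegzE !rmorphN /= => /eqP; rewrite oppr_eq0 padic_absN => /eqP; exact: h.
Qed.

Lemma padic_archi (eps : rat) : 0 < eps -> exists n, p%:R ^- n < eps.
Proof.
move=> e0; have [n hn] : exists n : nat, eps^-1 < n%:R.
  by exists (Num.bound eps^-1); rewrite archi_boundP // invr_ge0 ltW.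
exists n; rewrite -[ltRHS]invrK ltf_pV2 ?posrE ?exprn_gt0 ?invr_gt0 //.
by apply: lt_le_trans hn _; rewrite -natrX ler_nat ltnW // ltn_expl // prime_gt1 // p_pr.
Qed.

(** Density gives a fraction n/d close to x; since its absolute value is at most 1 and n, d are
    coprime, p does not divide d, and n/d makes sense in F_p. *)
Lemma Zp_residue x : abs x <= 1 -> exists a : 'F_p, abs (x - (a : nat)%:R) <= p%:R^-1.
Proof.
move=> x1; have [q hq] := padic_dense x pV_gt0.
have q1 : abs (ratr q) <= 1.
  rewrite -[ratr q](subKr x); apply: padic_absB_le => //.
  by rewrite ltW // (lt_trans hq).
pose d := `|denq q|%N.
have dE : denq q = d%:Z by rewrite /d absz_denq.
have d_gt0 : (0 < d)%N by rewrite absz_gt0 denq_neq0.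
have dQ0 : (d%:R : Qp) != 0.
  rewrite -padic_abs_eq0 padic_abs_nat // invr_eq0 expf_eq0 gt_eqF ?p_gt0 //.
  by rewrite andbF.
have qE : ratr q * d%:R = (numq q)%:~R :> Qp.
  by rewrite /ratr dE mulfVK.
have pd : ~~ (p %| d)%N.
  apply/negP => pd; have := coprime_num_den q.
  have [pn|pn] := boolP (p %| `|numq q|)%N.
    move=> co; have : (p %| gcdn `|numq q| d)%N by rewrite dvdn_gcd pn.
    by rewrite (eqP co) dvdn1; have := prime_gt1 p_pr; case: (p) => [|[]].
  move=> _; have aN : abs (numq q)%:~R = 1.
    rewrite -(padic_abs_ndvd pn).
    by case: (numq q) => n //; rewrite NegzE rmorphN padic_absN abszN.
  have := padic_abs_dvd pd; rewrite leNgt => /negP; apply.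
  apply: (lt_le_trans pV_lt1); rewrite -aN -qE padic_absM -[leRHS]mul1r.
  by rewrite ler_wpM2r ?padic_abs_ge0.
have d1 : abs d%:R = 1 by apply: padic_abs_ndvd.
have [a aE] : exists a : 'F_p, a * d%:R = (numq q)%:~R.
  exists ((numq q)%:~R / d%:R); rewrite mulfVK //.
  by rewrite -(dvdn_pcharf (pchar_Fp p_pr)).
exists a.
have ha : abs ((a : nat)%:R * d%:R - (numq q)%:~R) <= p%:R^-1.
  have := @Fp_int_eq0 ((a : nat)%:Z * d%:Z - numq q).
  rewrite !rmorphB !rmorphM /= -!pmulrn; apply.
  by rewrite natr_Zp aE subrr.
have -> : x - (a : nat)%:R = (x - ratr q) - ((a : nat)%:R - ratr q) by ring.
apply: padic_absB_le; first exact: ltW.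
have -> : abs ((a : nat)%:R - ratr q) = abs (((a : nat)%:R - ratr q) * d%:R).
  by rewrite padic_absM d1 mulr1.
by rewrite mulrBl qE.
Qed.

(** Only values at integers are prescribed, so discreteness is deduced: x lies within 1/p of an
    integer of absolute value below 1, which is then divisible by p. *)
Lemma padic_abs_discrete x : abs x < 1 -> abs x <= p%:R^-1.
Proof.
move=> x1; have [a ha] := Zp_residue (ltW x1).
have a1 : abs (a : nat)%:R < 1.
  rewrite -[(a : nat)%:R](subKr x); apply: padic_absB_lt => //.
  exact: le_lt_trans ha pV_lt1.
have [pa|pa] := boolP (p %| a)%N; last by rewrite padic_abs_ndvd ?ltxx in a1.
rewrite -[x](subrK (a : nat)%:R); apply: padic_absD_le => //.
exact: padic_abs_dvd.
Qed.

Lemma padic_div_p x : abs x < 1 -> exists2 y, abs y <= 1 & x = p%:R * y.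
Proof.
move=> x1; exists (x / p%:R); last by rewrite mulrC mulfVK // padic_natr_neq0.
rewrite padic_absM padic_absV padic_abs_p invrK -ler_pdivlMr // mul1r.
exact: padic_abs_discrete.
Qed.

Lemma padic_unit_part x : x != 0 -> abs x <= 1 ->
  exists n, exists2 u, abs u = 1 & x = p%:R ^+ n * u.
Proof.
move=> x0; have : 0 < abs x by rewrite lt0r padic_abs_ge0 padic_abs_eq0 x0.
move=> /padic_archi[n]; elim: n x x0 => [|n IH] x x0 hx x1.
  by exists 0%N, x; rewrite ?expr0 ?mul1r //; move: hx; rewrite expr0 invr1 ltNge x1.
have [xe|xe] := eqVneq (abs x) 1; first by exists 0%N, x; rewrite ?expr0 ?mul1r.
have [|y y1 Ex] := @padic_div_p x; first by rewrite lt_neqAle xe.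
have y0 : y != 0 by apply: contraNneq x0 => y0; rewrite Ex y0 mulr0.
have [|k [u u1 Ey]] := IH y y0 _ y1.
  move: hx; rewrite Ex padic_absM padic_abs_p exprS invfM.
  by rewrite ltr_pM2l.
by exists k.+1, u => //; rewrite exprS -mulrA -Ey.
Qed.

(* The residue class in F_p; only meaningful on Z_p. *)
Definition rz (x : Qp) : 'F_p := xget 0 [set a : 'F_p | abs (x - (a : nat)%:R) < 1]%classic.

Lemma rzP x : abs x <= 1 -> abs (x - (rz x : nat)%:R) < 1.
Proof.
move=> /Zp_residue[a ha]; rewrite /rz.
by case: xgetP => // /(_ a); case; apply: le_lt_trans ha pV_lt1.
Qed.

Lemma rz_uniq x (a : 'F_p) : abs (x - (a : nat)%:R) < 1 -> rz x = a.
Proof.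
move=> ha; have x1 : abs x <= 1.
  rewrite -[x](subrK (a : nat)%:R) padic_absD_le // ?padic_abs_natle1 //.
  exact: ltW.
have hb := rzP x1; set b := rz x in hb *.
have : abs (((b : nat)%:Z - (a : nat)%:Z)%:~R) < 1.
  rewrite rmorphB /= -!pmulrn.
  have -> : (b : nat)%:R - (a : nat)%:R = (x - (a : nat)%:R) - (x - (b : nat)%:R) :> Qp by ring.
  exact: padic_absB_lt.
have E (z : int) : abs z%:~R = abs (`|z|%N)%:R.
  by case: z => n //; rewrite NegzE rmorphN padic_absN abszN.
rewrite E => h; apply/eqP; rewrite -subr_eq0; apply/eqP.
have pd : (p %| `|(b : nat)%:Z - (a : nat)%:Z|)%N.
  by apply: contraLR isT => /padic_abs_ndvd h'; rewrite h' ltxx in h.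
have : ((b : nat)%:Z - (a : nat)%:Z)%:~R = 0 :> 'F_p.
  move: pd; set z := (_ - _); rewrite (dvdn_pcharf (pchar_Fp p_pr)) => /eqP.
  by case: z => n //; rewrite NegzE abszN rmorphN => h0; apply/eqP; rewrite oppr_eq0; apply/eqP.
by rewrite rmorphB /= -!pmulrn !natr_Zp.
Qed.

Lemma rz_nat n : rz n%:R = n%:R.
Proof.
apply: rz_uniq; apply: le_lt_trans pV_lt1.
have := @Fp_int_eq0 (n%:Z - ((n%:R : 'F_p) : nat)%:Z).
by rewrite !rmorphB /= -!pmulrn natr_Zp subrr => /(_ erefl).
Qed.

Lemma rz_congr x y : abs (x - y) < 1 -> abs y <= 1 -> rz x = rz y.
Proof.
move=> xy y1; apply: rz_uniq; rewrite -[x](subrK y) -addrA.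
by apply: padic_absD_lt => //; apply: rzP.
Qed.

Lemma rz1 : rz 1 = 1. Proof. exact: (rz_nat 1). Qed.
Lemma rz0 : rz 0 = 0. Proof. exact: (rz_nat 0). Qed.

Lemma rzD x y : abs x <= 1 -> abs y <= 1 -> rz (x + y) = rz x + rz y.
Proof.
move=> x1 y1; transitivity (rz ((rz x : nat) + (rz y : nat))%:R); last first.
  by rewrite rz_nat natrD !natr_Zp.
apply: rz_congr; last exact: padic_abs_natle1.
by rewrite natrD opprD addrACA; apply: padic_absD_lt; apply: rzP.
Qed.

Lemma rzM x y : abs x <= 1 -> abs y <= 1 -> rz (x * y) = rz x * rz y.
Proof.
move=> x1 y1; transitivity (rz ((rz x : nat) * (rz y : nat))%:R); last first.
  by rewrite rz_nat natrM !natr_Zp.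
apply: rz_congr; last exact: padic_abs_natle1.
have -> : x * y - ((rz x : nat) * (rz y : nat))%:R =
  x * (y - (rz y : nat)%:R) + (x - (rz x : nat)%:R) * (rz y : nat)%:R by rewrite natrM; ring.
apply: padic_absD_lt; rewrite padic_absM.
  by rewrite (le_lt_trans _ (rzP y1)) // ler_piMl ?padic_abs_ge0.
by rewrite (le_lt_trans _ (rzP x1)) // ler_piMr ?padic_abs_ge0 ?padic_abs_natle1.
Qed.

Lemma rzN x : abs x <= 1 -> rz (- x) = - rz x.
Proof.
move=> x1; apply/eqP; rewrite -addr_eq0 -rzD ?padic_absN // addNr.
by rewrite rz0.
Qed.

Lemma rzX x n : abs x <= 1 -> rz (x ^+ n) = rz x ^+ n.
Proof.
move=> x1; elim: n => [|n IH]; first by rewrite !expr0 rz1.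
by rewrite !exprS rzM ?padic_absX_le1 // IH.
Qed.

Lemma rz_sum (I : Type) (r : seq I) (f : I -> Qp) :
  (forall i, abs (f i) <= 1) -> rz (\sum_(i <- r) f i) = \sum_(i <- r) rz (f i).
Proof.
move=> h; elim: r => [|i r IH]; first by rewrite !big_nil rz0.
by rewrite !big_cons rzD ?IH // padic_abs_sum_le.
Qed.

Lemma rz_eq0 x : abs x <= 1 -> (rz x == 0) = (abs x < 1).
Proof.
move=> x1; apply/eqP/idP => [h|h]; first by have := rzP x1; rewrite h subr0.
by apply: rz_uniq; rewrite subr0.
Qed.

Lemma rz_eq0_abs1 x : abs x <= 1 -> (rz x != 0) = (abs x == 1).
Proof. by move=> x1; rewrite rz_eq0 // -leNgt eq_le x1. Qed.

Lemma exists_rz (a : 'F_p) : exists2 x, abs x <= 1 & rz x = a.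
Proof. by exists (a : nat)%:R; rewrite ?padic_abs_natle1 // rz_nat natr_Zp. Qed.

Lemma padic_eq0 x : (forall eps : rat, 0 < eps -> abs x < eps) -> x = 0.
Proof.
move=> h; apply/eqP; rewrite -padic_abs_eq0; apply: contraT => x0.
have : 0 < abs x by rewrite lt0r x0 padic_abs_ge0.
by move=> /h; rewrite ltxx.
Qed.

Lemma padic_absBX_le x y n (c : rat) : 0 <= c -> abs x <= 1 -> abs y <= 1 ->
  abs (x - y) <= c -> abs (x ^+ n - y ^+ n) <= c.
Proof.
move=> c0 x1 y1 xy; rewrite subrXX padic_absM -[leRHS]mulr1.
apply: ler_pM; rewrite ?padic_abs_ge0 //; apply: padic_abs_sum_le => // i _.
by apply: padic_absM_le1; apply: padic_absX_le1.
Qed.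

(** In x^p - y^p = (x - y) S the cofactor S reduces to p y^(p-1) = 0, which gains one more power of
    p. *)
Lemma padic_Frobenius x y n : abs x <= 1 -> abs y <= 1 -> abs (x - y) <= p%:R ^- n.+1 ->
  abs (x ^+ p - y ^+ p) <= p%:R ^- n.+2.
Proof.
move=> x1 y1 xy; rewrite subrXX padic_absM [p%:R ^+ n.+2]exprSr invfM.
apply: ler_pM; rewrite ?padic_abs_ge0 //.
have xy1 : abs (x - y) < 1.
  apply: le_lt_trans xy _; rewrite invf_lt1 ?exprn_gt0 //.
  by rewrite exprn_egt1.
have h i : abs (x ^+ (p.-1 - i) * y ^+ i) <= 1.
  by apply: padic_absM_le1; apply: padic_absX_le1.
apply: padic_abs_discrete; rewrite -rz_eq0; last exact: padic_abs_sum_le.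
rewrite rz_sum // (eq_bigr (fun=> rz y ^+ p.-1)) => [|i _].
  by rewrite sumr_const card_ord -mulr_natl (pcharf0 (pchar_Fp p_pr)) mul0r.
rewrite rzM ?padic_absX_le1 // !rzX // (rz_congr xy1 y1) -exprD subnK //.
by have := ltn_ord i; lia.
Qed.

(** The root is the limit of x^(p^n), a Cauchy sequence because each p-th power gains a factor p. *)
Lemma teich_ex x : abs x <= 1 -> exists z, z ^+ p = z /\ abs (z - x) < 1.
Proof.
move=> x1; pose u n := x ^+ (p ^ n).
have u1 n : abs (u n) <= 1 by apply: padic_absX_le1.
have uS n : u n.+1 = u n ^+ p by rewrite /u -exprM expnSr.
have du n : abs (u n.+1 - u n) <= p%:R ^- n.+1.
  elim: n => [|n IH].
    rewrite expr1 uS /u expn0 expr1; apply: padic_abs_discrete.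
    rewrite -rz_eq0; last by apply: padic_absB_le => //; apply: padic_absX_le1.
    rewrite rzD ?padic_absN ?padic_absX_le1 // rzN // rzX //.
    by have := expf_card (rz x); rewrite card_Fp ?p_pr // => ->; rewrite subrr.
  by rewrite uS [u n.+1 in X in _ - X]uS; apply: padic_Frobenius.
have pm m n : (m <= n)%N -> (p%:R ^- n : rat) <= p%:R ^- m.
  by move=> mn; rewrite lef_pV2 ?posrE ?exprn_gt0 // ler_weXn2l // ltW.
have cu N k : abs (u (N + k)%N - u N) <= p%:R ^- N.+1.
  elim: k => [|k IH]; first by rewrite addn0 subrr padic_abs0 invr_ge0 exprn_ge0 // ltW.
  rewrite addnS -[u _.+1](subrK (u (N + k)%N)) -addrA; apply: padic_absD_le => //.
  by apply: le_trans (du _) (pm _ _ _); rewrite ltnS leq_addr.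
have [|z hz] := @padic_complete p Qp u.
  move=> eps /padic_archi[N hN]; exists N => m n Nm Nn.
  apply: le_lt_trans hN; apply: le_trans (pm _ _ (leqnSn N)).
  have -> : u m - u n = (u m - u N) - (u n - u N) by ring.
  by rewrite -(subnKC Nm) -(subnKC Nn); apply: padic_absB_le; apply: cu.
have zu eps : 0 < eps -> exists N, forall n, (N <= n)%N -> abs (z - u n) < eps.
  move=> /hz[N hN]; exists N => n /hN; by rewrite padic_absBC.
have z1 : abs z <= 1.
  have [N hN] := zu 1 ltr01; rewrite -[z](subrK (u N)); apply: padic_absD_le => //.
  by rewrite ltW // hN.
exists z; split.
  apply/eqP; rewrite -subr_eq0; apply/eqP; apply: padic_eq0 => eps e0.
  have [N hN] := zu (eps / 2%:R) (divr_gt0 e0 (ltr0Sn _ _)).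
  have -> : z ^+ p - z = (z ^+ p - u N ^+ p) - (z - u N.+1) by rewrite uS; ring.
  have e2 : eps / 2%:R < eps by lra.
  apply: le_lt_trans e2; apply: padic_absB_le; last by rewrite ltW // hN.
  apply: padic_absBX_le => //; rewrite ?divr_ge0 ?ltW //; exact: hN.
have [N hN] := zu 1 ltr01; rewrite -[z](subrK (u N)) -addrA.
apply: padic_absD_lt; first exact: hN.
have := cu 0%N N; rewrite add0n {2}/u expn0 expr1 => h; apply: le_lt_trans h _.
by rewrite expr1.
Qed.

Lemma teichP x : abs x = 1 -> teich x ^+ p.-1 = 1 /\ abs (teich x - x) < 1.
Proof.
move=> x1; have x1' : abs x <= 1 by rewrite x1.
rewrite /teich; case: xgetP => [z _ [] //|] H; exfalso.
have [z [zp zx]] := teich_ex x1'; apply: (H z); split=> //.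
have z0 : z != 0.
  by apply: contraTneq zx => ->; rewrite sub0r padic_absN x1 ltxx.
by apply: (mulfI z0); rewrite -exprS prednK ?prime_gt0 ?p_pr // mulr1.
Qed.

Lemma root1_abs1 z n : (0 < n)%N -> z ^+ n = 1 -> abs z = 1.
Proof.
move=> n0 /(congr1 abs)/eqP; rewrite padic_abs1 padic_absX pexpr_eq1 ?padic_abs_ge0 //.
by move/eqP.
Qed.

(** The cofactor of z - z' in z^(p-1) - z'^(p-1) reduces to (p-1) z'^(p-2), which is nonzero. *)
Lemma root1_inj z z' : z ^+ p.-1 = 1 -> z' ^+ p.-1 = 1 -> abs (z - z') < 1 -> z = z'.
Proof.
have p1 : (0 < p.-1)%N by rewrite -ltnS prednK ?prime_gt0 ?prime_gt1 ?p_pr.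
move=> z1 z1' h; have a1 := root1_abs1 p1 z1; have a1' := root1_abs1 p1 z1'.
have : z ^+ p.-1 - z' ^+ p.-1 = 0 by rewrite z1 z1' subrr.
rewrite subrXX => /eqP; rewrite mulf_eq0 => /orP[|]; first by rewrite subr_eq0 => /eqP.
move=> /eqP /(congr1 rz); rewrite rz0 rz_sum => [|i]; last first.
  by rewrite padic_absM_le1 // padic_absX_le1 ?a1 ?a1'.
rewrite (eq_bigr (fun=> rz z' ^+ p.-2)) => [|i _].
  rewrite sumr_const card_ord -mulr_natl => /eqP; rewrite mulf_eq0 expf_eq0 andbC.
  rewrite (negPf (_ : rz z' != 0)) /=; last by rewrite rz_eq0_abs1 a1'.
  rewrite orbF -(dvdn_pcharf (pchar_Fp p_pr)) => /(dvdn_leq p1).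
  by rewrite leqNgt prednK ?leqnn // prime_gt0 // p_pr.
rewrite rzM ?padic_absX_le1 ?a1 ?a1' // !rzX ?a1 ?a1' //.
rewrite (rz_congr h) ?a1' // -exprD; congr (_ ^+ _).
by have := ltn_ord i; lia.
Qed.

Lemma teich_uniq x z : abs x = 1 -> z ^+ p.-1 = 1 -> abs (z - x) < 1 -> teich x = z.
Proof.
move=> x1 z1 zx; have [t1 tx] := teichP x1; apply: root1_inj => //.
have -> : teich x - z = (teich x - x) - (z - x) by ring.
exact: padic_absB_lt.
Qed.

Lemma teich_abs1 x : abs x = 1 -> abs (teich x) = 1.
Proof.
move=> /teichP[/root1_abs1 h _]; apply: h.
by rewrite -ltnS prednK ?prime_gt0 ?prime_gt1 ?p_pr.
Qed.

Lemma rz_teich x : abs x = 1 -> rz (teich x) = rz x.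
Proof. by move=> x1; apply: rz_congr; rewrite ?x1 // (teichP x1).2. Qed.

Lemma teich_root (z : Qp) : z ^+ p.-1 = 1 -> teich z = z.
Proof.
move=> z1; apply: teich_uniq => //; last by rewrite subrr padic_abs0.
by apply: root1_abs1 z1; rewrite -ltnS prednK ?prime_gt0 ?prime_gt1 ?p_pr.
Qed.

Lemma teich_congr x y : abs y = 1 -> abs (x - y) < 1 -> teich x = teich y.
Proof.
move=> y1 xy; have x1 : abs x = 1 by rewrite (@padic_abs_eq x y) ?y1.
have [t1 tx] := teichP y1; apply: teich_uniq => //.
have -> : teich y - x = (teich y - y) - (x - y) by ring.
exact: padic_absB_lt.
Qed.

Lemma teichM x y : abs x = 1 -> abs y = 1 -> teich (x * y) = teich x * teich y.
Proof.
move=> x1 y1; have [tx dx] := teichP x1; have [ty dy] := teichP y1.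
apply: teich_uniq; first by rewrite padic_absM x1 y1 mulr1.
  by rewrite exprMn tx ty mulr1.
have -> : teich x * teich y - x * y = teich x * (teich y - y) + (teich x - x) * y by ring.
by apply: padic_absD_lt; rewrite padic_absM ?teich_abs1 ?y1 ?mul1r ?mulr1.
Qed.

Lemma exists_teich (a : 'F_p) : a != 0 -> exists2 z, z ^+ p.-1 = 1 & rz z = a.
Proof.
move=> a0; have [x x1 xa] := exists_rz a.
have x1' : abs x = 1 by apply/eqP; rewrite -rz_eq0_abs1 // xa.
by exists (teich x); rewrite ?rz_teich // (teichP x1').1.
Qed.

End PadicNumbers.

(** Meant for an integral equation of x, with i the first index whose coefficient is nonzero, or a
    unit: the lower terms are then negligible and x^i can be cancelled. *)
Lemma split_power_sum (R : comNzRingType) (b : nat -> R) (x : R) n i : (i <= n)%N ->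
  exists c, \sum_(j < n.+1) b j * x ^+ j = \sum_(j < i) b j * x ^+ j + x ^+ i * (b i + x * c).
Proof.
move=> i_n; exists (\sum_(i.+1 <= j < n.+1) b j * x ^+ (j - i.+1)).
rewrite -!(big_mkord xpredT (fun j => b j * x ^+ j)) (@big_cat_nat _ _ _ i) //=; last exact: ltnW.
rewrite [X in _ + X = _]big_ltn //; congr (_ + _); rewrite mulrDr mulrC; congr (_ + _).
rewrite !mulr_sumr; apply: eq_big_nat => j /andP[ij _].
have -> : x ^+ j = x ^+ i.+1 * x ^+ (j - i.+1) by rewrite -exprD subnKC.
by rewrite exprS; ring.
Qed.

(** * The integers of E *)

Section IntegersE.
Variables (p : nat) (Qp : padicField p) (E : fieldExtType Qp).
Local Notation abs := (@padic_abs p Qp).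
Local Notation O := (integers E).
Local Notation toO := (toO E).

Lemma O_mulf_eq0 (x y : O) : x * y = 0 -> x = 0 \/ y = 0.
Proof.
move=> /(congr1 val)/eqP; rewrite rmorphM rmorph0 mulf_eq0 => /orP[]/eqP h; [left|right];
  by apply: val_inj; rewrite h rmorph0.
Qed.

Lemma O_mulI (x : O) : x != 0 -> injective ( *%R x).
Proof.
move=> x0 a b /eqP; rewrite -subr_eq0 -mulrBr => /eqP/O_mulf_eq0[h|/eqP].
  by rewrite h eqxx in x0.
by rewrite subr_eq0 => /eqP.
Qed.

Lemma val_toO x : abs x <= 1 -> val (toO x) = x%:A.
Proof.
move=> x1; rewrite /Defs.toO insubdK // unfold_in; apply/asboolP.
have xz : x \in @zp_pred p Qp by rewrite unfold_in.
exact: (integral_id (zp_in_ext E) (ZpElt xz)).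
Qed.

Lemma toO_nat n : toO n%:R = n%:R.
Proof. by apply: val_inj; rewrite val_toO ?padic_abs_natle1 // rmorph_nat scaler_nat. Qed.

Lemma toO1 : toO 1 = 1. Proof. exact: (toO_nat 1). Qed.
Lemma toO0 : toO 0 = 0. Proof. exact: (toO_nat 0). Qed.

Lemma toOD x y : abs x <= 1 -> abs y <= 1 -> toO (x + y) = toO x + toO y.
Proof.
move=> x1 y1; apply: val_inj; rewrite rmorphD /= !val_toO ?scalerDl //.
exact: padic_absD_le.
Qed.

Lemma toON x : abs x <= 1 -> toO (- x) = - toO x.
Proof. by move=> x1; apply: val_inj; rewrite rmorphN /= !val_toO ?padic_absN ?scaleNr. Qed.

Lemma toOB x y : abs x <= 1 -> abs y <= 1 -> toO (x - y) = toO x - toO y.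
Proof. by move=> x1 y1; rewrite toOD ?padic_absN // toON. Qed.

Lemma toOM x y : abs x <= 1 -> abs y <= 1 -> toO (x * y) = toO x * toO y.
Proof.
move=> x1 y1; apply: val_inj; rewrite rmorphM /= !val_toO ?padic_absM_le1 //.
by rewrite -scalerAl mul1r scalerA.
Qed.

Lemma toOX x n : abs x <= 1 -> toO (x ^+ n) = toO x ^+ n.
Proof.
move=> x1; elim: n => [|n IH]; first by rewrite !expr0 toO1.
by rewrite !exprS toOM ?padic_absX_le1 // IH.
Qed.

Lemma congO_toO n x y : abs x <= 1 -> abs y <= 1 -> congQ n x y -> congO n (toO x) (toO y).
Proof.
move=> x1 y1 xy; have pn0 : (p%:R ^+ n : Qp) != 0 by rewrite expf_neq0 // padic_natr_neq0.
have p0 : (0 : rat) < p%:R by rewrite ltr0n prime_gt0 // (padic_prime Qp).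
pose z := (x - y) / p%:R ^+ n.
have z1 : abs z <= 1.
  by rewrite padic_absM padic_absV padic_absX padic_abs_p exprVn invrK
    -ler_pdivlMr ?exprn_gt0 // mul1r.
have xyz : x - y = p%:R ^+ n * z by rewrite mulrC mulfVK.
exists (toO z); rewrite -toOB // xyz toOM ?padic_absX_le1 ?padic_abs_natle1 //.
by rewrite toOX ?padic_abs_natle1 // toO_nat.
Qed.

Lemma toO_unit x : abs x = 1 -> toO x * toO x^-1 = 1.
Proof.
move=> x1; have x0 : x != 0 by rewrite -padic_abs_eq0 x1 oner_eq0.
by rewrite -toOM ?padic_absV ?x1 ?invr1 // mulfV // toO1.
Qed.

Lemma O_monic (x : O) : exists n (a : nat -> Qp), [/\ forall i, abs (a i) <= 1,
  a n = 1 & \sum_(i < n.+1) toO (a i) * x ^+ i = 0].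
Proof.
have := valP x; rewrite unfold_in => /asboolP[f fm fx].
have f0 : f != 0 by apply: monic_neq0.
exists (size f).-1, (fun i => val f`_i).
have a1 i : abs (val f`_i) <= 1 by have := valP f`_i; rewrite unfold_in.
split=> //; first by rewrite -lead_coefE (monicP fm) rmorph1.
apply: val_inj; rewrite rmorph_sum rmorph0 prednK ?size_poly_gt0 //.
move: fx; rewrite rootE (@horner_coef_wide _ (size f)) ?size_poly // => /eqP fx.
rewrite -[RHS]fx; apply: eq_bigr => i _.
by rewrite coef_map rmorphM rmorphXn; congr (_ * _); apply: val_toO.
Qed.

(** In an integral equation of x with lowest nonzero coefficient a_i, cancelling x^i shows that x
    divides a_i, a power of p times a unit. *)
Lemma O_neq0_dvd (x : O) : x != 0 -> exists k, exists c, x * c = p%:R ^+ k.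
Proof.
move=> x0; have [n [a [a1 an an0]]] := O_monic x.
have exP : exists i, a i != 0 by exists n; rewrite an oner_eq0.
case: (ex_minnP exP) => i ai mi.
have i_n : (i <= n)%N by apply: mi; rewrite an oner_eq0.
have [c Ec] := split_power_sum (fun j => toO (a j)) x i_n.
move: Ec; rewrite an0 big1 ?add0r => [|j _]; last first.
  have [-> |/mi] := eqVneq (a j) 0; first by rewrite toO0 mul0r.
  by rewrite leqNgt ltn_ord.
have xi0 : x ^+ i != 0.
  apply/eqP; elim: (i) => [|m IH]; first by move/eqP; rewrite expr0 oner_eq0.
  by rewrite exprS => /O_mulf_eq0[/eqP|//]; rewrite (negPf x0).
rewrite -{1}(mulr0 (x ^+ i)) => /(O_mulI xi0)/esym/eqP; rewrite addr_eq0 => /eqP E0.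
have [k [u u1 Eu]] := padic_unit_part ai (a1 i).
exists k, (- c * toO u^-1); rewrite mulrA mulrN -E0 Eu.
rewrite toOM ?padic_absX_le1 ?padic_abs_natle1 ?u1 // -mulrA toO_unit // mulr1.
by rewrite toOX ?padic_abs_natle1 // toO_nat.
Qed.

Lemma natrp_O_neq0 : (p%:R : O) != 0.
Proof.
apply/eqP => /(congr1 val); rewrite rmorph_nat rmorph0.
have -> : (p%:R : E) = in_alg E p%:R by rewrite rmorph_nat.
by move/eqP; rewrite fmorph_eq0 (negPf (padic_natr_neq0 Qp)).
Qed.

Lemma padic_denominator (z : Qp) : exists k, forall j, (k <= j)%N -> abs (p%:R ^+ j * z) <= 1.
Proof.
have p1 : (1 : rat) < p%:R by rewrite ltr1n prime_gt1 // (padic_prime Qp).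
have p0 : (0 : rat) < p%:R := lt_trans ltr01 p1.
have [->|z0] := eqVneq z 0.
  by exists 0%N => j _; rewrite mulr0 padic_abs0 ler01.
have az : 0 < abs z by rewrite lt0r padic_abs_ge0 padic_abs_eq0 z0.
have [|k hk] := @padic_archi p Qp (abs z)^-1; first by rewrite invr_gt0.
exists k => j kj; rewrite padic_absM padic_absX padic_abs_p exprVn.
rewrite mulrC -ler_pdivlMr ?invr_gt0 ?exprn_gt0 // mul1r invrK.
rewrite -[leLHS]invrK -[leRHS]invrK lef_pV2 ?posrE ?invr_gt0 ?exprn_gt0 //.
apply: le_trans (ltW hk); rewrite lef_pV2 ?posrE ?exprn_gt0 //.
by rewrite ler_weXn2l // ltW.
Qed.

(** If f is the minimal polynomial of z, of degree n, then p^k z is a root of the monic polynomial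
    with coefficients p^(k(n-i)) f_i, integral for k large. So E is obtained from O by inverting
    p. *)
Lemma E_denominator (z : E) : exists k, exists x : O, p%:R ^+ k * z = val x.
Proof.
have /polyOver1P[f Ef] := minPolyOver 1%VS z.
have fm : f \is monic by rewrite -(map_monic (in_alg E)) -Ef monic_minPoly.
have rz : root (map_poly (in_alg E) f) z by rewrite -Ef root_minPoly.
pose n := (size f).-1.
have sf : size f = n.+1 by rewrite prednK // size_poly_gt0 monic_neq0.
have [k hk] : exists k, forall i, (i < n)%N -> abs (p%:R ^+ k * f`_i) <= 1.
  elim: n {sf} => [|m [k hk]]; first by exists 0%N.
  have [k' hk'] := padic_denominator f`_m.
  have [k2 hk2] : exists k2, forall i, (i < m)%N -> forall j, (k2 <= j)%N -> abs (p%:R ^+ j * f`_i) <= 1.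
    exists k => i im j kj; rewrite -(subnK kj) exprD -mulrA.
    by rewrite padic_absM_le1 ?hk // padic_absX_le1 // padic_abs_natle1.
  exists (maxn k' k2) => i; rewrite ltnS leq_eqVlt => /orP[/eqP ->|im].
    by rewrite hk' ?leq_maxl.
  by rewrite hk2 ?leq_maxr.
have fi i : abs (if i == n then 1 else if (i < n)%N then p%:R ^+ (k * (n - i)) * f`_i else 0) <= 1.
  case: eqP => _; first by rewrite padic_abs1.
  case: ltnP => [i_n|_]; last by rewrite padic_abs0 ler01.
  have -> : (k * (n - i) = k * (n - i).-1 + k)%N.
    by rewrite -{1}(prednK (_ : 0 < n - i)%N) ?subn_gt0 // mulnS addnC.
  by rewrite exprD -mulrA padic_absM_le1 ?hk // padic_absX_le1 // padic_abs_natle1.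
have fz i : (if i == n then 1 else if (i < n)%N then p%:R ^+ (k * (n - i)) * f`_i else 0)
     \in @zp_pred p Qp by rewrite unfold_in fi.
pose g := \poly_(i < n.+1) ZpElt (fz i).
have gi i : (i <= n)%N -> g`_i = ZpElt (fz i) by move=> i_n; rewrite coef_poly ltnS i_n.
have gm : g \is monic.
  apply/monicP; rewrite lead_coefE.
  have sg : size g = n.+1.
    apply/eqP; rewrite eqn_leq size_poly ltnNge /=; apply/negP => /leq_sizeP/(_ n (leqnn n)).
    rewrite gi // => /(congr1 val) /=; rewrite eqxx => /eqP.
    by rewrite oner_eq0.
  by rewrite sg /= gi //; apply: val_inj; rewrite /= eqxx.
exists k.
have gz : p%:R ^+ k * z \in @int_pred p Qp E.
  rewrite unfold_in; apply/asboolP; exists g => //.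
  rewrite rootE (@horner_coef_wide _ n.+1); last first.
    by rewrite (leq_trans (size_poly _ _)) // size_poly.
  have := rz; rewrite rootE (@horner_coef_wide _ n.+1) ?size_map_poly ?sf // => /eqP f0.
  apply/eqP; transitivity (p%:R ^+ (k * n) *
    \sum_(i < n.+1) (map_poly (in_alg E) f)`_i * z ^+ i); last by rewrite f0 mulr0.
  rewrite mulr_sumr; apply: eq_bigr => i _.
  have i_n : (i <= n)%N by rewrite -ltnS.
  rewrite !coef_map gi //= /zp_in_ext /=.
  have -> : (if i == n :> nat then 1 else if (i < n)%N then p%:R ^+ (k * (n - i)) * f`_i else 0)
    = p%:R ^+ (k * (n - i)) * f`_i.
    case: eqP => [->|ne].
      by rewrite subnn muln0 expr0 mul1r /n -lead_coefE (monicP fm).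
    by rewrite ltn_neqAle i_n andbT (introN eqP ne).
  have kn : (k * n = k * (n - i) + k * i)%N by rewrite -mulnDr subnK.
  have -> : (p%:R ^+ (k * (n - i)) * f`_i)%:A = p%:R ^+ (k * (n - i)) * (f`_i)%:A :> E.
    by rewrite -!in_algE rmorphM rmorphXn rmorph_nat.
  by rewrite exprMn -exprM kn exprD; ring.
by exists (IntElt gz).
Qed.

End IntegersE.

(** * Reduction modulo varpi and divisibility by its powers *)

Section Residue.
Variables (p : nat) (Qp : padicField p) (E : fieldExtType Qp).
Local Notation abs := (@padic_abs p Qp).
Local Notation O := (integers E).
Local Notation toO := (toO E).
Variables (F : fieldType) (red : {rmorphism O -> F}) (varpi : O).
Hypotheses (res : is_residue_field red varpi) (Fp0 : p%:R = 0 :> F).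

Lemma red_eq0 x : red x = 0 <-> exists y, x = varpi * y.
Proof. exact: res.2. Qed.

Lemma red_varpi : red varpi = 0.
Proof. by apply/red_eq0; exists 1; rewrite mulr1. Qed.

Lemma p_varpi : exists y : O, p%:R = varpi * y.
Proof. by apply/red_eq0; rewrite rmorph_nat. Qed.

Lemma varpi_neq0 : varpi != 0.
Proof.
have [y Ey] := p_varpi; apply/eqP => v0; have := natrp_O_neq0 E.
by rewrite Ey v0 mul0r eqxx.
Qed.

Lemma red_toO x : abs x <= 1 -> red (toO x) = (rz x : nat)%:R.
Proof.
move=> x1; have [y y1 Ey] := padic_div_p (rzP x1).
have Ex : x = p%:R * y + (rz x : nat)%:R by rewrite -Ey subrK.
rewrite {1}Ex toOD ?padic_absM_le1 ?padic_abs_natle1 //.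
by rewrite toOM ?padic_abs_natle1 // !toO_nat rmorphD rmorphM !rmorph_nat Fp0 mul0r add0r.
Qed.

Lemma red_toO_unit x : abs x = 1 -> red (toO x) != 0.
Proof.
move=> /(toO_unit E)/(congr1 red)/eqP; rewrite rmorphM rmorph1; apply: contraTneq => ->.
by rewrite mul0r eq_sym oner_eq0.
Qed.

Lemma varpi_exp_neq0 n : varpi ^+ n != 0.
Proof.
elim: n => [|n IH]; first by rewrite expr0 oner_eq0.
apply/eqP; rewrite exprS => /O_mulf_eq0[]/eqP; first by rewrite (negPf varpi_neq0).
by rewrite (negPf IH).
Qed.

(** In an integral equation of [varpi] let a_i be the first unit coefficient; the lower terms are
    multiples of p. If varpi^(i+1) divided p, cancelling varpi^i would make a_i vanish in F. *)
Lemma p_separated : exists N, ~ exists c, p%:R = varpi ^+ N * c.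
Proof.
have [n [a [a1 an an0]]] := O_monic varpi.
have exP : exists i, abs (a i) == 1 by exists n; rewrite an padic_abs1.
case: (ex_minnP exP) => i ai mi.
have i_n : (i <= n)%N by apply: mi; rewrite an padic_abs1.
have [c Ec] := split_power_sum (fun j => toO (a j)) varpi i_n.
have [b Eb] : exists b, \sum_(j < i) toO (a j) * varpi ^+ j = p%:R * b.
  elim/big_ind: _ => [|_ _ [b ->] [b' ->]|j _]; first by exists 0; rewrite mulr0.
    by exists (b + b'); rewrite mulrDr.
  have [|y y1 Ey] := @padic_div_p p Qp (a j).
    rewrite lt_neqAle a1 andbT; apply/negP => /mi.
    by rewrite leqNgt ltn_ord.
  exists (toO y * varpi ^+ j).
  by rewrite Ey toOM ?padic_abs_natle1 // toO_nat mulrA.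
exists i.+1 => -[y Ey]; move: Ec; rewrite an0 Eb Ey exprSr -!mulrA -mulrDr.
rewrite -{1}(mulr0 (varpi ^+ i)) => /(O_mulI (varpi_exp_neq0 i))/esym/(congr1 red).
rewrite !rmorphD !rmorphM red_varpi !mul0r add0r addr0 rmorph0 => /eqP.
by rewrite (negPf (red_toO_unit _)) //; apply/eqP.
Qed.

Lemma red_exp_neq0 x n : red x != 0 -> red (x ^+ n) != 0.
Proof. by move=> x0; rewrite rmorphXn expf_neq0. Qed.

(** Write p = varpi^v w with w nonzero in F, v being the largest possible exponent. A nonzero x
    divides some p^k = varpi^(vk) w^k, so varpi^(vk+1) cannot divide x. *)
Lemma O_separated x : x != 0 -> exists N, ~ exists c, x = varpi ^+ N * c.
Proof.
have [N hN] := p_separated.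
have [v [w [Ew w0]]] : exists v w, p%:R = varpi ^+ v * w /\ red w != 0.
  have : exists v, `[< ~ exists c, p%:R = varpi ^+ v.+1 * c >].
    case: N hN => [|N] hN; last by exists N; apply/asboolP.
    by exfalso; apply: hN; exists p%:R; rewrite expr0 mul1r.
  move=> exP; case: (ex_minnP exP) => v /asboolP hv mv.
  have [w Ew] : exists w, p%:R = varpi ^+ v * w.
    case: v hv mv => [|v] hv mv; first by exists p%:R; rewrite expr0 mul1r.
    apply: contrapT => h; have /mv : `[< ~ exists c, p%:R = varpi ^+ v.+1 * c >] by apply/asboolP.
    by rewrite ltnn.
  exists v, w; split=> //; apply/eqP => /red_eq0[y Ey]; apply: hv.
  by exists y; rewrite exprSr -mulrA -Ey.
move=> /O_neq0_dvd[k [c Ec]]; exists (v * k).+1 => -[d Ed].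
move: Ec; rewrite Ed Ew exprMn -exprM exprSr -!mulrA.
move/(O_mulI (varpi_exp_neq0 _)) => /(congr1 red).
rewrite !rmorphM red_varpi mul0r => /esym/eqP.
by rewrite (negPf (red_exp_neq0 _ w0)).
Qed.

Lemma red_prime x y n : red x != 0 -> (exists c, x * y = varpi ^+ n * c) ->
  exists c, y = varpi ^+ n * c.
Proof.
move=> x0; elim: n y => [|n IH] y; first by exists y; rewrite expr0 mul1r.
move=> [c Ec]; have /red_eq0[z Ez] : red y = 0.
  have /(congr1 red) := Ec; rewrite !rmorphM exprS rmorphM red_varpi !mul0r => /eqP.
  by rewrite mulf_eq0 (negPf x0) => /eqP.
have [|d Ed] := IH z; last by exists d; rewrite Ez Ed exprS mulrA.
exists c; apply: (O_mulI varpi_neq0).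
by rewrite mulrCA -Ez Ec exprS mulrA.
Qed.

Lemma exists_Fp_morphism (pr : prime p) :
  exists iota : {rmorphism 'F_p -> F}, forall a, iota a = (a : nat)%:R.
Proof.
have pE : (Zp_trunc (pdiv p)).+2 = p by exact: Fp_cast.
have md n : (n %% (Zp_trunc (pdiv p)).+2)%:R = n%:R :> F.
  by rewrite pE {2}(divn_eq n p) natrD natrM Fp0 mulr0 add0r.
pose f (a : 'F_p) : F := (a : nat)%:R.
have fD : {morph f : a b / a - b}.
  move=> a b; apply/eqP; rewrite eq_sym subr_eq; apply/eqP.
  by rewrite -{1}(subrK b a) /f -natrD -[RHS]md.
have fM : monoid_morphism f.
  split; first by rewrite /f /= pE modn_small ?prime_gt1.
  by move=> a b; rewrite /f /= md natrM.
pose mA := GRing.isZmodMorphism.Build _ _ f fD.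
pose mM := GRing.isMonoidMorphism.Build _ _ f fM.
pose f' : {rmorphism 'F_p -> F} := HB.pack f mA mM.
by exists f'.
Qed.

End Residue.

(** * Measures on GL_2(Z_p) *)

Section Measures.
Variables (p : nat) (Qp : padicField p) (E : fieldExtType Qp).
Local Notation abs := (@padic_abs p Qp).
Local Notation O := (integers E).
Local Notation toO := (toO E).
Local Notation M2 := 'M[Qp]_2.
Local Notation OK := (iwasawa E).
Local Notation K := (@GL2Zp p Qp).
Local Notation congK := (@congM p Qp).
Local Notation contK := (@ucont p Qp E M2 congK K).
Local Notation p_pr := (padic_prime Qp).

Lemma congOD m (a b a' b' : O) : congO m a b -> congO m a' b' -> congO m (a + a') (b + b').
Proof.
move=> [c Ec] [c' Ec']; exists (c + c'); rewrite mulrDr -Ec -Ec'; ring.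
Qed.

Lemma congOM m (a b a' b' : O) : congO m a b -> congO m a' b' -> congO m (a * a') (b * b').
Proof.
move=> [c Ec] [c' Ec']; exists (c * a' + b * c').
have -> : a * a' - b * b' = (a - b) * a' + b * (a' - b') by ring.
by rewrite Ec Ec'; ring.
Qed.

Lemma contK_cst (c : O) : contK (fun=> c).
Proof. by move=> m; exists 0%N => x y _ _ _; apply: congO_refl. Qed.

Lemma contKD f g : contK f -> contK g -> contK (fun x => f x + g x).
Proof.
move=> cf cg m; have [n1 h1] := cf m; have [n2 h2] := cg m.
exists (maxn n1 n2) => x y Ax Ay xy; apply: congOD.
  by apply: h1 => //; apply: congMW xy; apply: leq_maxl.
by apply: h2 => //; apply: congMW xy; apply: leq_maxr.
Qed.

Lemma contKM f g : contK f -> contK g -> contK (fun x => f x * g x).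
Proof.
move=> cf cg m; have [n1 h1] := cf m; have [n2 h2] := cg m.
exists (maxn n1 n2) => x y Ax Ay xy; apply: congOM.
  by apply: h1 => //; apply: congMW xy; apply: leq_maxl.
by apply: h2 => //; apply: congMW xy; apply: leq_maxr.
Qed.

Lemma contKZ (c : O) f : contK f -> contK (fun x => c * f x).
Proof. by move=> cf; apply: contKM => //; apply: contK_cst. Qed.

Lemma contK_sum (I : Type) (r : seq I) (f : I -> M2 -> O) :
  (forall i, contK (f i)) -> contK (fun x => \sum_(i <- r) f i x).
Proof.
move=> cf; elim: r => [|i r IH].
  by apply: ucont_eq (contK_cst 0) => x _; rewrite big_nil.
by apply: ucont_eq (contKD (cf i) IH) => x _; rewrite big_cons.
Qed.

Lemma contK_entry i j : contK (fun g => toO (g i j)).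
Proof.
by move=> m; exists m => x y [x1 _] [y1 _] xy; apply: congO_toO.
Qed.

Lemma contK_locconst n f :
  (forall g h, K g -> K h -> congK n g h -> f g = f h) -> contK f.
Proof. by move=> h m; exists n => x y Kx Ky xy; rewrite (h x y) //; apply: congO_refl. Qed.

Lemma mu_lin (mu : OK) c f g : contK f -> contK g ->
  mu (fun x => c * f x + g x) = c * mu f + mu g.
Proof. by move=> cf cg; rewrite (measure_linear (iwasawaP mu)). Qed.

Lemma mu_eq (mu : OK) f g : (forall x, K x -> f x = g x) -> mu f = mu g.
Proof. exact: (measure_eq (iwasawaP mu)). Qed.

Lemma mu0 (mu : OK) : mu (fun=> 0) = 0.
Proof.
transitivity (-1 * mu (fun=> 0) + mu (fun=> 0)); last by rewrite mulN1r addNr.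
by rewrite -mu_lin; [apply: mu_eq => x _; ring | exact: contK_cst | exact: contK_cst].
Qed.

Lemma muD (mu : OK) f g : contK f -> contK g -> mu (fun x => f x + g x) = mu f + mu g.
Proof.
by move=> cf cg; rewrite -[mu f]mul1r -mu_lin //; apply: mu_eq => x _; rewrite mul1r.
Qed.

Lemma muZ (mu : OK) c f : contK f -> mu (fun x => c * f x) = c * mu f.
Proof.
move=> cf; rewrite -[RHS]addr0 -(mu0 mu) -mu_lin //; last exact: contK_cst.
by apply: mu_eq => x _; rewrite addr0.
Qed.

Lemma mu_sum (mu : OK) (I : Type) (r : seq I) (f : I -> M2 -> O) :
  (forall i, contK (f i)) -> mu (fun x => \sum_(i <- r) f i x) = \sum_(i <- r) mu (f i).
Proof.
move=> cf; elim: r => [|i r IH].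
  by rewrite [RHS]big_nil -[RHS](mu0 mu); apply: mu_eq => x _; rewrite big_nil.
rewrite big_cons -IH -muD //; last exact: contK_sum.
by apply: mu_eq => x _; rewrite big_cons.
Qed.

Lemma iwDE (mu nu : OK) f : (mu + nu) f = mu f + nu f. Proof. by []. Qed.
Lemma iwNE (mu : OK) f : (- mu) f = - mu f. Proof. by []. Qed.
Lemma iw0E f : (0 : OK) f = 0. Proof. by []. Qed.
Lemma iw_sumE (I : Type) (r : seq I) (P : pred I) (mu : I -> OK) f :
  (\sum_(i <- r | P i) mu i) f = \sum_(i <- r | P i) mu i f.
Proof. exact: (big_morph (fun mu : OK => mu f) (fun _ _ => erefl) erefl). Qed.

Lemma iw_scalarE (c : O) f : contK f -> iw_scalar c f = c * f 1%:M.
Proof. by move=> cf; rewrite /= diracE //; apply: GL2Zp1. Qed.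

Lemma K_inv (g : M2) : K g -> K (invmx g).
Proof.
move=> [g1 gd]; have d0 : \det g != 0 by rewrite -padic_abs_eq0 gd oner_eq0.
have gu : g \in unitmx by rewrite unitmxE unitfE.
split; last by rewrite det_inv padic_absV gd invr1.
move=> i j; rewrite /invmx gu mxE padic_absM padic_absV gd invr1 mul1r /adjugate mxE.
rewrite /cofactor padic_absM padic_absX padic_absN padic_abs1 expr1n mul1r.
by rewrite [X in \det X]mx11_scalar det_scalar1 !mxE.
Qed.

Lemma K_unit (g : M2) : K g -> g \in unitmx.
Proof. by move=> [_ gd]; rewrite unitmxE unitfE -padic_abs_eq0 gd oner_eq0. Qed.

Lemma map_toO_mul (g h : M2) : K g -> K h ->
  map_mx toO (g *m h) = map_mx toO g *m map_mx toO h.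
Proof.
move=> [g1 _] [h1 _]; apply/matrixP => i j; rewrite mulmx2E mxE mulmx2E !mxE.
by rewrite toOD ?toOM ?padic_absM_le1.
Qed.

Lemma map_toO_1 : map_mx toO (1%:M : M2) = 1%:M.
Proof. by apply/matrixP => i j; rewrite !mxE; case: (i == j); rewrite ?toO1 ?toO0. Qed.

Definition rzmx (g : M2) : 'M['F_p]_2 := map_mx (@rz p Qp) g.

Lemma rzmxM (g h : M2) : K g -> K h -> rzmx (g *m h) = rzmx g *m rzmx h.
Proof.
move=> [g1 _] [h1 _]; apply/matrixP => i j; rewrite mulmx2E mxE mulmx2E !mxE.
by rewrite rzD ?rzM ?padic_absM_le1.
Qed.

Lemma det_rzmx (g : M2) : K g -> \det (rzmx g) = rz (\det g).
Proof.
by move=> [g1 _]; rewrite !det_mx2 !mxE rzD ?rzN ?padic_absN ?rzM ?padic_absM_le1.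
Qed.

Lemma det_rzmx_neq0 (g : M2) : K g -> \det (rzmx g) != 0.
Proof. by move=> Kg; rewrite det_rzmx // rz_eq0_abs1 Kg.2. Qed.

Lemma rzmx1 : rzmx 1%:M = 1%:M.
Proof. by apply/matrixP => i j; rewrite !mxE; case: (i == j); rewrite ?rz1 ?rz0. Qed.

Lemma rzmx_congK (g h : M2) : K g -> K h -> (congK 1 g h <-> rzmx g = rzmx h).
Proof.
move=> [g1 _] [h1 _]; have pV1 : (p%:R ^- 1 : rat) < 1.
  by rewrite expr1 invf_lt1 ?ltr0n ?ltr1n ?prime_gt0 ?prime_gt1 ?p_pr.
split=> [gh|/matrixP gh i j].
  apply/matrixP => i j; rewrite !mxE; apply: rz_congr => //.
  exact: le_lt_trans (gh i j) pV1.
rewrite /congQ expr1; apply: padic_abs_discrete; rewrite -rz_eq0 ?padic_absB_le //.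
by have := gh i j; rewrite !mxE rzD ?padic_absN // rzN // => ->; rewrite subrr.
Qed.

Definition Klift (b : 'M['F_p]_2) : M2 := \matrix_(i, j) ((b i j : nat)%:R).

Lemma rz_Klift b : rzmx (Klift b) = b.
Proof. by apply/matrixP => i j; rewrite !mxE rz_nat natr_Zp. Qed.

Lemma Klift_K b : \det b != 0 -> K (Klift b).
Proof.
move=> b0; have k1 i j : abs (Klift b i j) <= 1 by rewrite mxE padic_abs_natle1.
split=> //; apply/eqP; rewrite -rz_eq0_abs1; last first.
  by rewrite det_mx2 padic_absB_le ?padic_absM_le1.
have := rz_Klift b; move: b0; rewrite !det_mx2 => b0 /matrixP Eb.
rewrite rzD ?padic_absN ?padic_absM_le1 // rzN ?padic_absM_le1 // !rzM //.
have H i j : rz (Klift b i j) = b i j by rewrite mxE rz_nat natr_Zp.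
by rewrite !H.
Qed.

(** The indicator of the fibre of K -> GL_2(F_p) over b; its mass under mu is the coefficient at b
    of the image of mu in O[GL_2(F_p)]. All 2 x 2 matrices b are allowed, singular ones having empty
    fibre. *)
Definition Kind (b : 'M['F_p]_2) (g : M2) : O := (rzmx g == b)%:R.

Lemma Kind_cont b : contK (Kind b).
Proof.
by apply: (@contK_locconst 1%N) => g h Kg Kh /(rzmx_congK Kg Kh); rewrite /Kind => ->.
Qed.

Lemma Kind_out (mu : OK) b : \det b = 0 -> mu (Kind b) = 0.
Proof.
move=> b0; rewrite -(mu0 mu); apply: mu_eq => g Kg; rewrite /Kind.
by case: eqP => // gb; have := det_rzmx_neq0 Kg; rewrite gb b0 eqxx.
Qed.

Lemma dirac_out (g : M2) : ~ K g -> dirac E g = 0.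
Proof. by move=> nK; rewrite /dirac; case: pselect. Qed.

Lemma conv_dirac (g h : M2) : K g -> K h -> conv (dirac E g) (dirac E h) = dirac E (g *m h).
Proof.
move=> Kg Kh; apply: iwasawaE => f cf.
rewrite convE // diracE //; last exact: contK_conv.
rewrite !diracE //; [exact: GL2ZpM | exact: contK_mull].
Qed.

Lemma conv_dirac_l (g : M2) (mu : OK) f : K g -> contK f ->
  conv (dirac E g) mu f = mu (fun h => f (g *m h)).
Proof. by move=> Kg cf; rewrite convE // diracE //; apply: contK_conv. Qed.

Lemma conv_dirac_r (g : M2) (mu : OK) f : K g -> contK f ->
  conv mu (dirac E g) f = mu (fun h => f (h *m g)).
Proof.
move=> Kg cf; rewrite convE //; apply: mu_eq => h Kh; rewrite diracE //.
exact: contK_mull.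
Qed.

Lemma conv_scalar (mu : OK) (c : O) f : contK f -> conv mu (iw_scalar c) f = c * mu f.
Proof.
move=> cf; rewrite convE // -muZ //; apply: mu_eq => g Kg.
by rewrite iw_scalarE ?mulmx1 //; apply: contK_mull.
Qed.

Lemma supported_eq (S : M2 -> Prop) (mu : OK) f g : (supported S mu) -> contK f -> contK g ->
  (forall x, S x -> f x = g x) -> mu f = mu g.
Proof.
move=> Smu cf cg fg; apply/eqP; rewrite -subr_eq0; apply/eqP.
have -> : mu f - mu g = mu (fun x => -1 * g x + f x).
  by rewrite mu_lin // mulN1r addrC.
apply: Smu; first by apply: contKD => //; apply: contKZ.
by move=> x Sx; rewrite fg // mulN1r addNr.
Qed.

Lemma supported_conv (S : M2 -> Prop) (mu nu : OK) :
  (forall g h, S g -> S h -> S (g *m h)) -> (forall g, S g -> K g) ->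
  supported S mu -> supported S nu -> supported S (conv mu nu).
Proof.
move=> SM SK Smu Snu f cf f0; rewrite convE //; apply: Smu; first exact: contK_conv.
move=> g Sg; apply: Snu; first by apply: contK_mull => //; apply: SK.
by move=> h Sh; apply: f0; apply: SM.
Qed.

Lemma supported_dirac (S : M2 -> Prop) g : S g -> supported S (dirac E g).
Proof.
move=> Sg f cf f0; have [Kg|nK] := pselect (K g); last by rewrite dirac_out.
by rewrite diracE // f0.
Qed.

Lemma supported_scalar (S : M2 -> Prop) (c : O) : S 1%:M -> supported S (iw_scalar c).
Proof. by move=> S1 f cf f0; rewrite iw_scalarE // f0 // mulr0. Qed.

Lemma supported_sum (S : M2 -> Prop) (I : Type) (r : seq I) (mu : I -> OK) :
  (forall i, supported S (mu i)) -> supported S (\sum_(i <- r) mu i).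
Proof. by move=> h f cf f0; rewrite iw_sumE big1 // => i _; apply: h. Qed.

(** The measure with density u against mu, set to 0 on discontinuous functions as [is_measure]
    demands. *)
Definition restr_fun (u : M2 -> O) (mu : OK) (f : M2 -> O) : O :=
  if `[< contK f >] then mu (fun g => u g * f g) else 0.

Lemma restr_subproof u mu : contK u -> restr_fun u mu \in @meas_pred p Qp E.
Proof.
move=> cu; rewrite /meas_pred unfold_in; apply/asboolP; rewrite /restr_fun.
split=> [c f f' cf cf'|f f' ff'|f ncf]; last by rewrite asboolF.
- have cff' : contK (fun x => c * f x + f' x) by apply: contKD => //; apply: contKZ.
  rewrite !asboolT //.
  rewrite (@mu_eq _ _ (fun x => c * (u x * f x) + u x * f' x)) ?mu_lin //.
  + exact: contKM.
  + exact: contKM.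
  + by move=> x _; ring.
- rewrite (contK_asbool_eq ff'); case: ifP => // _.
  by apply: mu_eq => x Kx; rewrite ff'.
Qed.

Definition restr u (mu : OK) (cu : contK u) : OK := Iwasawa (restr_subproof mu cu).

Lemma restrE u (mu : OK) (cu : contK u) f : contK f -> restr mu cu f = mu (fun g => u g * f g).
Proof. by move=> cf; rewrite /= /restr_fun asboolT. Qed.

(* Decomposition along the cosets g_i S of a subgroup S, cut out by the indicators u_i. *)
Lemma coset_decomp (I : finType) (g : I -> M2) (u : I -> M2 -> O) (cu : forall i, contK (u i))
    (T S : M2 -> Prop) (mu : OK) : (forall i, K (g i)) -> supported T mu ->
  (forall x, T x -> \sum_i u i x = 1) ->
  (forall i x, T x -> ~ S (invmx (g i) *m x) -> u i x = 0) ->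
  let nu i := conv (dirac E (invmx (g i))) (restr mu (cu i)) in
  mu = \sum_i conv (dirac E (g i)) (nu i) /\ forall i, supported S (nu i).
Proof.
move=> Kg Tmu u1 u0 nu; have Kgi i := K_inv (Kg i); split=> [|i f cf f0].
  apply: iwasawaE => f cf; rewrite iw_sumE.
  transitivity (mu (fun x => \sum_i u i x * f x)).
    apply: (supported_eq Tmu) => // [|x Tx]; last by rewrite -mulr_suml u1 // mul1r.
    by apply: contK_sum => i; apply: contKM.
  rewrite mu_sum => [|i]; last exact: contKM.
  apply: eq_bigr => i _; rewrite /nu convA conv_dirac // conv_dirac_l //; last first.
    exact: GL2ZpM.
  rewrite restrE; last by apply: contK_mull => //; apply: GL2ZpM.
  by apply: mu_eq => x Kx; rewrite mulmxV ?mul1mx // K_unit.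
rewrite /nu conv_dirac_l // restrE; last exact: contK_mull.
apply: Tmu; first by apply: contKM => //; apply: contK_mull.
move=> x Tx; have [Sx|nSx] := pselect (S (invmx (g i) *m x)); first by rewrite f0 ?mulr0.
by rewrite u0 ?mul0r.
Qed.

(** * Measures modulo varpi *)

Section Reduction.
Variables (F : fieldType) (red : {rmorphism O -> F}) (varpi : O).
Hypotheses (res : is_residue_field red varpi) (Fp0 : p%:R = 0 :> F).

Lemma red_mu (mu : OK) f f' : contK f -> contK f' ->
  (forall g, K g -> red (f g) = red (f' g)) -> red (mu f) = red (mu f').
Proof.
move=> cf cf' ff'.
have [u hu] : exists u : M2 -> O, forall x, K x -> f x - f' x = varpi * u x.
  have /choice[u hu] : forall x, exists c : O, K x -> f x - f' x = varpi * c.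
    move=> x; have [Kx|nKx] := pselect (K x); last by exists 0.
    have /(red_eq0 res)[c Ec] : red (f x - f' x) = 0 by rewrite rmorphB ff' // subrr.
    by exists c.
  by exists u.
have [y Ey] := p_varpi res Fp0.
(* Dividing by [varpi] loses at most one power of p, because [varpi] divides p; hence the modulus
   for m + 1 serves for m. *)
have cu : contK u.
  move=> m; have [n hn] : exists n, forall x z, K x -> K z -> congK n x z ->
      congO m.+1 (f x - f' x) (f z - f' z).
    have h : contK (fun x => f x + -1 * f' x) by apply: contKD => //; apply: contKZ.
    have [n hn] := h m.+1; exists n => x z Kx Kz xz.
    by have := hn x z Kx Kz xz; rewrite !mulN1r.
  exists n => x z Kx Kz xz; have [c Ec] := hn x z Kx Kz xz.
  exists (y * c); apply: (O_mulI (varpi_neq0 res Fp0)).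
  rewrite mulrBr -!hu // Ec exprS Ey; ring.
apply/eqP; rewrite -subr_eq0 -rmorphB; apply/eqP/(red_eq0 res); exists (mu u).
have -> : mu f - mu f' = mu (fun x => -1 * f' x + f x) by rewrite mu_lin // mulN1r addrC.
by rewrite -muZ //; apply: mu_eq => x Kx; rewrite -hu // mulN1r addrC.
Qed.

Lemma red_mu_expand (mu : OK) f : contK f ->
  (forall g h, K g -> K h -> rzmx g = rzmx h -> red (f g) = red (f h)) ->
  red (mu f) = \sum_b red (mu (Kind b)) * red (f (Klift b)).
Proof.
move=> cf hf; rewrite (@red_mu mu f (fun g => \sum_b f (Klift b) * Kind b g)) //.
- rewrite mu_sum => [|b]; last by apply: contKZ; apply: Kind_cont.
  rewrite rmorph_sum; apply: eq_bigr => b _; rewrite muZ ?rmorphM 1?mulrC //.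
  exact: Kind_cont.
- by apply: contK_sum => b; apply: contKZ; apply: Kind_cont.
move=> g Kg; rewrite (bigD1 (rzmx g)) //= big1 ?addr0 => [|b bg]; last first.
  by rewrite /Kind eq_sym (negPf bg) mulr0.
rewrite /Kind eqxx mulr1; apply: hf => //; last by rewrite rz_Klift.
by apply: Klift_K; apply: det_rzmx_neq0.
Qed.

Definition augJ (nu : OK) := forall b, red (nu (Kind b)) = 0.

(** A combination of group elements with the same image as mu in O[GL_2(F_p)]. *)
Definition iw_finite (mu : OK) : OK :=
  \sum_b conv (dirac E (Klift b)) (iw_scalar (mu (Kind b))).

Lemma augJ_decomp mu : augJ (mu - iw_finite mu).
Proof.
move=> b; rewrite iwDE iwNE iw_sumE.
have -> : \sum_c conv (dirac E (Klift c)) (iw_scalar (mu (Kind c))) (Kind b) = mu (Kind b).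
  rewrite (bigD1 b) // big1 => [|c cb].
    rewrite [LHS]addr0 conv_scalar; last exact: Kind_cont.
    have [b0|b0] := eqVneq (\det b) 0; first by rewrite (Kind_out mu b0) mul0r.
    rewrite (diracE (Klift_K b0) (@Kind_cont b)).
    by rewrite /Kind rz_Klift eqxx mulr1.
  rewrite conv_scalar; last exact: Kind_cont.
  have [b0|b0] := eqVneq (\det c) 0; first by rewrite (Kind_out mu b0) mul0r.
  rewrite (diracE (Klift_K b0) (@Kind_cont b)).
  by rewrite /Kind rz_Klift (negPf cb) mulr0.
by rewrite subrr rmorph0.
Qed.

Lemma augJ_dirac nu g : K g -> augJ nu -> augJ (conv nu (dirac E g)).
Proof.
move=> Kg Jnu b; rewrite conv_dirac_r //; last exact: Kind_cont.
rewrite -[RHS](Jnu (b *m invmx (rzmx g))); congr (red _); apply: mu_eq => h Kh.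
rewrite /Kind rzmxM //; congr (_%:R); congr (nat_of_bool _).
have gu : rzmx g \in unitmx by rewrite unitmxE unitfE det_rzmx_neq0.
apply/eqP/eqP => [<-|->]; first by rewrite mulmxK.
by rewrite mulmxKV.
Qed.

Lemma augJ_scalar nu c : augJ nu -> augJ (conv nu (iw_scalar c)).
Proof.
move=> Jnu b; rewrite conv_scalar; last exact: Kind_cont.
by rewrite rmorphM Jnu mulr0.
Qed.

Lemma augJ_varpi : augJ (iw_scalar varpi).
Proof.
move=> b; rewrite iw_scalarE; last exact: Kind_cont.
by rewrite rmorphM (red_varpi res) mul0r.
Qed.

Lemma augJ_K1 g : @K1 p Qp g -> augJ (dirac E g - dirac E 1%:M).
Proof.
move=> [Kg g1] b; have K1 := GL2Zp1 Qp; rewrite iwDE iwNE !diracE //; try exact: Kind_cont.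
by rewrite /Kind (proj1 (rzmx_congK Kg K1) g1) subrr rmorph0.
Qed.

End Reduction.
End Measures.

(** * The Iwasawa algebra acting on polynomials *)

Section PolynomialModule.
Variables (p : nat) (Qp : padicField p) (E : fieldExtType Qp).
Local Notation abs := (@padic_abs p Qp).
Local Notation O := (integers E).
Local Notation toO := (toO E).
Local Notation M2 := 'M[Qp]_2.
Local Notation OK := (iwasawa E).
Local Notation K := (@GL2Zp p Qp).
Local Notation Iw := (@Iw p Qp).
Local Notation congK := (@congM p Qp).
Local Notation contK := (@ucont p Qp E M2 congK K).
Local Notation p_pr := (padic_prime Qp).
Local Notation slashO m g h := (slash m (map_mx toO g) h).

Definition contP (f : M2 -> {poly O}) := forall k, contK (fun g => (f g)`_k).

Lemma contP_mul f f' : contP f -> contP f' -> contP (fun g => f g * f' g).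
Proof.
move=> cf cf' k.
apply: (@ucont_eq _ _ _ _ _ _ (fun g => \sum_(j < k.+1) (f g)`_j * (f' g)`_(k - j))).
  by move=> g _; rewrite coefM.
by apply: contK_sum => j; apply: contKM.
Qed.

Lemma contP_exp f n : contP f -> contP (fun g => f g ^+ n).
Proof.
move=> cf; elim: n => [|n IH] k.
  by apply: ucont_eq (contK_cst (if k == 0%N then 1 else 0)) => g _; rewrite expr0 coef1; case: eqP.
have := contP_mul cf IH k; apply: ucont_eq => g _.
by rewrite exprS.
Qed.

Lemma contP_lin (i i' j j' : 'I_2) :
  contP (fun g => toO (g i j) *: 'X + (toO (g i' j'))%:P).
Proof.
move=> k; apply: (@ucont_eq _ _ _ _ _ _
  (fun g : M2 => toO (g i j) * (k == 1%N)%:R + toO (g i' j') * (k == 0%N)%:R)).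
  by move=> g _; rewrite coefD coefZ coefX coefC; case: (k == 0%N); rewrite ?mulr1 ?mulr0.
by apply: contKD; apply: contKM; rewrite ?contK_cst //; [apply: contK_entry|
  apply: contK_cst|apply: contK_entry|apply: contK_cst].
Qed.

Lemma contK_slash m h k : contK (fun g => (slashO m g h)`_k).
Proof.
pose f (i : 'I_m.+1) g := h`_i * (mnum (map_mx toO g) ^+ i * mden (map_mx toO g) ^+ (m - i))`_k.
apply: (@ucont_eq _ _ _ _ _ _ (fun g => \sum_(i < m.+1) f i g)) => [g _|].
  by rewrite slashE coef_sum; apply: eq_bigr => i _; rewrite coefZ.
apply: contK_sum => i; apply: contKZ; apply: (@contP_mul _ _ _ _ k); apply: contP_exp => j.
  by apply: ucont_eq (@contP_lin 0 0 0 1 j) => g _; rewrite /mnum !mxE.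
by apply: ucont_eq (@contP_lin 1 1 0 1 j) => g _; rewrite /mden !mxE.
Qed.

Lemma pol_act_coef m chi h (mu : OK) k :
  (pol_act m chi h mu)`_k = mu (fun g => chi g * (slashO m g h)`_k).
Proof.
rewrite coef_poly; case: ltnP => // mk; rewrite -[LHS](mu0 mu); apply: mu_eq => g _.
by rewrite [X in _ * X]nth_default ?mulr0 // (leq_trans (size_slash _ _ _)).
Qed.

Lemma size_pol_act m chi h (mu : OK) : (size (pol_act m chi h mu) <= m.+1)%N.
Proof. exact: size_poly. Qed.

Section ContinuousCharacter.
Variables (m : nat) (chi : M2 -> O).
Hypothesis chi_cont : contK chi.

Let cont h k : contK (fun g => chi g * (slashO m g h)`_k).
Proof. by apply: contKM => //; apply: contK_slash. Qed.

Lemma pol_act_lin c h h' (mu : OK) :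
  pol_act m chi (c *: h + h') mu = c *: pol_act m chi h mu + pol_act m chi h' mu.
Proof.
apply/polyP => k; rewrite coefD coefZ !pol_act_coef -mu_lin //.
by apply: mu_eq => g _; rewrite slash_linear coefD coefZ; ring.
Qed.

Lemma pol_actD h h' (mu : OK) :
  pol_act m chi (h + h') mu = pol_act m chi h mu + pol_act m chi h' mu.
Proof. by have := pol_act_lin 1 h h' mu; rewrite !scale1r. Qed.

Lemma pol_act0 (mu : OK) : pol_act m chi 0 mu = 0.
Proof.
by apply: (addrI (pol_act m chi 0 mu)); rewrite -pol_actD !addr0.
Qed.

Lemma pol_actZ c h (mu : OK) : pol_act m chi (c *: h) mu = c *: pol_act m chi h mu.
Proof. by rewrite -[c *: h]addr0 pol_act_lin pol_act0 addr0. Qed.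

Lemma pol_act_iwD h (mu nu : OK) :
  pol_act m chi h (mu + nu) = pol_act m chi h mu + pol_act m chi h nu.
Proof. by apply/polyP => k; rewrite coefD !pol_act_coef iwDE. Qed.

Lemma pol_act_iw0 h : pol_act m chi h 0 = 0.
Proof. by apply/polyP => k; rewrite pol_act_coef coef0 iw0E. Qed.

Lemma pol_act_iw_sum (I : Type) (r : seq I) (mu : I -> OK) h :
  pol_act m chi h (\sum_(i <- r) mu i) = \sum_(i <- r) pol_act m chi h (mu i).
Proof. exact: (big_morph _ (pol_act_iwD h) (pol_act_iw0 h)). Qed.

Lemma pol_act_dirac h g : K g -> pol_act m chi h (dirac E g) = chi g *: slashO m g h.
Proof. by move=> Kg; apply/polyP => k; rewrite coefZ pol_act_coef diracE. Qed.

Lemma pol_act_scalar (h : {poly O}) (c : O) : (size h <= m.+1)%N -> chi 1%:M = 1 ->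
  pol_act m chi h (iw_scalar c) = c *: h.
Proof.
move=> sh c1; apply/polyP => k; rewrite coefZ pol_act_coef iw_scalarE // c1 mul1r.
by rewrite map_toO_1 slash_id.
Qed.

(** Fubini: since Sym^m has finite rank, both sides are the same sum of products of matrix
    coefficients of mu and nu. The character has to be multiplicative on S only, where both measures
    live. *)
Lemma pol_act_conv (S : M2 -> Prop) (h : {poly O}) (mu nu : OK) : (size h <= m.+1)%N ->
  (forall g, S g -> K g) ->
  (forall g g', S g -> S g' -> chi (g *m g') = chi g * chi g') ->
  supported S mu -> supported S nu ->
  pol_act m chi h (conv mu nu) = pol_act m chi (pol_act m chi h mu) nu.
Proof.
move=> sh SK chiM Smu Snu; apply/polyP => k; rewrite !pol_act_coef.
pose c i := nu (fun x => chi x * (slashO m x 'X^i)`_k).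
transitivity (\sum_(i < m.+1) c i * (pol_act m chi h mu)`_i); last first.
  rewrite [pol_act m chi h mu in RHS](poly_sumE (size_pol_act m chi h mu)).
  transitivity (nu (fun x => \sum_(i < m.+1) (pol_act m chi h mu)`_i *
      (chi x * (slashO m x 'X^i)`_k))).
    rewrite mu_sum => [|i]; last exact: contKZ.
    by apply: eq_bigr => i _; rewrite muZ // mulrC.
  apply: mu_eq => x _; rewrite slash_sum coef_sum mulr_sumr; apply: eq_bigr => i _.
  by rewrite slashZ coefZ; ring.
rewrite convE //.
transitivity (mu (fun g => \sum_(i < m.+1) c i * (chi g * (slashO m g h)`_i))); last first.
  rewrite mu_sum => [|i]; last exact: contKZ.
  by apply: eq_bigr => i _; rewrite muZ // pol_act_coef.
apply: (supported_eq Smu); first exact: (contK_conv nu (@cont h k)).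
  by apply: contK_sum => i; apply: contKZ.
move=> g Sg; have Kg := SK _ Sg.
transitivity (nu (fun x => \sum_(i < m.+1) (chi g * (slashO m g h)`_i) *
    (chi x * (slashO m x 'X^i)`_k))); last first.
  rewrite mu_sum => [|i]; last exact: contKZ.
  by apply: eq_bigr => i _; rewrite muZ // mulrC.
apply: (supported_eq Snu); first exact: (contK_mull Kg (@cont h k)).
  by apply: contK_sum => i; apply: contKZ.
move=> x Sx; rewrite chiM // map_toO_mul //; last exact: SK.
rewrite -slash_comp // [slash m (map_mx toO g) h in LHS](poly_sumE (size_slash m (map_mx toO g) h)).
rewrite slash_sum coef_sum mulr_sumr; apply: eq_bigr => i _.
by rewrite slashZ coefZ; ring.
Qed.

Section Reduction.
Variables (F : fieldType) (red : {rmorphism O -> F}) (varpi : O).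
Hypotheses (res : is_residue_field red varpi) (Fp0 : p%:R = 0 :> F).
Variable iota : {rmorphism 'F_p -> F}.
Hypothesis iotaE : forall a, iota a = (a : nat)%:R.

Lemma red_toO_iota x : abs x <= 1 -> red (toO x) = iota (rz x).
Proof. by move=> x1; rewrite (red_toO red Fp0 x1) iotaE. Qed.

Lemma map_red_toO g : K g -> map_mx red (map_mx toO g) = map_mx iota (rzmx g).
Proof. by move=> [g1 _]; apply/matrixP => i j; rewrite !mxE red_toO_iota. Qed.

Hypothesis chi_red : forall g g', K g -> K g' -> rzmx g = rzmx g' -> red (chi g) = red (chi g').

Lemma red_pol_act h (mu : OK) : map_poly red (pol_act m chi h mu) =
  \sum_b (red (mu (Kind E b)) * red (chi (Klift Qp b))) *: slashFp iota m b (map_poly red h).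
Proof.
have Hg g k : K g -> red (slashO m g h)`_k = (slashFp iota m (rzmx g) (map_poly red h))`_k.
  by move=> Kg; rewrite -coef_map /= map_slash map_red_toO.
apply/polyP => k; rewrite coef_map /= pol_act_coef coef_sum.
transitivity (\sum_b red (mu (Kind E b)) *
    red (chi (Klift Qp b) * (slashO m (Klift Qp b) h)`_k)).
  apply: (red_mu_expand res Fp0 mu (@cont h k)) => g g' Kg Kg' gg'.
  transitivity (red (chi g) * red ((slashO m g h)`_k)); first exact: rmorphM.
  by rewrite (chi_red Kg Kg' gg') (Hg g k Kg) gg' -(Hg g' k Kg') -rmorphM.
apply: eq_bigr => b _; rewrite coefZ -mulrA.
have -> : red (chi (Klift Qp b) * (slashO m (Klift Qp b) h)`_k) =
    red (chi (Klift Qp b)) * red ((slashO m (Klift Qp b) h)`_k) by exact: rmorphM.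
have [b0|b0] := eqVneq (\det b) 0; first by rewrite Kind_out // rmorph0 !mul0r.
by rewrite (Hg _ k (Klift_K Qp b0)) rz_Klift.
Qed.

End Reduction.
End ContinuousCharacter.

(** * The characters that twist the polynomials *)

Lemma padic_absXz (x : Qp) (n : int) : abs x = 1 -> abs (x ^ n) = 1.
Proof.
move=> x1; case: n => n; first by rewrite -exprnP padic_absX_eq1.
by rewrite NegzE -exprnN padic_absV padic_absX_eq1 // invr1.
Qed.

Lemma omega_pow_M n (x y : Qp) : abs x = 1 -> abs y = 1 ->
  omega_pow E n (x * y) = omega_pow E n x * omega_pow E n y.
Proof.
move=> x1 y1; rewrite /omega_pow teichM // expfzMl toOM //.
  by rewrite padic_absXz ?teich_abs1.
by rewrite padic_absXz ?teich_abs1.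
Qed.

Lemma omega_pow_D n n' (x : Qp) : abs x = 1 ->
  omega_pow E (n + n') x = omega_pow E n x * omega_pow E n' x.
Proof.
move=> x1; have t1 := teich_abs1 x1; rewrite /omega_pow expfzDr.
  by rewrite toOM // padic_absXz.
by rewrite -padic_abs_eq0 t1 oner_eq0.
Qed.

Lemma omega_pow_nat (n : nat) (x : Qp) : abs x = 1 -> omega_pow E n x = toO (teich x) ^+ n.
Proof. by move=> x1; rewrite /omega_pow -exprnP toOX // teich_abs1. Qed.

Lemma omega_pow_congr n (x y : Qp) : abs y = 1 -> abs (x - y) < 1 ->
  omega_pow E n x = omega_pow E n y.
Proof. by move=> y1 xy; rewrite /omega_pow (teich_congr y1 xy). Qed.

Lemma omega_pow_1 n : omega_pow E n (1 : Qp) = 1.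
Proof. by rewrite /omega_pow teich_root ?expr1n // exp1rz toO1. Qed.

Lemma omega_powN n (x : Qp) : abs x = 1 -> omega_pow E (- n) x * omega_pow E n x = 1.
Proof. by move=> x1; rewrite -omega_pow_D // addNr /omega_pow expr0z toO1. Qed.

Lemma K_det_congr g g' : K g -> K g' -> rzmx g = rzmx g' -> abs (\det g - \det g') < 1.
Proof.
move=> Kg Kg' gg'; rewrite -rz_eq0; last first.
  by rewrite padic_absB_le ?Kg.2 ?Kg'.2.
rewrite rzD ?padic_absN ?Kg.2 ?Kg'.2 // rzN ?Kg'.2 // -!det_rzmx // gg'.
by rewrite subrr.
Qed.

Lemma K_entry_congr g g' i j : K g -> K g' -> rzmx g = rzmx g' -> abs (g i j - g' i j) < 1.
Proof.
move=> [g1 _] [g1' _] /matrixP/(_ i j); rewrite !mxE => gg'.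
by rewrite -rz_eq0 ?padic_absB_le // rzD ?padic_absN // rzN // gg' subrr.
Qed.

Lemma chi_ur_congr s g g' : K g -> K g' -> rzmx g = rzmx g' -> chi_ur E s g = chi_ur E s g'.
Proof. by move=> Kg Kg' gg'; apply: omega_pow_congr; [case: Kg' | apply: K_det_congr]. Qed.

Lemma chi_ur_cont s : contK (chi_ur E s).
Proof.
by apply: (@contK_locconst _ _ _ 1%N) => g g' Kg Kg' /(rzmx_congK Kg Kg'); apply: chi_ur_congr.
Qed.

Lemma chi_urM s g g' : K g -> K g' -> chi_ur E s (g *m g') = chi_ur E s g * chi_ur E s g'.
Proof. by move=> [_ g1] [_ g1']; rewrite /chi_ur det_mulmx omega_pow_M. Qed.

Lemma chi_ur1 s : chi_ur E s 1%:M = 1.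
Proof. by rewrite /chi_ur det1 omega_pow_1. Qed.

Lemma red_chi_ur (F : fieldType) (red : {rmorphism O -> F}) (iota : {rmorphism 'F_p -> F})
    (Fp0 : p%:R = 0 :> F) (iotaE : forall a, iota a = (a : nat)%:R) s g : K g ->
  red (chi_ur E s g) * iota (\det (rzmx g)) ^+ s = 1.
Proof.
move=> Kg; have [_ g1] := Kg; have t1 := teich_abs1 g1.
rewrite det_rzmx // -(rz_teich g1) -(red_toO_iota red Fp0 iotaE) ?t1 // -rmorphXn -rmorphM.
by rewrite -omega_pow_nat // /chi_ur omega_powN // rmorph1.
Qed.

Lemma Iw_K g : Iw g -> K g. Proof. by case. Qed.

Lemma Iw_11 g : Iw g -> abs (g 1 1) = 1 /\ abs (g 0 0) = 1.
Proof.
move=> [[g1 gd] g10]; have : abs (g 0 0 * g 1 1) = 1.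
  rewrite -gd; apply: padic_abs_eq; rewrite gd det_mx2 opprB addrC subrK padic_absM.
  by apply: le_lt_trans g10; rewrite ler_piMl ?padic_abs_ge0.
rewrite padic_absM => h; have a0 := g1 0 0; have a1 := g1 1 1.
have p0 := padic_abs_ge0 (g 0 0); have p1 := padic_abs_ge0 (g 1 1).
split; apply/eqP; rewrite eq_le ?a1 ?a0 /= -h.
  by rewrite -[leRHS]mul1r ler_wpM2r.
by rewrite -[leRHS]mulr1 ler_wpM2l.
Qed.

Lemma IwM g g' : Iw g -> Iw g' -> Iw (g *m g').
Proof.
move=> [Kg g10] [Kg' g10']; split; first exact: GL2ZpM.
rewrite mulmx2E; apply: padic_absD_lt; rewrite padic_absM.
  by apply: le_lt_trans g10; rewrite ler_piMr ?padic_abs_ge0 //; case: Kg'.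
by apply: le_lt_trans g10'; rewrite ler_piMl ?padic_abs_ge0 //; case: Kg.
Qed.

Lemma Iw1 : Iw 1%:M.
Proof. by split; [exact: GL2Zp1 | rewrite mxE padic_abs0 ltr01]. Qed.

Lemma Iw_congr g g' : K g -> K g' -> rzmx g = rzmx g' -> Iw g -> Iw g'.
Proof.
move=> Kg Kg' gg' [_ g10]; split=> //.
rewrite -[g' 1 0](subrK (g 1 0)); apply: padic_absD_lt => //.
by rewrite padic_absBC; apply: K_entry_congr.
Qed.

Lemma chi_Iw_cont s k : contK (chi_Iw E s k).
Proof.
apply: (@contK_locconst _ _ _ 1%N) => g g' Kg Kg' /(rzmx_congK Kg Kg') gg'.
rewrite /chi_Iw; case: asboolP => Ig; last first.
  by rewrite asboolF // => Ig'; apply: Ig; apply: (Iw_congr Kg' Kg).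
have Ig' := Iw_congr Kg Kg' gg' Ig; rewrite asboolT //.
have [a1 _] := Iw_11 Ig; have [a1' _] := Iw_11 Ig'.
have h := K_entry_congr 1 1 Kg Kg' gg'.
congr (_ * _); apply: omega_pow_congr => //.
  by rewrite padic_absM padic_absV Kg'.2 a1' invr1 mulr1.
have g0 : g 1 1 != 0 by rewrite -padic_abs_eq0 a1 oner_eq0.
have g0' : g' 1 1 != 0 by rewrite -padic_abs_eq0 a1' oner_eq0.
have -> : \det g / g 1 1 - \det g' / g' 1 1 =
  ((\det g - \det g') * g' 1 1 - \det g' * (g 1 1 - g' 1 1)) * (g 1 1 * g' 1 1)^-1.
  by field; rewrite g0 g0'.
rewrite padic_absM padic_absV padic_absM a1 a1' mulr1 invr1 mulr1.
apply: padic_absB_lt; rewrite padic_absM.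
  by rewrite a1' mulr1; apply: K_det_congr.
by rewrite Kg'.2 mul1r.
Qed.

Lemma chi_IwE s k g : Iw g -> chi_Iw E s k g =
  omega_pow E (- s%:Z) (\det g / g 1 1) * omega_pow E (s%:Z + (2 - k%:Z)) (g 1 1).
Proof. by move=> Ig; rewrite /chi_Iw asboolT. Qed.

(** On Iw the lower right entry is multiplicative modulo p, hence so is det divided by it, and
    powers of omega see residues only. *)
Lemma chi_IwM s k g g' : Iw g -> Iw g' ->
  chi_Iw E s k (g *m g') = chi_Iw E s k g * chi_Iw E s k g'.
Proof.
move=> Ig Ig'; have Igg := IwM Ig Ig'; rewrite !chi_IwE //.
have [a1 _] := Iw_11 Ig; have [a1' _] := Iw_11 Ig'; have [a1g _] := Iw_11 Igg.
have d1 := Ig.1.2; have d1' := Ig'.1.2.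
have hh : abs ((g *m g') 1 1 - g 1 1 * g' 1 1) < 1.
  rewrite mulmx2E addrK padic_absM; apply: le_lt_trans Ig.2.
  by rewrite ler_piMr ?padic_abs_ge0 //; case: Ig' => [[]].
have aa : abs (g 1 1 * g' 1 1) = 1 by rewrite padic_absM a1 a1' mulr1.
rewrite (omega_pow_congr _ aa hh) omega_pow_M //.
have -> : omega_pow E (- s%:Z) (\det (g *m g') / (g *m g') 1 1) =
   omega_pow E (- s%:Z) (\det g / g 1 1) * omega_pow E (- s%:Z) (\det g' / g' 1 1).
  rewrite -omega_pow_M ?padic_absM ?padic_absV ?a1 ?a1' ?d1 ?d1' ?invr1 ?mulr1 //.
  have g0 : g 1 1 != 0 by rewrite -padic_abs_eq0 a1 oner_eq0.
  have g0' : g' 1 1 != 0 by rewrite -padic_abs_eq0 a1' oner_eq0.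
  have g0g : (g *m g') 1 1 != 0 by rewrite -padic_abs_eq0 a1g oner_eq0.
  apply: omega_pow_congr.
    by rewrite !padic_absM !padic_absV a1 a1' d1 d1' invr1 !mulr1.
  have -> : \det (g *m g') / (g *m g') 1 1 - \det g / g 1 1 * (\det g' / g' 1 1) =
      \det g * \det g' * - ((g *m g') 1 1 - g 1 1 * g' 1 1) * ((g *m g') 1 1 * (g 1 1 * g' 1 1))^-1.
    by rewrite det_mulmx; field; rewrite g0 g0' g0g.
  rewrite padic_absM padic_absV padic_absM a1g aa mulr1 invr1 mulr1.
  by rewrite !padic_absM d1 d1' !mul1r padic_absN.
ring.
Qed.

Lemma chi_Iw1 s k : chi_Iw E s k 1%:M = 1.
Proof.
rewrite chi_IwE ?mxE ?det1 //=; last exact: Iw1.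
by rewrite divr1 !omega_pow_1 mulr1.
Qed.

End PolynomialModule.

(** * GL_2(F_p) and the characteristic of F *)

Lemma GL2_exists (p : nat) (b : 'M['F_p]_2) : \det b != 0 ->
  exists x : {'GL_2['F_p]}, GLval x = b.
Proof.
move=> b0; have bu : b \is a GRing.unit by rewrite -[_ \is a _]/(b \in unitmx) unitmxE unitfE.
by exists (FinRing.Unit bu).
Qed.

Lemma GL2_det (p : nat) (x : {'GL_2['F_p]}) : prime p -> \det (GLval x) != 0.
Proof.
by move=> p_pr; have := valP x; rewrite -[_ \is a _]/(GLval x \in unitmx) unitmxE unitfE.
Qed.

(** The unipotents with entries 1 and -1 are inverse to each other, but [ofFp] sends -1 to p - 1;
    acting on X by both must give X back, so 1 + (p - 1) = 0 in F. *)
Lemma envelope_char (p : nat) (F : fieldType) (n : nat)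
    (rP : mx_representation F [set: {'GL_2['F_p]}]%G n) (pi : {linear 'rV[F]_n -> {poly F}}) :
  prime p -> (2 < p)%N -> is_envelope_sym p.-1 rP pi -> p%:R = 0 :> F.
Proof.
move=> p_pr p_gt2 env; pose u c : 'M['F_p]_2 := mx2 1 c 0 1.
have du c : \det (u c) != 0 by rewrite det_mx2 !mxE /= mulr1 mulr0 subr0 oner_neq0.
have [x Ex] := GL2_exists (du 1); have [y Ey] := GL2_exists (du (-1)).
have xy : (x * y = 1)%g.
  have M1 : u 1 *m u (-1) = 1%:M.
    rewrite mul_mx2; apply/matrixP => i j; rewrite !mxE.
    by case: i => [[|[|]]] // ?; case: j => [[|[|]]] // ? /=; ring.
  by apply: val_inj; rewrite -[LHS]/(GLval x *m GLval y) Ex Ey M1.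
have sX : (size ('X : {poly F}) <= p.-1.+1)%N by rewrite size_polyX; lia.
have [v Ev] := env_surj env sX.
have pE : (Zp_trunc (pdiv p)).+2 = p by exact: Fp_cast.
have o1 : ofFp F (1 : 'F_p) = 1 by rewrite /ofFp /= pE modn_small ?prime_gt1.
have sl c h : slash p.-1 (map_mx (@ofFp p F) (u c)) h =
    slash p.-1 (mx2 1 (ofFp F c) 0 1) h.
  by rewrite map_mx2 o1.
have slX (c : F) : slash p.-1 (mx2 1 c 0 1) 'X = 'X + c%:P.
  rewrite -[X in slash _ _ X]expr1 slash_Xn; last by lia.
  by rewrite /mnum /mden !mxE /= scale1r scale0r add0r expr1n mulr1.
have slC (c d : F) : slash p.-1 (mx2 1 c 0 1) d%:P = d%:P.
  rewrite -[d%:P]mulr1 mul_polyC slashZ slash_1 /mden !mxE /= scale0r add0r expr1n.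
  by rewrite -mul_polyC mulr1.
have := env_equiv env (v *m rP x) y; rewrite -mulmxA -repr_mxM ?inE // xy repr_mx1 mulmx1.
rewrite (env_equiv env) Ex Ey !sl Ev slX slashD slX slC -addrA => /eqP.
rewrite -subr_eq0 opprD addrA subrr sub0r oppr_eq0 -polyCD polyC_eq0 o1 /ofFp natr1 => h.
set b := (-1 : 'F_p) in h *.
have pb : (p %| b.+1)%N.
  by rewrite (dvdn_pcharf (pchar_Fp p_pr)) -natr1 natr_Zp /b addNr.
have -> : p = b.+1; last exact/eqP.
have bp : (b < p)%N by rewrite -[in X in (_ < X)%N]pE ltn_ord.
by apply/eqP; rewrite eqn_leq bp dvdn_leq.
Qed.

Section RightModule.
Variables (p : nat) (Qp : padicField p) (E : fieldExtType Qp).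
Local Notation O := (integers E).
Local Notation OK := (iwasawa E).
Variable H : lmodType OK^c.
Local Notation "x ** mu" := (Defs.ract x mu) (at level 40, left associativity).

Lemma ractDr (x : H) mu nu : x ** (mu + nu) = x ** mu + x ** nu.
Proof. exact: scalerDl. Qed.
Lemma ractNr (x : H) mu : x ** (- mu) = - (x ** mu).
Proof. exact: scaleNr. Qed.
Lemma ract0r (x : H) : x ** 0 = 0. Proof. exact: scale0r. Qed.
Lemma ract_sumr (I : Type) (r : seq I) (P : pred I) (mu : I -> OK) (x : H) :
  x ** (\sum_(i <- r | P i) mu i) = \sum_(i <- r | P i) x ** mu i.
Proof. exact: scaler_suml. Qed.
Lemma ract_suml (I : Type) (r : seq I) (P : pred I) (x : I -> H) mu :
  (\sum_(i <- r | P i) x i) ** mu = \sum_(i <- r | P i) x i ** mu.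
Proof. exact: scaler_sumr. Qed.
Lemma ractM (x : H) mu nu : x ** conv mu nu = x ** mu ** nu.
Proof. by rewrite /Defs.ract scalerA. Qed.
Lemma ract1 (x : H) : x ** dirac E 1%:M = x.
Proof. exact: scale1r. Qed.

End RightModule.

(** * The Steinberg quotient of H *)

Section Envelope.
Variables (p : nat) (Qp : padicField p) (E : fieldExtType Qp).
Local Notation abs := (@padic_abs p Qp).
Local Notation O := (integers E).
Local Notation M2 := 'M[Qp]_2.
Local Notation OK := (iwasawa E).
Local Notation K := (@GL2Zp p Qp).
Local Notation p_pr := (padic_prime Qp).
Variables (F : fieldType) (red : {rmorphism O -> F}) (varpi : O).
Hypotheses (res : is_residue_field red varpi) (Fp0 : p%:R = 0 :> F) (p_gt2 : (2 < p)%N).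
Variable iota : {rmorphism 'F_p -> F}.
Hypothesis iotaE : forall a, iota a = (a : nat)%:R.
Variable H : lmodType OK^c.
Local Notation "x ** mu" := (Defs.ract x mu) (at level 40, left associativity).
Variables (act : H -> M2 -> H) (e : H).
Hypotheses (nrm : normalized act e).
Variables (n : nat) (rP : mx_representation F [set: {'GL_2['F_p]}]%G n).
Variables (pi : {linear 'rV[F]_n -> {poly F}}) (q : H -> 'rV[F]_n).
Hypotheses (env : is_envelope_sym p.-1 rP pi)
  (q_lin : forall c x y, q (x ** iw_scalar c + y) = red c *: q x + q y)
  (q_eq : forall x g gb, K g -> reduces_to g gb -> q (x ** dirac E g) = q x *m rP gb)
  (q_surj : forall v, exists x, q x = v)
  (q_ker : forall x, q x = 0 <-> exists (y : H) (s : seq (H * M2)),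
        (forall u, u \in s -> @K1 p Qp u.2) /\
        x = y ** iw_scalar varpi + \sum_(u <- s) (u.1 ** dirac E u.2 - u.1)).
Local Notation sl := (slashFp iota).

Lemma iw_scalar1 : iw_scalar 1 = dirac E (1%:M : M2).
Proof. by apply: iwasawaE => f cf; rewrite iw_scalarE // mul1r diracE //; apply: GL2Zp1. Qed.

Lemma q_D x y : q (x + y) = q x + q y.
Proof. by have := q_lin 1 x y; rewrite iw_scalar1 ract1 rmorph1 scale1r. Qed.

Lemma q_0 : q 0 = 0.
Proof. by apply: (addrI (q 0)); rewrite -q_D !addr0. Qed.

Lemma q_Z x c : q (x ** iw_scalar c) = red c *: q x.
Proof. by have := q_lin c x 0; rewrite !addr0 q_0 addr0. Qed.

Lemma q_N x : q (- x) = - q x.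
Proof. by apply/eqP; rewrite -addr_eq0 -q_D addNr q_0. Qed.

Definition stq (x : H) : {poly F} := pi (q x).

Lemma stqD x y : stq (x + y) = stq x + stq y.
Proof. by rewrite /stq q_D linearD. Qed.
Lemma stq0 : stq 0 = 0. Proof. by rewrite /stq q_0 linear0. Qed.
Lemma stqN x : stq (- x) = - stq x.
Proof. by rewrite /stq q_N linearN. Qed.
Lemma stqZ x c : stq (x ** iw_scalar c) = red c *: stq x.
Proof. by rewrite /stq q_Z linearZ. Qed.
Lemma stq_sum (I : Type) (r : seq I) (x : I -> H) :
  stq (\sum_(i <- r) x i) = \sum_(i <- r) stq (x i).
Proof. exact: (big_morph stq stqD stq0). Qed.

Lemma size_stq x : (size (stq x) <= p)%N.
Proof. by have := env_sub env (q x); rewrite prednK // prime_gt0 // p_pr. Qed.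

Lemma stq_surj (h : {poly F}) : (size h <= p)%N -> exists x, stq x = h.
Proof.
rewrite -[X in (_ <= X)%N](prednK (prime_gt0 p_pr)) => /(env_surj env)[v <-].
by have [x <-] := q_surj v; exists x.
Qed.

Lemma reduces_toP g (gb : {'GL_2['F_p]}) : K g -> rzmx g = GLval gb -> reduces_to g gb.
Proof.
move=> [g1 _] E0 i j; have := rzP (g1 i j).
by have -> : rz (g i j) = GLval gb i j by rewrite -E0 mxE.
Qed.

Lemma map_ofFp (b : 'M['F_p]_2) : map_mx (@ofFp p F) b = map_mx iota b.
Proof. by apply/matrixP => i j; rewrite !mxE iotaE. Qed.

Lemma q_dirac x g (gb : {'GL_2['F_p]}) : K g -> rzmx g = GLval gb ->
  q (x ** dirac E g) = q x *m rP gb.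
Proof. by move=> Kg ggb; apply: q_eq => //; apply: reduces_toP. Qed.

Lemma stq_dirac x g : K g -> stq (x ** dirac E g) = sl p.-1 (rzmx g) (stq x).
Proof.
move=> Kg; have [gb Egb] := GL2_exists (det_rzmx_neq0 Kg).
by rewrite /stq (q_dirac x Kg (esym Egb)) (env_equiv env) Egb map_ofFp.
Qed.

(* x lies in H . J, J the kernel of O[[K]] -> F[GL_2(F_p)]. *)
Definition inHJ (x : H) := exists s : seq (H * OK),
  (forall u, u \in s -> augJ red u.2) /\ x = \sum_(u <- s) u.1 ** u.2.

Lemma inHJ_1 x nu : augJ red nu -> inHJ (x ** nu).
Proof.
move=> Jnu; exists [:: (x, nu)]; split; last by rewrite big_seq1.
by move=> u; rewrite inE => /eqP ->.
Qed.

Lemma inHJ_0 : inHJ 0.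
Proof. by exists [::]; split => //; rewrite big_nil. Qed.

Lemma inHJ_D x y : inHJ x -> inHJ y -> inHJ (x + y).
Proof.
move=> [s [Js ->]] [t [Jt ->]]; exists (s ++ t); split; last by rewrite big_cat.
by move=> u; rewrite mem_cat => /orP[/Js|/Jt].
Qed.

Lemma inHJ_sum (I : eqType) (r : seq I) (x : I -> H) :
  (forall i, i \in r -> inHJ (x i)) -> inHJ (\sum_(i <- r) x i).
Proof.
move=> h; rewrite big_seq; elim/big_ind: _ => //; first exact: inHJ_0.
exact: inHJ_D.
Qed.

Lemma inHJ_map x mu : (forall nu, augJ red nu -> augJ red (conv nu mu)) ->
  inHJ x -> inHJ (x ** mu).
Proof.
move=> Jmu [s [Js ->]]; rewrite ract_suml; apply: inHJ_sum => u us.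
by rewrite -ractM; apply: inHJ_1; apply: Jmu; apply: Js.
Qed.

Lemma inHJ_dirac x g : K g -> inHJ x -> inHJ (x ** dirac E g).
Proof. by move=> Kg; apply: inHJ_map => nu; apply: augJ_dirac. Qed.

Lemma inHJ_Z x c : inHJ x -> inHJ (x ** iw_scalar c).
Proof. by apply: inHJ_map => nu; apply: augJ_scalar. Qed.

Lemma q_ker_inHJ x : q x = 0 -> inHJ x.
Proof.
move=> /q_ker[y [s [Ks ->]]]; apply: inHJ_D.
  by apply: inHJ_1; apply: (augJ_varpi res).
apply: inHJ_sum => u us; rewrite -{2}[u.1]ract1 -ractNr -ractDr.
by apply: inHJ_1; apply: augJ_K1; apply: Ks.
Qed.

Lemma I1_rz g : @I1 p Qp g -> rzmx g = mx2 1 (rz (g 0 1)) 0 1.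
Proof.
move=> [[[g1 gd] g10] [g00 g11]]; rewrite [LHS]mx2_eta !mxE.
congr (mx2 _ _ _ _); first by rewrite -(rz1 Qp); apply: rz_congr; rewrite ?padic_abs1.
  by apply/eqP; rewrite rz_eq0.
by rewrite -(rz1 Qp); apply: rz_congr; rewrite ?padic_abs1.
Qed.

Lemma I1P g y : K g -> rzmx g = mx2 1 y 0 1 -> @I1 p Qp g.
Proof.
move=> Kg /matrixP h; have [g1 _] := Kg.
have u i j : abs (g i j) <= 1 by [].
split; [split=> // | split].
- by rewrite -rz_eq0 //; have := h 1 0; rewrite !mxE /= => ->.
- have := h 0 0; rewrite !mxE /= => h0.
  by rewrite -rz_eq0 ?padic_absB_le ?padic_abs1 // rzD ?padic_absN ?padic_abs1 // rzN
    ?padic_abs1 // h0 rz1 subrr.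
have := h 1 1; rewrite !mxE /= => h0.
by rewrite -rz_eq0 ?padic_absB_le ?padic_abs1 // rzD ?padic_absN ?padic_abs1 // rzN
  ?padic_abs1 // h0 rz1 subrr.
Qed.

Lemma I1_K g : @I1 p Qp g -> K g. Proof. by case=> [[]]. Qed.

Lemma I1M g g' : @I1 p Qp g -> @I1 p Qp g' -> @I1 p Qp (g *m g').
Proof.
move=> Ig Ig'; have Kg := I1_K Ig; have Kg' := I1_K Ig'.
apply: (@I1P _ (rz (g' 0 1) + rz (g 0 1))); first exact: GL2ZpM.
rewrite rzmxM // (I1_rz Ig) (I1_rz Ig') mul_mx2.
by rewrite !(mulr0, mulr1, mul0r, mul1r, addr0, add0r).
Qed.

Lemma I1_1 : @I1 p Qp 1%:M.
Proof.
apply: (@I1P _ 0); first exact: GL2Zp1.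
rewrite rzmx1; apply/matrixP => i j; rewrite !mxE.
by case: i => [[|[|]]] //; case: j => [[|[|]]].
Qed.

Lemma K1_I1 g : @K1 p Qp g -> @I1 p Qp g.
Proof.
move=> [Kg /(rzmx_congK Kg (GL2Zp1 Qp)) g1]; apply: (@I1P _ 0) => //.
rewrite g1 rzmx1; apply/matrixP => i j; rewrite !mxE.
by case: i => [[|[|]]] //; case: j => [[|[|]]].
Qed.

Lemma supportedS (S T : M2 -> Prop) (mu : OK) : (forall g, S g -> T g) ->
  supported S mu -> supported T mu.
Proof. by move=> ST Smu f cf f0; apply: Smu => // g /ST; apply: f0. Qed.

Lemma e_basis x : exists2 mu : OK, supported (@I1 p Qp) mu & x = e ** mu.
Proof. by have [mu [[Smu xE] _]] := norm_basis nrm x; exists mu. Qed.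

Lemma e_basis_uniq (mu nu : OK) : supported (@I1 p Qp) mu -> supported (@I1 p Qp) nu ->
  e ** mu = e ** nu -> mu = nu.
Proof.
move=> Smu Snu E0; have [k [_ uk]] := norm_basis nrm (e ** mu).
by rewrite -(uk mu) // (uk nu).
Qed.

Let one : M2 -> O := fun=> 1.

(** Split nu along the cosets g_b K_1, the parts k_b having mass 0 in F. Each x g_b is [e] times a
    measure m_b on I_1, and K_1 lies in I_1, so k is the sum of the m_b k_b; masses multiply under
    convolution. *)
Lemma HJ_e_aug (x : H) nu : augJ red nu ->
  exists k : OK, [/\ supported (@I1 p Qp) k, red (k one) = 0 & x ** nu = e ** k].
Proof.
(* For singular b the value 1 only keeps [g b] in K: the fibre over b is empty. *)
move=> Jnu; pose g (b : 'M['F_p]_2) : M2 := if \det b != 0 then Klift Qp b else 1%:M.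
have Kg b : K (g b).
  by rewrite /g; case: ifP => [/(Klift_K Qp)|_] //; apply: GL2Zp1.
have cu b := @Kind_cont p Qp E b.
have SK : supported K nu by move=> f cf f0; rewrite -(mu0 nu); apply: mu_eq.
have h1 y : K y -> \sum_b Kind E b y = 1.
  move=> Ky; rewrite (bigD1 (rzmx y)) //= /Kind eqxx big1 ?addr0 // => b.
  by rewrite eq_sym => /negPf ->.
have h2 b y : K y -> ~ @K1 p Qp (invmx (g b) *m y) -> Kind E b y = 0.
  move=> Ky; rewrite /Kind; case: eqP => // yb []; split; first exact/GL2ZpM/Ky/K_inv.
  have b0 : \det b != 0 by rewrite -yb det_rzmx_neq0.
  rewrite /g b0; have Kb := Klift_K Qp b0.
  apply/rzmx_congK; [exact/GL2ZpM/Ky/K_inv | exact: GL2Zp1 |].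
  rewrite rzmxM //; last exact: K_inv.
  rewrite yb -{2}(rz_Klift Qp b) -rzmxM //; last exact: K_inv.
  by rewrite mulVmx // K_unit.
pose k b := conv (dirac E (invmx (g b))) (restr nu (cu b)).
have [nuE Sk] : nu = \sum_b conv (dirac E (g b)) (k b) /\ forall b, supported (@K1 p Qp) (k b).
  exact: (coset_decomp cu Kg SK h1 h2).
have hk b : red (k b one) = 0.
  rewrite /k conv_dirac_l; [|exact: K_inv|exact: contK_cst].
  rewrite restrE; last exact: contK_cst.
  by rewrite -[RHS](Jnu b); congr (red _); apply: mu_eq => y _; rewrite mulr1.
have /choice[m hm] : forall b, exists mu : OK,
    supported (@I1 p Qp) mu /\ x ** dirac E (g b) = e ** mu.
  by move=> b; have [mu] := e_basis (x ** dirac E (g b)); exists mu.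
have Sk' b : supported (@I1 p Qp) (k b).
  exact: supportedS K1_I1 (Sk b).
exists (\sum_b conv (m b) (k b)); split.
- apply: supported_sum => b; apply: supported_conv; [exact: I1M | exact: I1_K | |exact: Sk'].
  by case: (hm b).
- rewrite iw_sumE rmorph_sum big1 // => b _; rewrite convE; last exact: contK_cst.
  have -> : m b (fun=> k b (fun=> one 1%:M)) = k b one * m b one.
    rewrite -muZ; last exact: contK_cst.
    by apply: mu_eq => y _; rewrite mulr1.
  by rewrite rmorphM hk mul0r.
rewrite nuE !ract_sumr; apply: eq_bigr => b _.
by rewrite !ractM (hm b).2.
Qed.

(* An element of H . J is e k with k supported on I_1 of total mass 0 in F. *)
Lemma e_notin_HJ : ~ inHJ e.
Proof.
move=> [s [Js Es]].
have : exists k : OK, [/\ supported (@I1 p Qp) k, red (k one) = 0 & \sum_(u <- s) u.1 ** u.2 = e ** k].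
  rewrite big_seq; elim/big_ind: _ => [|x y [k [Sk k1 ->]] [k' [Sk' k1' ->]]|u us].
  - by exists 0; split; rewrite ?ract0r ?iw0E ?rmorph0.
  - exists (k + k'); rewrite iwDE rmorphD k1 k1' addr0 ractDr; split=> //.
    by move=> f cf f0; rewrite iwDE Sk // Sk' // addr0.
  - by apply: HJ_e_aug; apply: Js.
move=> [k [Sk k1 Ek]].
have : k = dirac E 1%:M.
  apply: e_basis_uniq => //; first exact/supported_dirac/I1_1.
  by rewrite ract1 -Ek -Es.
move=> kE; move: k1; rewrite kE diracE ?rmorph1; [|exact: GL2Zp1|exact: contK_cst].
by move/eqP; rewrite oner_eq0.
Qed.

(** The submodule generated by q x maps onto Sym^(p-1), since translates of 1 span; as the envelope
    is essential, it is everything. *)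
Lemma stq_cyclic x : stq x = 1 -> forall v, exists2 A : 'M[F]_n,
  (A \in enveloping_algebra_mx rP)%MS & v = q x *m A.
Proof.
move=> x1 v; apply/cyclic_mxP; apply: submx_full; apply: (env_essential env).
  exact: cyclic_mx_module.
have cyc (g : {'GL_2['F_p]}) : (q x *m rP g <= cyclic_mx rP (q x))%MS.
  by apply: mxmodule_trans (cyclic_mx_id _ _); rewrite ?inE //; apply: cyclic_mx_module.
move=> h; rewrite prednK ?prime_gt0 ?p_pr // => sh.
have /choice[w hw] d : exists g : {'GL_2['F_p]}, GLval g = W d.
  by apply: GL2_exists; rewrite det_W oner_eq0.
exists (- (h`_p.-1 *: q x + \sum_d h.[iota (- d)] *: (q x *m rP (w d)))).
  rewrite eqmx_opp; apply: addmx_sub; first by apply: scalemx_sub; apply: cyclic_mx_id.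
  by apply: summx_sub => d _; apply: scalemx_sub.
rewrite linearN linearD linearZ linear_sum /= -/(stq x) x1 -[RHS](stform_id iota p_pr p_gt2 sh).
congr (- (_ + _)); apply: eq_bigr => d _.
by rewrite linearZ /= (env_equiv env) hw map_ofFp -/(stq x) x1.
Qed.

(* The image of H . J in the simple module Sym^(p-1) would otherwise be everything; as the
   projective envelope is essential, H . J would then be H, but it does not contain e. *)
Lemma stq_inHJ x : inHJ x -> stq x = 0.
Proof.
move=> Hx; apply/eqP; apply: contrapT => /negP x0.
pose P h := exists2 y, inHJ y & stq y = h.
have [y Hy y1] : P 1.
  apply: (@st_irreducible p F iota p_pr p_gt2 P (stq x)) => //; last 2 first.
  - by exists x.
  - by rewrite size_poly1 prime_gt0 // p_pr.
  - by move=> _ [y _ <-]; apply: size_stq.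
  - move=> c _ _ [y Hy <-] [z Hz <-]; have [c' <-] := res.1 c.
    by exists (y ** iw_scalar c' + z); rewrite ?stqD ?stqZ //; apply: inHJ_D => //; apply: inHJ_Z.
  - move=> g _ dg [y Hy <-]; exists (y ** dirac E (Klift Qp g)).
      by apply: inHJ_dirac => //; apply: Klift_K.
    by rewrite stq_dirac ?rz_Klift //; apply: Klift_K.
have [A /envelop_mxP[c cA] qe] := stq_cyclic y1 (q e).
have [z Hz Ez] : exists2 z, inHJ z & q z = q e.
  rewrite qe cA mulmx_sumr; elim/big_ind: _ => [|u v [a Ha <-] [b Hb <-]|g _].
  - by exists 0; [apply: inHJ_0 | rewrite q_0].
  - by exists (a + b); [apply: inHJ_D | rewrite q_D].
  have [c' Ec'] := res.1 (c g); have Kg := Klift_K Qp (GL2_det g p_pr).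
  exists (y ** dirac E (Klift Qp (GLval g)) ** iw_scalar c').
    by apply: inHJ_Z; apply: inHJ_dirac.
  by rewrite q_Z Ec' (q_dirac _ Kg (rz_Klift _ _)) -scalemxAr.
apply: e_notin_HJ; rewrite -[e](subrK z); apply: inHJ_D => //.
by apply: q_ker_inHJ; rewrite q_D q_N Ez subrr.
Qed.

Let u (y : 'F_p) : 'M['F_p]_2 := mx2 1 y 0 1.

Lemma det_unip y : \det (u y) != 0.
Proof. by rewrite det_mx2 !mxE /= mulr1 mulr0 subr0 oner_neq0. Qed.

(** Modulo HJ only the image of mu in O[GL_2(F_p)] counts, and a measure on I_1 has its image
    carried by the upper unipotents. *)
Lemma e_expand x : exists c : 'F_p -> O,
  inHJ (x - \sum_y e ** dirac E (Klift Qp (u y)) ** iw_scalar (c y)).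
Proof.
have [mu Smu ->] := e_basis x; exists (fun y => mu (Kind E (u y))).
have -> : \sum_y e ** dirac E (Klift Qp (u y)) ** iw_scalar (mu (Kind E (u y))) =
    e ** iw_finite mu.
  rewrite /iw_finite ract_sumr (bigID (fun b => b \in [set u y | y : 'F_p])) /=.
  rewrite [X in _ + X]big1 ?addr0.
    rewrite big_imset /= => [|y y' _ _ /matrixP/(_ 0 1)]; last by rewrite !mxE.
    by apply: eq_big => // y _; rewrite ractM.
  move=> b /negP nb; have -> : mu (Kind E b) = 0.
    apply: Smu; first exact: Kind_cont.
    move=> g Ig; rewrite /Kind; case: eqP => // gb; case: nb; apply/imsetP.
    by exists (rz (g 0 1)); rewrite // -gb (I1_rz Ig).
  by rewrite ractM (_ : iw_scalar 0 = 0) ?ract0r //; apply: iwasawaE => f cf;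
    rewrite iw_scalarE // mul0r.
by rewrite -ractNr -ractDr; apply: inHJ_1; apply: augJ_decomp.
Qed.

(* The p unipotent translates of the image of e span Sym^(p-1), which has dimension p. *)
Lemma unip_indep (c : 'F_p -> F) :
  \sum_y c y *: sl p.-1 (u y) (stq e) = 0 -> forall y, c y = 0.
Proof.
move=> c0; pose N := (Zp_trunc (pdiv p)).+2.
have NE : N = p by exact: (Fp_cast p_pr).
pose A : 'M[F]_N := \matrix_(y, j) (sl p.-1 (u y) (stq e))`_j.
have span (h : {poly F}) : (size h <= p)%N -> exists d : 'F_p -> F,
    h = \sum_y d y *: sl p.-1 (u y) (stq e).
  move=> /stq_surj[x <-]; have [d /stq_inHJ] := e_expand x.
  rewrite stqD stqN => /eqP; rewrite subr_eq0 stq_sum => /eqP ->.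
  exists (red \o d); apply: eq_bigr => y _.
  by rewrite stqZ stq_dirac ?rz_Klift //; apply: Klift_K; apply: det_unip.
have fullA : row_full A.
  rewrite -sub1mx; apply/row_subP => j; rewrite rowE mulmx1.
  have [|d Ed] := span 'X^j; first by rewrite size_polyXn -[X in (_ <= X)%N]NE ltn_ord.
  apply/submxP; exists (\row_y d y); apply/rowP => k; rewrite !mxE.
  have := congr1 (fun h : {poly F} => h`_k) Ed; rewrite coefXn coef_sum eqxx andTb => E0.
  rewrite -[LHS]/((k == j)%:R : F) -val_eqE /= E0.
  by apply: eq_bigr => y _; rewrite !mxE coefZ.
have freeA : row_free A by rewrite row_free_unit -row_full_unit.
have : (\row_y c y) *m A = 0 *m A.
  rewrite mul0mx; apply/rowP => k; rewrite !mxE.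
  have := congr1 (fun h : {poly F} => h`_k) c0; rewrite coef0 coef_sum => E0.
  by rewrite -[RHS]E0; apply: eq_bigr => y _; rewrite !mxE coefZ.
by move=> /(row_free_inj freeA)/rowP E0 y; have := E0 y; rewrite !mxE.
Qed.

(** Modulo HJ, x is a combination of the unipotent translates of [e]; as their images are
    independent, stq x = 0 forces the coefficients to reduce to 0, and such scalars lie in J. *)
Lemma stq_eq0 x : stq x = 0 <-> inHJ x.
Proof.
split=> [x0|]; last exact: stq_inHJ.
have [c Hc] := e_expand x; have := stq_inHJ Hc.
rewrite stqD x0 stqN add0r => /eqP; rewrite oppr_eq0 stq_sum => /eqP c0.
have hc y : red (c y) = 0.
  apply: (@unip_indep (red \o c)); rewrite -[RHS]c0; apply: eq_bigr => z _.
  by rewrite stqZ stq_dirac ?rz_Klift //; apply: Klift_K; apply: det_unip.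
rewrite -[x](subrK (\sum_y e ** dirac E (Klift Qp (u y)) ** iw_scalar (c y))).
apply: inHJ_D => //; apply: inHJ_sum => y _; apply: inHJ_1 => b.
rewrite iw_scalarE; last exact: Kind_cont.
by rewrite rmorphM hc mul0r.
Qed.

End Envelope.

(** * Homomorphisms over O[[K]] modulo varpi *)

Section HomK.
Variables (p : nat) (Qp : padicField p) (E : fieldExtType Qp).
Local Notation abs := (@padic_abs p Qp).
Local Notation O := (integers E).
Local Notation M2 := 'M[Qp]_2.
Local Notation OK := (iwasawa E).
Local Notation K := (@GL2Zp p Qp).
Local Notation p_pr := (padic_prime Qp).
Variables (F : fieldType) (red : {rmorphism O -> F}) (varpi : O).
Hypotheses (res : is_residue_field red varpi) (Fp0 : p%:R = 0 :> F) (p_gt2 : (2 < p)%N).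
Variable iota : {rmorphism 'F_p -> F}.
Hypothesis iotaE : forall a, iota a = (a : nat)%:R.
Variable H : lmodType OK^c.
Local Notation "x ** mu" := (Defs.ract x mu) (at level 40, left associativity).
Variable stq : H -> {poly F}.
Hypotheses (stqD : forall x y, stq (x + y) = stq x + stq y)
  (stqZ : forall x c, stq (x ** iw_scalar c) = red c *: stq x)
  (size_stq : forall x, (size (stq x) <= p)%N)
  (stq_dirac : forall x g, K g -> stq (x ** dirac E g) = slashFp iota p.-1 (rzmx g) (stq x))
  (stq_eq0 : forall x, stq x = 0 <-> inHJ red x).
Variables m s : nat.
Local Notation sl := (slashFp iota).
Local Notation chi := (chi_ur E s).
Local Notation homK := (@hom_pol p Qp E K m chi H).
Local Notation redP := (map_poly red).

Let chi_cont := @chi_ur_cont p Qp E s.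

Lemma supportedK (mu : OK) : supported K mu.
Proof. by move=> f cf f0; rewrite -(mu0 mu); apply: mu_eq. Qed.

Let stq0 : stq 0 = 0.
Proof. by apply: (addrI (stq 0)); rewrite -stqD !addr0. Qed.

Let stqN x : stq (- x) = - stq x.
Proof. by apply/eqP; rewrite -addr_eq0 -stqD addNr stq0. Qed.

Let stq_sum (I : Type) (r : seq I) (P : pred I) (x : I -> H) :
  stq (\sum_(i <- r | P i) x i) = \sum_(i <- r | P i) stq (x i).
Proof. exact: (big_morph stq stqD stq0). Qed.

Section Hom.
Variables (S : M2 -> Prop) (psi : M2 -> O).
Hypothesis psi_cont : ucont (@congM p Qp) K psi.
Local Notation hom := (@hom_pol p Qp E S m psi H).

Lemma hom0 phi : hom phi -> phi 0 = 0.
Proof. by move=> [_ hD _]; apply: (addrI (phi 0)); rewrite -hD !addr0. Qed.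

Lemma homN phi x : hom phi -> phi (- x) = - phi x.
Proof. by move=> hp; have [_ hD _] := hp; apply/eqP; rewrite -addr_eq0 -hD addNr hom0. Qed.

Lemma hom_sum phi (I : Type) (r : seq I) (P : pred I) (x : I -> H) : hom phi ->
  phi (\sum_(i <- r | P i) x i) = \sum_(i <- r | P i) phi (x i).
Proof. by move=> hp; have [_ hD _] := hp; apply: (big_morph phi hD (hom0 hp)). Qed.

Lemma hom_lincomb n (phi : 'I_n -> H -> {poly O}) (c : 'I_n -> O) :
  (forall i, hom (phi i)) -> hom (fun x => \sum_i c i *: phi i x).
Proof.
move=> hp; split=> [x|x y|x mu Smu].
- apply: (leq_trans (size_sum _ _ _)); apply/bigmax_leqP => i _.
  by rewrite (leq_trans (size_scale_leq _ _)) //; case: (hp i).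
- by rewrite -big_split; apply: eq_bigr => i _; case: (hp i) => _ -> _; rewrite scalerDr.
rewrite (big_morph (fun h => pol_act m psi h mu) (fun a b => pol_actD m psi_cont a b mu)
  (pol_act0 m psi_cont mu)).
by apply: eq_bigr => i _; rewrite pol_actZ //; case: (hp i) => _ _ ->.
Qed.

Lemma homZ phi x c : hom phi -> S 1%:M -> psi 1%:M = 1 ->
  phi (x ** iw_scalar c) = c *: phi x.
Proof.
by move=> [h1 _ h3] S1 psi1; rewrite h3 ?pol_act_scalar //; apply: supported_scalar.
Qed.

(** Quotients by [varpi] in O[z] are unique, so the pointwise quotient of phi is again a
    homomorphism. *)
Lemma hom_saturated phi : hom phi -> (forall x, redP (phi x) = 0) ->
  exists2 phi', hom phi' & forall x, phi x = varpi *: phi' x.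
Proof.
move=> [h1 h2 h3] h0.
have v0 := varpi_neq0 res Fp0.
have /choice[phi' hphi'] : forall x, exists h : {poly O},
    (size h <= m.+1)%N /\ phi x = varpi *: h.
  move=> x; have /choice[f hf] : forall i, exists c, (phi x)`_i = varpi * c.
    by move=> i; apply/(red_eq0 res); rewrite -coef_map h0 coef0.
  exists (\poly_(i < m.+1) f i); split; first exact: size_poly.
  apply/polyP => i; rewrite coefZ coef_poly; case: ltnP => // mi.
  by rewrite mulr0 nth_default // (leq_trans (h1 x)).
have vI (a b : {poly O}) : varpi *: a = varpi *: b -> a = b.
  move=> ab; apply/polyP => i; apply: (O_mulI v0).
  by have := congr1 (fun h : {poly O} => h`_i) ab; rewrite !coefZ.
exists phi'; last by move=> x; case: (hphi' x).
split=> [x|x y|x mu Smu]; first by case: (hphi' x).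
- by apply: vI; rewrite scalerDr -(hphi' x).2 -(hphi' y).2 -(hphi' _).2.
- by apply: vI; rewrite -(hphi' _).2 -pol_actZ // -(hphi' _).2 h3.
Qed.

End Hom.

Lemma chi_red_congr (g g' : M2) : K g -> K g' -> rzmx g = rzmx g' -> red (chi g) = red (chi g').
Proof. by move=> Kg Kg' gg'; rewrite (chi_ur_congr E s Kg Kg' gg'). Qed.

Lemma red_homK phi x mu : homK phi -> redP (phi (x ** mu)) =
  \sum_b (red (mu (Kind E b)) * red (chi (Klift Qp b))) *: sl m b (redP (phi x)).
Proof.
move=> [_ _ h3]; rewrite h3; last exact: supportedK.
by apply: red_pol_act => //; [exact: res | exact: chi_red_congr].
Qed.

Lemma red_homK_inHJ phi x : homK phi -> inHJ red x -> redP (phi x) = 0.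
Proof.
move=> hp [t [Jt ->]]; rewrite (hom_sum _ _ _ hp) rmorph_sum /= big_seq big1 // => u /Jt Ju.
by rewrite red_homK // big1 // => b _; rewrite Ju mul0r scale0r.
Qed.

Lemma red_homK_dirac phi x g : homK phi -> K g ->
  redP (phi (x ** dirac E g)) = red (chi g) *: sl m (rzmx g) (redP (phi x)).
Proof.
move=> [_ _ h3] Kg; rewrite h3; last exact: supportedK.
by rewrite pol_act_dirac // map_polyZ map_slash (map_red_toO red Fp0 iotaE).
Qed.

Lemma red_homK_eq phi x y : homK phi -> stq x = stq y -> redP (phi x) = redP (phi y).
Proof.
move=> hp xy; have [_ hD _] := hp; apply/eqP; rewrite -subr_eq0 -rmorphB /=.
rewrite -(homN _ hp) -hD; apply/eqP; apply: red_homK_inHJ => //.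
by apply/stq_eq0; rewrite stqD stqN xy subrr.
Qed.

Lemma red_chi_lift (b : 'M['F_p]_2) : \det b != 0 ->
  red (chi (Klift Qp b)) * iota (\det b) ^+ s = 1.
Proof.
by move=> b0; have := red_chi_ur red Fp0 iotaE s (Klift_K Qp b0); rewrite rz_Klift.
Qed.

(** The element x1 lifts the constant 1. The Borel invariance of 1 and the relation [st_trace1] hold
    for x1 modulo HJ, which phi sends to 0 modulo [varpi]. *)
Lemma homK_st_vec phi x1 : homK phi -> stq x1 = 1 -> st_vec iota m s (redP (phi x1)).
Proof.
move=> hp x1E; have [hs hD _] := hp; split.
- rewrite (leq_trans _ (hs x1)) //; exact: size_poly.
- move=> g g0 dg; have Kg := Klift_K Qp dg.
  have E0 : redP (phi (x1 ** dirac E (Klift Qp g))) = redP (phi x1).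
    by apply: red_homK_eq => //; rewrite stq_dirac // rz_Klift x1E (sl_p_1_upper iota p_pr p_gt2).
  rewrite -{2}E0 red_homK_dirac // rz_Klift scalerA mulrC red_chi_lift //.
  by rewrite scale1r.
transitivity (redP (phi (x1 + \sum_d x1 ** dirac E (Klift Qp (W d))))).
  rewrite hD rmorphD /= (hom_sum _ _ _ hp) rmorph_sum /=; congr (_ + _).
  apply: eq_bigr => d _; have dW : \det (W d) != 0 by rewrite det_W oner_neq0.
  rewrite red_homK_dirac ?rz_Klift //; last exact: Klift_K.
  by have := red_chi_lift dW; rewrite det_W rmorph1 expr1n mulr1 => ->; rewrite scale1r.
apply: red_homK_inHJ => //; apply/stq_eq0; rewrite stqD stq_sum x1E.
rewrite -[RHS](st_trace1 iota p_pr p_gt2); congr (_ + _); apply: eq_bigr => d _.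
by rewrite stq_dirac ?rz_Klift ?x1E //; apply: Klift_K; rewrite det_W oner_neq0.
Qed.

(** Modulo HJ every x is a combination of translates of x1, by the interpolation formula
    [stform_id]. *)
Lemma homK_inj phi x1 : homK phi -> stq x1 = 1 -> redP (phi x1) = 0 ->
  forall x, redP (phi x) = 0.
Proof.
move=> hp x1E p0 x; have [_ hD _] := hp.
have dW d : \det (W d : 'M['F_p]_2) != 0 by rewrite det_W oner_neq0.
have [c0 Ec0] := res.1 (stq x)`_p.-1.
have /choice[c Ec] : forall d, exists c, red c = (stq x).[iota (- d)] by move=> d; apply: res.1.
pose y := - (x1 ** iw_scalar c0 + \sum_d x1 ** dirac E (Klift Qp (W d)) ** iw_scalar (c d)).
have -> : redP (phi x) = redP (phi y).
  apply: red_homK_eq => //; rewrite -[LHS](stform_id iota p_pr p_gt2) // /stform.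
  rewrite /y stqN stqD stqZ Ec0 x1E stq_sum; congr (- (_ + _)); apply: eq_bigr => d _.
  by rewrite stqZ Ec stq_dirac ?rz_Klift ?x1E //; apply: Klift_K.
have Z z c' : redP (phi (z ** iw_scalar c')) = red c' *: redP (phi z).
  rewrite (homZ chi_cont _ _ hp); [|exact: GL2Zp1|exact: chi_ur1].
  exact: map_polyZ.
rewrite /y (homN _ hp) hD (hom_sum _ _ _ hp) rmorphN rmorphD rmorph_sum /= Z p0 scaler0 add0r.
rewrite big1 ?oppr0 // => d _; rewrite Z red_homK_dirac; [|by []|exact: Klift_K].
by rewrite p0 /slashFp slash0 !scaler0.
Qed.

(** As stq kills HJ, mu may be replaced by the combination [iw_finite mu] of group elements, where
    [stform_sl] applies. *)
Lemma stform_iw a x mu : st_vec iota m s a -> stform iota m a (stq (x ** mu)) =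
  \sum_b (red (mu (Kind E b)) * red (chi (Klift Qp b))) *: sl m b (stform iota m a (stq x)).
Proof.
move=> Aa; have -> : stq (x ** mu) = stq (x ** iw_finite mu).
  apply/eqP; rewrite -subr_eq0 -stqN -stqD -ractNr -ractDr; apply/eqP/stq_eq0.
  by apply: inHJ_1; apply: augJ_decomp.
rewrite /iw_finite ract_sumr stq_sum.
rewrite (big_morph _ (stformD iota m a) (stform0 iota m a)); apply: eq_bigr => b _.
rewrite ractM stqZ stformZ -scalerA.
have [b0|b0] := eqVneq (\det b) 0; first by rewrite Kind_out // rmorph0 !scale0r.
congr (_ *: _); rewrite stq_dirac ?rz_Klift; last exact: Klift_K.
rewrite -(stform_sl p_pr p_gt2 Aa b0) // scalerA red_chi_lift // scale1r.
by [].
Qed.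

Lemma lift_poly (h : {poly F}) : (size h <= m.+1)%N ->
  exists2 P : {poly O}, (size P <= m.+1)%N & redP P = h.
Proof.
move=> sh; have /choice[f hf] : forall i, exists c, red c = h`_i by move=> i; apply: res.1.
exists (\poly_(i < m.+1) f i); first exact: size_poly.
apply/polyP => i; rewrite coef_map coef_poly; case: ltnP => /= mi; first exact: hf.
by rewrite rmorph0 nth_default // (leq_trans sh).
Qed.

(* H is a direct summand of a free module, so it suffices to lift the images of generators. *)
Lemma homK_lift a : finite_projective H -> st_vec iota m s a ->
  exists2 phi, homK phi & forall x, redP (phi x) = stform iota m a (stq x).
Proof.
move=> [n [i [r ir]]] Aa; have [sa _ _] := Aa.
have /choice[P hP] : forall j : 'I_n, exists h : {poly O},
    (size h <= m.+1)%N /\ redP h = stform iota m a (stq (r (delta_mx 0 j))).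
  move=> j; have [|h sh hE] := @lift_poly (stform iota m a (stq (r (delta_mx 0 j)))).
    exact: size_stform.
  by exists h.
exists (fun x => \sum_j pol_act m chi (P j) ((i x) 0 j)).
  split=> [x|x y|x mu _].
  - apply: (leq_trans (size_sum _ _ _)); apply/bigmax_leqP => j _; exact: size_pol_act.
  - rewrite -big_split; apply: eq_bigr => j _.
    by rewrite linearD mxE /= -pol_act_iwD.
  rewrite (big_morph (fun h => pol_act m chi h mu) (fun a b => pol_actD m chi_cont a b mu)
    (pol_act0 m chi_cont mu)).
  apply: eq_bigr => j _; rewrite -(@pol_act_conv p Qp E m chi chi_cont K) ?(hP j).1 //.
  + by congr (pol_act _ _ _ _); rewrite linearZ mxE.
  + exact: chi_urM.
  + exact: supportedK.
  + exact: supportedK.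
move=> x; rewrite rmorph_sum /=.
have -> : stq x = \sum_j stq (r (delta_mx 0 j) ** (i x) 0 j).
  rewrite -stq_sum -{1}(ir x) {1}(row_sum_delta (i x)) linear_sum; congr (stq _).
  by apply: eq_bigr => j _; rewrite linearZ.
rewrite (big_morph _ (stformD iota m a) (stform0 iota m a)); apply: eq_bigr => j _.
rewrite stform_iw // (@red_pol_act p Qp E m chi chi_cont F red varpi res Fp0 iota iotaE chi_red_congr).
by apply: eq_bigr => b _; rewrite (hP j).2.
Qed.

End HomK.

(** Cramer's rule in a form without division: v times the new row is a combination of the old rows,
    of which only row i0 contributes to the determinant. *)
Lemma det_row_replace (R : comNzRingType) n (M M' : 'M[R]_n) i0 (v : R) (c : 'I_n -> R) :
  (forall i j, i != i0 -> M' i j = M i j) ->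
  (forall j, v * M' i0 j = \sum_k c k * M k j) -> v * \det M' = c i0 * \det M.
Proof.
move=> hM hr; rewrite (expand_det_row M' i0) mulr_sumr.
have cof j : cofactor M' i0 j = \adj M j i0.
  rewrite mxE /cofactor; congr (_ * \det _); apply/matrixP => i k; rewrite !mxE.
  by rewrite hM // eq_sym neq_lift.
under eq_bigr => j _ do rewrite mulrA hr cof mulr_suml.
rewrite exchange_big /=.
under eq_bigr => k _ do under eq_bigr => j _ do rewrite -mulrA.
under eq_bigr => k _ do rewrite -mulr_sumr.
have adjE k : \sum_j M k j * \adj M j i0 = (k == i0)%:R * \det M.
  by have := congr1 (fun A : 'M_n => A k i0) (mul_mx_adj M); rewrite !mxE => ->; rewrite mulr_natl.
rewrite (bigD1 i0) //= adjE eqxx mul1r big1 ?addr0 // => k /negPf ki.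
by rewrite adjE ki mul0r mulr0.
Qed.

(** * Ranks over O *)

Section Rank.
Variables (p : nat) (Qp : padicField p) (E : fieldExtType Qp).
Local Notation O := (integers E).
Variable X : Type.
Variable S : (X -> {poly O}) -> Prop.

Lemma lin_indep_le n n' : (n' <= n)%N -> lin_indep S n -> lin_indep S n'.
Proof.
move=> nn [b [Sb ib]]; exists (fun i => b (widen_ord nn i)); split=> // c hc i.
pose d (j : 'I_n) := if insub (val j) is Some k then c k else 0 : O.
have dE k : d (widen_ord nn k) = c k.
  by rewrite /d insubT //= => lt; congr c; apply: val_inj.
rewrite -dE; apply: ib => x; rewrite -[RHS](hc x).
rewrite (bigID (fun j : 'I_n => (j < n')%N)) /= [X in _ + X]big1 ?addr0; last first.
  by move=> j /negPf nj; rewrite /d insubF // scale0r.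
rewrite (big_ord_narrow nn); apply: eq_bigr => k _; rewrite dE.
by [].
Qed.

Lemma rankO_eq n : lin_indep S n -> ~ lin_indep S n.+1 -> rankO S = n.
Proof.
move=> hn hn1; rewrite /rankO; case: xgetP => [m _ [] hm hm1|/(_ n) []//].
have [mn|nm|//] := ltngtP m n; first by case: hm1; apply: lin_indep_le hn.
by case: hn1; apply: lin_indep_le hm.
Qed.

Lemma common_denominator (I : finType) (f : I -> E) :
  exists k, exists g : I -> O, forall i, p%:R ^+ k * f i = val (g i).
Proof.
have /choice[k hk] i := E_denominator (f i).
have /choice[x hx] := hk.
exists (\sum_i k i)%N, (fun i => p%:R ^+ (\sum_(j | j != i) k j) * x i) => i.
rewrite (bigD1 i) // exprD mulrC mulrA [f i * _]mulrC hx.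
by rewrite rmorphM rmorphXn rmorph_nat mulrC.
Qed.

Lemma p_E_neq0 k : p%:R ^+ k != 0 :> E.
Proof.
rewrite expf_neq0 //; have -> : (p%:R : E) = in_alg E p%:R by rewrite rmorph_nat.
by rewrite fmorph_eq0 padic_natr_neq0.
Qed.

(** A relation exists over the field E; a common denominator, a power of p, brings it into O. *)
Lemma O_dependent n (D : 'M[O]_(n.+1, n)) : exists c : 'I_n.+1 -> O,
  (exists i, c i != 0) /\ forall j, \sum_i c i * D i j = 0.
Proof.
pose DE : 'M[E]_(n.+1, n) := map_mx val D.
have : kermx DE != 0.
  rewrite -mxrank_eq0 mxrank_ker subn_eq0 -ltnNge.
  by rewrite ltnS rank_leq_col.
case/rowV0Pn => v /sub_kermxP vD v0.
have [k [g hg]] := common_denominator (fun i => v 0 i).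
exists g; split.
  apply: contrapT => h; case/eqP: v0; apply/rowP => i; rewrite mxE.
  apply: (mulfI (p_E_neq0 k)); rewrite mulr0 hg.
  have -> : g i = 0 by apply/eqP; apply: contrapT => /negP gi; apply: h; exists i.
  by rewrite rmorph0.
move=> j; apply: val_inj; rewrite rmorph_sum rmorph0.
have := congr1 (fun A : 'rV_n => A 0 j) vD; rewrite !mxE => vDj.
transitivity (p%:R ^+ k * \sum_i v 0 i * DE i j); last by rewrite vDj mulr0.
rewrite mulr_sumr; apply: eq_bigr => i _.
transitivity (val (g i) * val (D i j)); first exact: rmorphM.
by rewrite -hg mxE mulrA.
Qed.

Section Upper.
Variables (F : fieldType) (red : {rmorphism O -> F}) (varpi : O).
Hypotheses (res : is_residue_field red varpi) (Fp0 : p%:R = 0 :> F).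
Local Notation redP := (map_poly red).

(* A relation over O that is trivial mod varpi can be divided by varpi indefinitely. *)
Lemma lin_indep_reduction n (b : 'I_n -> X -> {poly O}) x1 :
  (forall i, S (b i)) ->
  (forall c : 'I_n -> F, \sum_i c i *: redP (b i x1) = 0 -> forall i, c i = 0) ->
  lin_indep S n.
Proof.
move=> Sb ib; exists b; split=> // c hc.
have dvd N : exists c', (forall i, c i = varpi ^+ N * c' i) /\
    forall x, \sum_i c' i *: b i x = 0.
  elim: N => [|N [c' [cc' hc']]].
    by exists c; split=> // i; rewrite expr0 mul1r.
  have /choice[d hd] : forall i, exists d, c' i = varpi * d.
    move=> i; apply/(red_eq0 res); apply: (ib (fun i => red (c' i))) i.
    rewrite -[RHS](rmorph0 redP) -(hc' x1) rmorph_sum /=.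
    by apply: eq_bigr => i _; rewrite map_polyZ.
  exists d; split=> [i|x]; first by rewrite cc' hd exprSr mulrA.
  apply/polyP => k; apply: (O_mulI (varpi_neq0 res Fp0)).
  have := congr1 (fun h : {poly O} => h`_k) (hc' x).
  rewrite !coef0 mulr0 !coef_sum mulr_sumr => h; rewrite -[RHS]h.
  by apply: eq_bigr => i _; rewrite !coefZ hd mulrA.
move=> i; apply/eqP; apply: contrapT => /negP ci.
have [N hN] := O_separated res Fp0 ci; apply: hN.
by have [c' [cc' _]] := dvd N; exists (c' i).
Qed.

Lemma F_dependent n (A : {poly F} -> Prop) (a : 'I_n.+1 -> {poly F}) :
  has_basis A n -> (forall i, A (a i)) ->
  exists c : 'I_n.+1 -> F, (exists i, c i != 0) /\ \sum_i c i *: a i = 0.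
Proof.
move=> [w [_ _ gw]] Aa; have /choice[d hd] : forall i, exists d : 'I_n -> F,
    a i = \sum_j d j *: w j by move=> i; apply: gw.
pose D : 'M[F]_(n.+1, n) := \matrix_(i, j) d i j.
have : kermx D != 0.
  by rewrite -mxrank_eq0 mxrank_ker subn_eq0 -ltnNge ltnS rank_leq_col.
case/rowV0Pn => v /sub_kermxP vD v0; exists (fun i => v 0 i); split.
  apply: contrapT => h; case/eqP: v0; apply/rowP => i; rewrite mxE.
  by apply/eqP; apply: contrapT => /negP vi; apply: h; exists i.
under eq_bigr => i _ do rewrite hd scaler_sumr.
rewrite exchange_big big1 //= => j _.
under eq_bigr => i _ do rewrite scalerA.
rewrite -scaler_suml; have := congr1 (fun M : 'rV_n => M 0 j) vD; rewrite !mxE.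
by under eq_bigr => i _ do rewrite mxE; move=> ->; rewrite scale0r.
Qed.

(* Dividing by varpi a combination that vanishes mod varpi, and replacing a member of the
   family by it, lowers the valuation of a nonzero maximal minor of the evaluations at x0. *)
Lemma not_lin_indep n m x0 x1 (A : {poly F} -> Prop) :
  (forall phi, S phi -> (size (phi x0) <= m.+1)%N) ->
  (forall phi, S phi -> phi x0 = 0 -> forall x, phi x = 0) ->
  (forall k (phi : 'I_k -> X -> {poly O}) (c : 'I_k -> O), (forall i, S (phi i)) ->
     S (fun x => \sum_i c i *: phi i x)) ->
  (forall phi, S phi -> redP (phi x1) = 0 ->
     exists2 phi', S phi' & forall x, phi x = varpi *: phi' x) ->
  (forall phi, S phi -> A (redP (phi x1))) -> has_basis A n ->
  ~ lin_indep S n.+1.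
Proof.
move=> sz ev0 lin sat SA hA [b [Sb ib]].
pose B (b : 'I_n.+1 -> X -> {poly O}) : 'M[O]_(n.+1, m.+1) := \matrix_(i, j) (b i x0)`_j.
have freeB : row_free (map_mx val (B b) : 'M[E]_(n.+1, m.+1)).
  rewrite -kermx_eq0; apply/rowV0P => v /sub_kermxP vB.
  have [k [g hg]] := common_denominator (fun i => v 0 i).
  have g0 : forall i, g i = 0.
    apply: ib => x; apply: (ev0 (fun x => \sum_i g i *: b i x)); first exact: lin.
    apply/polyP => j; rewrite coef0.
    have [mj|jm] := leqP m.+1 j.
      by rewrite nth_default // (leq_trans (sz _ (lin _ _ _ Sb))).
    rewrite coef_sum; apply: val_inj; rewrite rmorph_sum rmorph0.
    have := congr1 (fun M : 'rV_m.+1 => M 0 (Ordinal jm)) vB; rewrite mxE [RHS]mxE => vBj.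
    transitivity (p%:R ^+ k * \sum_i v 0 i * (map_mx val (B b) : 'M[E]_(n.+1, m.+1)) i (Ordinal jm)).
      2: by rewrite vBj mulr0.
    rewrite mulr_sumr; apply: eq_bigr => i _.
    transitivity (val (g i) * val (b i x0)`_j); first by rewrite coefZ; exact: rmorphM.
    by rewrite -hg !mxE mulrA.
  apply/rowP => i; rewrite mxE; apply: (mulfI (p_E_neq0 k)).
  by rewrite mulr0 hg g0 rmorph0.
(* A right inverse over E, cleared of denominators, stands in for the choice of a minor: the
   determinant of B times [CO] is a power of p, hence nonzero. *)
have [C BC] := row_freeP freeB.
have [k [g hg]] := common_denominator (fun u : 'I_m.+1 * 'I_n.+1 => C u.1 u.2).
pose CO : 'M[O]_(m.+1, n.+1) := \matrix_(i, j) g (i, j).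
have det0 : \det (B b *m CO) != 0.
  apply/eqP => /(congr1 val); rewrite rmorph0 -[val _]/(val (\det _)) -det_map_mx map_mxM.
  have -> : map_mx val CO = p%:R ^+ k *: C :> 'M[E]_(m.+1, n.+1).
    by apply/matrixP => i j; rewrite !mxE -hg.
  rewrite -scalemxAr BC detZ det1 mulr1 => /eqP.
  by rewrite -exprM (negPf (p_E_neq0 _)).
have [N hN] := O_separated res Fp0 det0.
have key : forall N0 b0, (forall i, S (b0 i)) ->
    ~ (exists c, \det (B b0 *m CO) = varpi ^+ N0 * c) -> False.
  elim=> [|N0 IH] b0 Sb0 hN0.
    by apply: hN0; exists (\det (B b0 *m CO)); rewrite expr0 mul1r.
  have [c [[i0 ci0] c0]] := F_dependent hA (fun i => SA _ (Sb0 i)).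
  have /choice[d hd] : forall i, exists d, red d = c i by move=> i; apply: res.1.
  have [] := sat _ (lin _ b0 d Sb0).
    rewrite rmorph_sum -[RHS]c0; apply: eq_bigr => i _.
    by rewrite -hd; apply: map_polyZ.
  move=> phi Sphi phiE.
  (* Since varpi phi is the combination of the b0 with coefficients d, [varpi] times the new
     determinant is d i0 times the old one, and d i0 is nonzero in F: one factor [varpi] has been
     removed. *)
  pose b' i := if i == i0 then phi else b0 i.
  have Sb' i : S (b' i) by rewrite /b'; case: eqP.
  apply: (IH b' Sb') => -[z Ez]; apply: hN0.
  apply: (@red_prime _ _ _ _ red _ res Fp0 (d i0)); first by rewrite hd.
  exists z; rewrite exprS -mulrA -Ez; apply/esym.
  apply: det_row_replace => [i j ii0|j].
    by rewrite !mxE; apply: eq_bigr => l _; rewrite !mxE /b' (negPf ii0).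
  rewrite mxE mulr_sumr; under [RHS]eq_bigr => l _ do rewrite mxE mulr_sumr.
  rewrite exchange_big; apply: eq_bigr => l _ /=.
  rewrite mxE /b' eqxx mulrA; have := congr1 (fun h : {poly O} => h`_l) (phiE x0).
  rewrite coefZ => <-; rewrite coef_sum mulr_suml; apply: eq_bigr => i _.
  by rewrite coefZ [B b0 i l]mxE mulrA.
exact: (key N b Sb hN).
Qed.

End Upper.
End Rank.

(** * Homomorphisms over O[[Iw]] *)

Section HomIw.
Variables (p : nat) (Qp : padicField p) (E : fieldExtType Qp).
Local Notation abs := (@padic_abs p Qp).
Local Notation O := (integers E).
Local Notation toO := (toO E).
Local Notation M2 := 'M[Qp]_2.
Local Notation OK := (iwasawa E).
Local Notation K := (@GL2Zp p Qp).
Local Notation Iw := (@Iw p Qp).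
Local Notation I1 := (@I1 p Qp).
Local Notation p_pr := (padic_prime Qp).
Hypothesis p_gt2 : (2 < p)%N.
Variable H : lmodType OK^c.
Local Notation "x ** mu" := (Defs.ract x mu) (at level 40, left associativity).
Variables (act : H -> M2 -> H) (e : H).
Hypotheses (nrm : normalized act e)
  (act_K : forall x g, K g -> act x g = x ** dirac E g).
Variables s k : nat.
Hypothesis k_ge2 : (2 <= k)%N.
Local Notation m := (k - 2)%N.
Local Notation chi := (chi_Iw E s k).
Local Notation homIw := (@hom_pol p Qp E Iw m chi H).

Let chi_cont := @chi_Iw_cont p Qp E s k.

Definition torus (z w : Qp) : M2 := mx2 z 0 0 w.

Lemma det_torus z w : \det (torus z w) = z * w.
Proof. by rewrite det_mx2 !mxE /= mulr0 subr0. Qed.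

Let p1_gt0 : (0 < p.-1)%N. Proof. by lia. Qed.

Lemma torus_Iw z w : abs z = 1 -> abs w = 1 -> Iw (torus z w).
Proof.
move=> z1 w1; split; last by rewrite mxE /= padic_abs0 ltr01.
split; last by rewrite det_torus padic_absM z1 w1 mulr1.
by move=> i j; rewrite mxE; case: (i == 0); case: (j == 0);
  rewrite ?z1 ?w1 ?padic_abs0 ?ler01.
Qed.

Lemma torus_Delta2 z w : z ^+ p.-1 = 1 -> w ^+ p.-1 = 1 -> Delta2 (torus z w).
Proof.
move=> z1 w1; split.
- by case: (torus_Iw (root1_abs1 p1_gt0 z1) (root1_abs1 p1_gt0 w1)).
- apply/is_diag_mxP => i j; rewrite mxE.
  by case: i => [[|[|]]] //; case: j => [[|[|]]].
exists p.-1 => //.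
have tX n : torus z w ^+ n = torus (z ^+ n) (w ^+ n).
  elim: n => [|n IH].
    rewrite !expr0; apply/matrixP => i j; rewrite !mxE.
    by case: i => [[|[|]]] //; case: j => [[|[|]]].
  by rewrite !exprS IH -[LHS]/(_ *m _) mul_mx2 !(mulr0, mul0r, addr0, add0r).
rewrite tX z1 w1; apply/matrixP => i j; rewrite !mxE.
by case: i => [[|[|]]] //; case: j => [[|[|]]].
Qed.

Lemma e_torus z w : z ^+ p.-1 = 1 -> w ^+ p.-1 = 1 -> e ** dirac E (torus z w) = e.
Proof.
move=> z1 w1; have Dt := torus_Delta2 z1 w1; rewrite -act_K; last by case: Dt.
exact: (norm_Delta2 nrm).
Qed.

Lemma chi_torus z w (P : {poly O}) i : z ^+ p.-1 = 1 -> w ^+ p.-1 = 1 -> (i <= m)%N ->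
  (chi (torus z w) *: slash m (map_mx toO (torus z w)) P)`_i =
  P`_i * omega_pow E (i%:Z - s%:Z) z * omega_pow E (s%:Z - i%:Z) w.
Proof.
move=> z1 w1 im; have az := root1_abs1 p1_gt0 z1; have aw := root1_abs1 p1_gt0 w1.
have w0 : w != 0 by rewrite -padic_abs_eq0 aw oner_eq0.
have chiE : chi (torus z w) = omega_pow E (- s%:Z) z * omega_pow E (s%:Z + (2 - k%:Z)) w.
  rewrite chi_IwE; last exact: torus_Iw.
  by rewrite det_torus /torus mxE /= mulfK.
rewrite coefZ chiE /torus map_mx2 toO0 slash_diag //.
have zE : toO z ^+ i = omega_pow E i z by rewrite omega_pow_nat // teich_root.
have wE : toO w ^+ (m - i) = omega_pow E (m - i)%N w by rewrite omega_pow_nat // teich_root.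
rewrite zE wE; have -> : (i%:Z - s%:Z) = (- s%:Z) + i%:Z by lia.
have -> : s%:Z - i%:Z = s%:Z + (2 - k%:Z) + (m - i)%N by lia.
rewrite [omega_pow E (- s%:Z + i%:Z) z]omega_pow_D //.
by rewrite [omega_pow E (s%:Z + (2 - k%:Z) + (m - i)%N) w]omega_pow_D //; ring.
Qed.

Lemma chi_torus_fix z w j : z ^+ p.-1 = 1 -> w ^+ p.-1 = 1 -> (s + p.-1 * j <= m)%N ->
  chi (torus z w) *: slash m (map_mx toO (torus z w)) 'X^(s + p.-1 * j) = 'X^(s + p.-1 * j).
Proof.
move=> z1 w1 jm; apply/polyP => i; have [im|mi] := leqP i m; last first.
  rewrite coefZ coefXn gtn_eqF ?(leq_ltn_trans jm) // nth_default ?mulr0 //.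
  by rewrite (leq_trans (size_slash _ _ _)).
rewrite chi_torus // coefXn; case: eqP => [->|_]; last by rewrite !mul0r.
have om (x : Qp) : x ^+ p.-1 = 1 -> omega_pow E (p.-1 * j)%N x = 1.
  move=> x1; rewrite omega_pow_nat ?(root1_abs1 p1_gt0 x1) // teich_root // exprM.
  by rewrite -toOX ?(root1_abs1 p1_gt0 x1) // x1 toO1 expr1n.
have -> : (s + p.-1 * j)%N%:Z - s%:Z = (p.-1 * j)%N by lia.
have -> : s%:Z - (s + p.-1 * j)%N%:Z = - (p.-1 * j)%N%:Z by lia.
have omN : omega_pow E (- (p.-1 * j)%N%:Z) w = 1.
  by have := omega_powN E (p.-1 * j)%N (root1_abs1 p1_gt0 w1); rewrite om // mulr1.
by rewrite om // omN !mulr1.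
Qed.

Lemma exists_FpX_neq i : (i != s %[mod p.-1])%N -> exists2 x : 'F_p, x != 0 & x ^+ i != x ^+ s.
Proof.
(* As p - 2 = -1 modulo p - 1, the exponent i + (p - 2) s stands for i - s. *)
move=> is_; have hs : ~~ (p.-1 %| i + p.-2 * s)%N.
  apply: contraNN is_ => h; rewrite -(eqn_modDr (p.-2 * s)).
  have -> : (s + p.-2 * s = p.-1 * s)%N by rewrite -mulSn; congr (_ * _)%N; lia.
  by rewrite modnMr; exact: h.
have [x x0 xr] := exists_FpX_neq1 p_pr p_gt2 hs; exists x => //.
apply: contraNneq xr => xis; rewrite exprD xis -exprD.
have -> : (s + p.-2 * s = p.-1 * s)%N by rewrite -mulSn; congr (_ * _)%N; lia.
by rewrite FpX_dvd ?p_pr // dvdn_mulr.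
Qed.

(** For a Teichmuller root of unity z, diag(z, 1) fixes [e] and multiplies the coefficient of X^i by
    z^(i-s); some z has z^i different from z^s, and O is a domain. *)
Lemma homIw_coef phi i : homIw phi -> (i <= m)%N -> (i != s %[mod p.-1])%N -> (phi e)`_i = 0.
Proof.
move=> [_ _ h3] im is_; have [x x0 xs] := exists_FpX_neq is_.
have [z z1 zx] := @exists_teich p Qp x x0.
have w1 : (1 : Qp) ^+ p.-1 = 1 by rewrite expr1n.
have az := root1_abs1 p1_gt0 z1; have It := torus_Iw az (@padic_abs1 p Qp).
have := h3 e (dirac E (torus z 1)) (@supported_dirac p Qp E _ _ It).
rewrite e_torus // pol_act_dirac //; last exact: Iw_K.
move=> /(congr1 (fun h : {poly O} => h`_i)); rewrite chi_torus // omega_pow_1 mulr1 => h.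
have hz : omega_pow E (i%:Z - s%:Z) z * toO z ^+ s = toO z ^+ i.
  have E' n : toO z ^+ n = omega_pow E n z by rewrite omega_pow_nat // teich_root.
  by rewrite !E' -omega_pow_D // subrK.
have : (phi e)`_i * (toO z ^+ i - toO z ^+ s) = 0.
  by rewrite mulrBr -hz mulrA -h subrr.
move=> /O_mulf_eq0[//|/(congr1 val)]; rewrite rmorphB !rmorphXn rmorph0 /= val_toO ?az //.
move=> /eqP; rewrite -!in_algE -!rmorphXn -rmorphB fmorph_eq0 subr_eq0 => /eqP zz.
case/eqP: xs; rewrite -zx -!rzX ?az // zz.
by [].
Qed.

Lemma homIw_ext phi : homIw phi -> phi e = 0 -> forall x, phi x = 0.
Proof.
move=> [_ _ h3] p0 x; have [mu Smu ->] := e_basis nrm x.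
rewrite h3 ?p0 ?pol_act0 //; apply: supportedS Smu => g []; by [].
Qed.

Lemma I1_Iw g : I1 g -> Iw g. Proof. by case. Qed.

Let te (x : 'F_p) : Qp := teich (x : nat)%:R.

Lemma te_abs (x : 'F_p) : x != 0 -> abs (x : nat)%:R = 1.
Proof.
by move=> x0; apply/eqP; rewrite -rz_eq0_abs1 ?padic_abs_natle1 // rz_nat natr_Zp.
Qed.

Lemma te_root (x : 'F_p) : x != 0 -> te x ^+ p.-1 = 1.
Proof. by move=> /te_abs/teichP[]. Qed.

Lemma rz_te (x : 'F_p) : x != 0 -> rz (te x) = x.
Proof. by move=> x0; rewrite rz_teich ?te_abs // rz_nat natr_Zp. Qed.

(** The value at e mu, mu on I_1, must be P mu; the issue is linearity over all of O[[Iw]]. Now Iw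
    is a union of cosets T I_1 with T in Delta^2, and each T fixes both [e] and P. *)
Lemma homIw_exists j : (s + p.-1 * j <= m)%N ->
  exists2 phi, homIw phi & phi e = 'X^(s + p.-1 * j).
Proof.
move=> jm; set P : {poly O} := 'X^_.
have sP : (size P <= m.+1)%N by rewrite size_polyXn.
have I1S := supportedS (fun g => @I1_Iw g).
(* Pairs with a zero coordinate get 1 as a harmless value: diagonal entries of elements of Iw are
   units. *)
pose T (u : 'F_p * 'F_p) : M2 := if (u.1 != 0) && (u.2 != 0) then torus (te u.1) (te u.2) else 1%:M.
have T_or u : exists z w, [/\ z ^+ p.-1 = 1, w ^+ p.-1 = 1 & T u = torus z w].
  rewrite /T; case: ifP => [/andP[a0 d0]|_].
    by exists (te u.1), (te u.2); split; rewrite ?te_root.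
  exists 1, 1; split; rewrite ?expr1n //; apply/matrixP => i j'; rewrite !mxE.
  by case: i => [[|[|]]] //; case: j' => [[|[|]]].
have TIw u : Iw (T u).
  by have [z [w [z1 w1 ->]]] := T_or u; apply: torus_Iw; apply: root1_abs1 p1_gt0 _.
have TK u := Iw_K (TIw u).
have Te u : e ** dirac E (T u) = e.
  by have [z [w [z1 w1 ->]]] := T_or u; apply: e_torus.
have TP u : pol_act m chi P (dirac E (T u)) = P.
  rewrite pol_act_dirac //; have [z [w [z1 w1 ->]]] := T_or u; exact: chi_torus_fix.
pose U (u : 'F_p * 'F_p) (g : M2) : O :=
  [&& rzmx g 1 0 == 0, rzmx g 0 0 == u.1 & rzmx g 1 1 == u.2]%:R.
have Ucont u : ucont (@congM p Qp) K (U u).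
  by apply: (@contK_locconst _ _ _ 1%N) => g h Kg Kh /(rzmx_congK Kg Kh); rewrite /U => ->.
have rz10 g : Iw g -> rzmx g 1 0 = 0.
  by move=> [[g1 _] g10]; apply/eqP; rewrite mxE rz_eq0.
have U1 g : Iw g -> \sum_u U u g = 1.
  move=> Ig; rewrite (bigD1 (rzmx g 0 0, rzmx g 1 1)) //= /U rz10 // !eqxx big1 ?addr0 //=.
  move=> [a d]; rewrite xpair_eqE => h.
  by rewrite /= ![rzmx g _ _ == _]eq_sym (negPf h).
have U0 u g : Iw g -> ~ I1 (invmx (T u) *m g) -> U u g = 0.
  move=> Ig nI; rewrite /U; case: and3P => // -[_ /eqP g00 /eqP g11]; case: nI.
  have [a1 d1] := Iw_11 Ig; have [g1 _] := Ig.1.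
  have nz i j' : abs (g i j') = 1 -> rzmx g i j' != 0.
    by move=> h; rewrite mxE rz_eq0_abs1 ?h.
  have u10 : u.1 != 0 by rewrite -g00 nz.
  have u20 : u.2 != 0 by rewrite -g11 nz.
  have KT := TK u; have Kg := Iw_K Ig.
  apply: (@I1P _ _ _ (rzmx g 0 1 / u.1)); first exact/GL2ZpM/Kg/K_inv.
  have rT : rzmx (T u) = mx2 u.1 0 0 u.2.
    rewrite /T u10 u20 /=; apply/matrixP => i j'; rewrite !mxE.
    by case: (i == 0); case: (j' == 0); rewrite ?rz0 ?rz_te.
  have Tu : rzmx (T u) \in unitmx by rewrite unitmxE unitfE det_rzmx_neq0.
  apply: (can_inj (mulKmx Tu)); rewrite -rzmxM //; last exact/GL2ZpM/Kg/K_inv.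
  rewrite mulmxA mulmxV ?K_unit // mul1mx rT mul_mx2 [LHS]mx2_eta g00 g11 rz10 //.
  by congr (mx2 _ _ _ _); rewrite ?mulr1 ?mulr0 ?mul0r ?addr0 ?add0r // mulrC mulfVK.
have /choice[mu hmu] : forall x, exists nu : OK, supported I1 nu /\ x = e ** nu.
  by move=> x; have [nu] := e_basis nrm x; exists nu.
(* Removing the representatives [T u] turns a measure on Iw into one on I_1 with the same effect on
   [e] and on P; uniqueness of coordinates then identifies it with kap'. *)
have key kap kap' : supported Iw kap -> supported I1 kap' -> e ** kap = e ** kap' ->
    pol_act m chi P kap = pol_act m chi P kap'.
  move=> Sk Sk' kk'.
  pose nu u := conv (dirac E (invmx (T u))) (restr kap (Ucont u)).
  have [kE Sn] : kap = \sum_u conv (dirac E (T u)) (nu u) /\ forall u, supported I1 (nu u).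
    exact: (coset_decomp Ucont TK Sk U1 U0).
  have -> : kap' = \sum_u nu u.
    apply: (e_basis_uniq nrm) => //; first exact: supported_sum.
    rewrite -kk' [in LHS]kE !ract_sumr; apply: eq_bigr => u _.
    by rewrite ractM Te.
  rewrite kE !pol_act_iw_sum; apply: eq_bigr => u _.
  rewrite (@pol_act_conv p Qp E m chi chi_cont Iw) ?TP //.
  + exact: Iw_K.
  + exact: chi_IwM.
  + exact: supported_dirac.
  + exact/I1S.
exists (fun x => pol_act m chi P (mu x)); last first.
  rewrite (key (mu e) (dirac E 1%:M)).
  - by rewrite -(iw_scalar1 E) pol_act_scalar ?scale1r // chi_Iw1.
  - by apply: I1S; case: (hmu e).
  - exact/supported_dirac/I1_1.
  - by rewrite ract1 -(hmu e).2.
split=> [x|x y|x nu Snu]; first exact: size_pol_act.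
- rewrite -pol_act_iwD; congr (pol_act _ _ _ _).
  apply: (e_basis_uniq nrm); first by case: (hmu (x + y)).
    by move=> f cf f0; rewrite iwDE (hmu x).1 // (hmu y).1 // addr0.
  by rewrite ractDr -!(hmu _).2.
rewrite -(@pol_act_conv p Qp E m chi chi_cont Iw) //.
- apply/esym; apply: key.
  + apply: supported_conv => //; [exact: IwM | exact: Iw_K | by apply: I1S; case: (hmu x)].
  + by case: (hmu (x ** nu)).
  + by rewrite ractM -!(hmu _).2.
- exact: Iw_K.
- exact: chi_IwM.
- by apply: I1S; case: (hmu x).
Qed.

Lemma d_Iw_eq : (s < p.-1)%N -> d_Iw H s k = ((m + p.-1 - s) %/ p.-1)%N.
Proof.
(* The number of j with s + (p-1) j <= m; adding p - 1 before subtracting s keeps the count right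
   when m < s. *)
move=> sp; set n := (_ %/ _)%N.
have jn j : (j < n)%N = (s + p.-1 * j <= m)%N.
  rewrite /n leq_divRL // mulSn mulnC.
  by apply/idP/idP; lia.
apply: rankO_eq.
  have /choice[b hb] : forall j : 'I_n, exists phi, homIw phi /\ phi e = 'X^(s + p.-1 * j).
    by move=> j; have [|phi] := @homIw_exists j; [rewrite -jn | exists phi].
  exists b; split=> [i|c hc i]; first by case: (hb i).
  have := congr1 (fun h : {poly O} => h`_(s + p.-1 * i)) (hc e).
  rewrite coef0 coef_sum (bigD1 i) //= coefZ (hb i).2 coefXn eqxx mulr1 big1 ?addr0 //.
  move=> j; rewrite -val_eqE /= => ji; rewrite coefZ (hb j).2 coefXn eqn_add2l eqn_pmul2l //.
  by rewrite eq_sym (negPf ji) mulr0.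
move=> [b [Sb ib]].
have [c [[i0 ci0] c0]] := O_dependent (\matrix_(i < n.+1, j < n) (b i e)`_(s + p.-1 * j)).
case/eqP: ci0; apply: ib => x.
have hL := hom_lincomb chi_cont c Sb.
apply: (homIw_ext hL); apply/polyP => l; rewrite coef0.
have [lm|ml] := leqP l m; last first.
  by have [hs _ _] := hL; rewrite nth_default // (leq_trans (hs e)).
have [ls|ls] := eqVneq (l %% p.-1)%N (s %% p.-1)%N; last exact: (homIw_coef hL lm ls).
have sl : (s <= l)%N.
  rewrite leqNgt; apply/negP => ls'; move: ls; rewrite !modn_small //; first by lia.
  exact: ltn_trans sp.
have [j lE] : exists j, l = (s + p.-1 * j)%N.
  have : (p.-1 %| l - s)%N by rewrite -eqn_mod_dvd // ls.
  by move=> /dvdnP[j hj]; exists j; rewrite mulnC -hj subnKC.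
have jlt : (j < n)%N by rewrite jn -lE.
rewrite lE coef_sum -[RHS](c0 (Ordinal jlt)); apply: eq_bigr => i _.
by rewrite coefZ mxE.
Qed.

End HomIw.

(** * The rank of the O[[K]]-homomorphisms *)

Section Dimension.
Variables (p : nat) (Qp : padicField p) (E : fieldExtType Qp).
Local Notation O := (integers E).
Local Notation OK := (iwasawa E).
Variables (F : fieldType) (red : {rmorphism O -> F}) (varpi : O).
Variables (H : lmodType OK^c) (act : H -> 'M[Qp]_2 -> H) (e : H) (s : nat).
Hypotheses (p_gt2 : (2 < p)%N) (res : is_residue_field red varpi)
  (pam : primitive_augmented red varpi act) (nrm : normalized act e).

Lemma d_ur_eq k : (2 <= k)%N -> (s <= p - 2)%N -> (k - 2 = 2 * s %[mod p.-1])%N ->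
  d_ur H s k = ((k - 2 + (p ^ 2 - p) - p.+1 * s) %/ (p ^ 2 - 1))%N.
Proof.
move=> k2 sp ks; have p_pr := padic_prime Qp.
have [n [rP [pi [q [env q_lin q_eq q_surj q_ker]]]]] := pam_envelope pam.
have Fp0 := envelope_char p_pr p_gt2 env.
have [iota iotaE] := exists_Fp_morphism Fp0 p_pr.
pose st := @stq p Qp E F H n pi q.
have st0 x : st x = 0 <-> inHJ red x.
  exact: (stq_eq0 res p_gt2 iotaE nrm env q_lin q_eq q_surj q_ker).
have stD x y : st (x + y) = st x + st y by exact: (stqD pi q_lin).
have stZ x c : st (Defs.ract x (iw_scalar c)) = red c *: st x by exact: (stqZ pi q_lin).
have sst x : (size (st x) <= p)%N by exact: (size_stq q env).
have stS (h : {poly F}) : (size h <= p)%N -> exists x, st x = h.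
  exact: (stq_surj env q_surj).
have std x g : GL2Zp g -> st (Defs.ract x (dirac E g)) = slashFp iota p.-1 (rzmx g) (st x).
  exact: (stq_dirac iotaE env q_eq).
have cc := @chi_ur_cont p Qp E s.
have hA := st_vec_basis iota p_pr p_gt2 sp ks.
have [|x1 x1E] := stS 1; first by rewrite size_poly1 prime_gt0.
apply: rankO_eq.
  have [a [Aa ia _]] := hA.
  have /choice[b hb] : forall i, exists phi, @hom_pol p Qp E (@GL2Zp p Qp) (k - 2) (chi_ur E s) H phi /\
      map_poly red (phi x1) = a i.
    move=> i; have [phi hp phiE] :=
      homK_lift res Fp0 p_gt2 iotaE stD stZ sst std st0 (pam_projective pam) (Aa i).
    by exists phi; split=> //; rewrite phiE x1E (stform_1 p_pr p_gt2 (Aa i)).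
  apply: (lin_indep_reduction res Fp0 (b := b) (x1 := x1)) => [i|c hc]; first by case: (hb i).
  by apply: ia; rewrite -[RHS]hc; apply: eq_bigr => i _; rewrite (hb i).2.
(* Evaluation at [e], which generates H, detects the vanishing of a homomorphism over O; evaluation
   at x1, a lift of the constant 1, detects it modulo [varpi]. *)
apply: (not_lin_indep res Fp0 (x0 := e) (x1 := x1) (m := (k - 2)%N) (A := st_vec iota (k - 2) s)) => //.
- by move=> phi [].
- move=> phi [_ _ h3] p0 x; have [mu _ ->] := e_basis nrm x.
  by rewrite h3 ?p0 ?pol_act0 //; apply: supportedK.
- by move=> j phi c; apply: hom_lincomb.
- move=> phi hp p0; apply: (hom_saturated res Fp0 cc hp).
  exact: (homK_inj res Fp0 p_gt2 iotaE stD stZ sst std st0 hp x1E).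
- by move=> phi hp; apply: (homK_st_vec res Fp0 p_gt2 iotaE stD std st0 hp).
Qed.

End Dimension.

(** * The dimension formulas *)

Lemma delta_eps_le1 (p s : nat) : (2 < p)%N -> (s <= p - 2)%N -> (delta_eps p s <= 1)%N.
Proof. by move=> p2 sp; rewrite /delta_eps -ltnS ltn_divLR; lia. Qed.

(** Here q = p - 1, u = {2s}, d = delta and r = p - 1 - s - d. The numerator is a multiple of p - 1,
    so only the division by p + 1 remains. *)
Lemma count_weight_aux (q s d u r kb : nat) : (2 * s = d * q + u)%N -> q = (s + d + r)%N ->
  (2 + u + q * kb - 2 + q.+1 * q - q.+2 * s = (kb + 1 + r) * q)%N.
Proof.
move=> sd qE; have : (u + q * kb + q.+1 * q = (kb + 1 + r) * q + q.+2 * s)%N.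
  apply/eqP; rewrite -(eqn_add2r (d * q)); apply/eqP.
  transitivity ((d * q + u) + q * kb + q.+1 * q)%N; first by ring.
  by rewrite -sd {sd} qE; ring.
move: (q * kb)%N (q.+1 * q)%N (q.+2 * s)%N ((kb + 1 + r) * q)%N => A B C D; clear; lia.
Qed.

Lemma count_weight (p s kb : nat) : (2 < p)%N -> (s <= p - 2)%N ->
  ((k_eps p s + (p - 1) * kb - 2 + (p ^ 2 - p) - p.+1 * s) %/ (p ^ 2 - 1) =
   (kb + p - delta_eps p s - s) %/ p.+1)%N.
Proof.
case: p => // q q2 sp; have dl := delta_eps_le1 q2 sp; move: dl.
rewrite /k_eps /delta_eps subn1 /=; have := divn_eq (2 * s) q.
set d := (_ %/ _)%N; set u := (_ %% _)%N; move: d u => d u sd dl.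
have q0 : (0 < q)%N by lia.
have -> : (q.+1 ^ 2 - q.+1 = q.+1 * q)%N by rewrite -mulnn mulnS addKn.
have -> : (q.+1 ^ 2 - 1 = q * q.+2)%N by rewrite -{2}(exp1n 2) subn_sqr subn1 addn1.
rewrite (@count_weight_aux _ _ d _ (q - (s + d))) //; last first.
  by move: sp dl q0; clear; lia.
rewrite divnMA mulnK //; congr (_ %/ _)%N.
by move: sp dl q2; clear; lia.
Qed.

(** Subtracting 1 outside keeps the numerator natural: kb - t_eps may be negative, but kb - t_eps +
    (p + 1) is not, as t_eps <= p. The sign of the count is then evident. *)
Lemma floor_natr_div (a b : nat) : (0 < b)%N ->
  Num.floor (a%:R / b%:R - 1 : rat) = (a %/ b)%N%:Z - 1.
Proof.
move=> b0; apply: floor_def; have b0' : (0 : rat) < b%:R by rewrite ltr0n.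
rewrite subrK rmorphB lerD2r ltrBlDr natr1 ler_pdivlMr // ltr_pdivrMr //.
change (((a %/ b)%N%:R : rat) * b%:R <= (a%:R : rat) < ((a %/ b).+1%:R : rat) * b%:R).
by rewrite -!natrM ler_nat ltr_nat leq_trunc_div ltn_ceil.
Qed.

(** The floor costs at most 1, and replacing N by k at most M/D <= M. *)
Lemma divn_approx (N D k M : nat) : (0 < D)%N -> (N <= k + M)%N -> (k <= N + M)%N ->
  `|(N %/ D)%N%:R - k%:R / D%:R| <= (M + 1)%:R :> rat.
Proof.
move=> D0 NkM kNM; have D0' : (0 : rat) < D%:R by rewrite ltr0n.
have -> : (N %/ D)%N%:R - k%:R / D%:R = ((N %/ D)%N%:R * D%:R - k%:R) / D%:R :> rat.
  by field; rewrite gt_eqF.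
rewrite normrM normfV [`|D%:R|]gtr0_norm // ler_pdivrMr // -!natrM.
rewrite ler_norml; apply/andP; split.
  rewrite lerBrDr addrC lerBlDr -natrD ler_nat.
  have := ltn_ceil N D0; nia.
rewrite lerBlDr -natrD ler_nat; have := leq_trunc_div N D; nia.
Qed.

Theorem proposition3p2 (p : nat) (Qp : padicField p)
    (L : closedFieldType) (iota : {rmorphism Qp -> L})
    (E : fieldExtType Qp) (F : fieldType)
    (red : {rmorphism integers E -> F}) (varpi : integers E)
    (rho : (L -> L) -> 'M[F]_2)
    (H : lmodType (iwasawa E)^c) (act : H -> 'M[Qp]_2 -> H) (e : H) (s : nat) :
  prime p -> (11 <= p)%N ->
  is_algebraic_closure iota ->
  is_residue_field red varpi ->
  tres_ramifiee iota rho ->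
  primitive_augmented red varpi act ->
  normalized act e ->
  (s <= p - 2)%N ->
  [/\ forall kb : nat,
        let k := (k_eps p s + (p - 1) * kb)%N in
        let r := Num.floor ((kb%:R - (t_eps p s)%:R) / (p + 1)%:R : rat) + 1 in
        (d_ur H s k)%:Z = r /\ 0 <= r,
      forall k : nat, (2 <= k)%N -> k = k_eps p s %[mod p - 1] ->
        d_ur H s (k + p ^ 2 - 1) = (d_ur H s k + 1)%N,
      exists C : rat, forall k : nat, (2 <= k)%N -> k = k_eps p s %[mod p - 1] ->
        `|(d_ur H s k)%:R - k%:R / (p ^ 2 - 1)%:R| <= C &
      exists C : rat, forall k : nat, (2 <= k)%N -> k = k_eps p s %[mod p - 1] ->
        `|(d_new H s k)%:~R - k%:R / (p + 1)%:R| <= C].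
Proof.
move=> _ p11 _ res _ pam nrm sp.
have p2 : (p ^ 2 = p * p)%N by rewrite -mulnn.
have p_gt2 : (2 < p)%N by lia.
have D0 : (0 < p ^ 2 - 1)%N by nia.
have k2s k : (2 <= k)%N -> k = k_eps p s %[mod p - 1] -> (k - 2 = 2 * s %[mod p.-1])%N.
  move=> k2 /eqP; rewrite /k_eps subn1 -{1}(subnKC k2) eqn_modDl => /eqP ->.
  by rewrite modn_mod.
have dur k : (2 <= k)%N -> k = k_eps p s %[mod p - 1] ->
    d_ur H s k = ((k - 2 + (p ^ 2 - p) - p.+1 * s) %/ (p ^ 2 - 1))%N.
  by move=> k2 /(k2s _ k2); apply: (d_ur_eq p_gt2 res pam nrm).
have ps : (p.+1 * s <= p ^ 2 - p)%N by nia.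
(* The numerator exceeds k - 2 by p^2 - p - (p+1)s, which lies between 0 and p^2. *)
have dur_approx k : (2 <= k)%N -> k = k_eps p s %[mod p - 1] ->
    `|(d_ur H s k)%:R - k%:R / (p ^ 2 - 1)%:R| <= (p ^ 2 + 2 + 1)%:R :> rat.
  by move=> k2 kk; rewrite dur //; apply: divn_approx => //; lia.
split.
- move=> kb k r; rewrite /r.
  have k2 : (2 <= k)%N by rewrite /k /k_eps -addnA leq_addr.
  have kk : k = k_eps p s %[mod p - 1] by rewrite /k addnC mulnC modnMDl.
  have dl := delta_eps_le1 p_gt2 sp.
  rewrite dur // /k count_weight //.
  have -> : (kb%:R - (t_eps p s)%:R) / (p + 1)%:R =
      (kb + p - delta_eps p s - s)%N%:R / p.+1%:R - 1 :> rat.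
    have -> : (kb + p - delta_eps p s - s)%N%:R = kb%:R - (t_eps p s)%:R + p.+1%:R :> rat.
      apply/eqP; rewrite -addrA [_ + p.+1%:R]addrC addrA eq_sym subr_eq -!natrD eqr_nat /t_eps.
      by apply/eqP; lia.
    by rewrite [in RHS]mulrDl mulfV ?pnatr_eq0 // addrK addn1.
  by rewrite floor_natr_div // subrK.
- move=> k k2 kk; have k2' : (2 <= k + p ^ 2 - 1)%N by lia.
  have kk' : k + p ^ 2 - 1 = k_eps p s %[mod p - 1].
    have -> : (k + p ^ 2 - 1 = (p + 1) * (p - 1) + k)%N by nia.
    by rewrite modnMDl.
  rewrite !dur //.
  have -> : (k + p ^ 2 - 1 - 2 + (p ^ 2 - p) - p.+1 * s =
    (k - 2 + (p ^ 2 - p) - p.+1 * s) + (p ^ 2 - 1))%N.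
    by move: (p ^ 2)%N (p.+1 * s)%N D0 ps k2 => P S; clear; lia.
  by rewrite divnDr ?dvdnn // divnn D0.
- by exists (p ^ 2 + 2 + 1)%:R.
exists ((p + 2 + 1)%:R + 2%:R * (p ^ 2 + 2 + 1)%:R) => k k2 kk.
have p10 : (0 < p.-1)%N by lia.
have dIw : `|(d_Iw H s k)%:R - k%:R / p.-1%:R| <= (p + 2 + 1)%:R :> rat.
  rewrite (d_Iw_eq p_gt2 nrm (pam_extends pam)) //; last by lia.
  by apply: divn_approx => //; lia.
have dU := dur_approx k k2 kk.
(* The leading terms combine as 1/(p-1) - 2/(p^2-1) = 1/(p+1). *)
have -> : (d_new H s k)%:~R - k%:R / (p + 1)%:R =
    ((d_Iw H s k)%:R - k%:R / p.-1%:R) - 2%:R * ((d_ur H s k)%:R - k%:R / (p ^ 2 - 1)%:R) :> rat.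
  rewrite /d_new rmorphB rmorphM /= -!pmulrn.
  have -> : (p ^ 2 - 1)%N%:R = p.-1%:R * (p + 1)%:R :> rat.
    by rewrite -natrM; congr (_%:R); nia.
  have -> : (p + 1)%:R = p.-1%:R + 2%:R :> rat by rewrite -natrD; congr (_%:R); lia.
  have h1 : (p.-1%:R : rat) != 0 by rewrite pnatr_eq0; lia.
  have h2 : (p.-1%:R + 2%:R : rat) != 0 by rewrite -natrD pnatr_eq0; lia.
  by field; rewrite h1 h2.
apply: le_trans (ler_normB _ _) _; apply: lerD => //.
by rewrite normrM ger0_norm ?ler0n // ler_pM2l // ltr0n.
Qed.
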